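(* Let $n\ge 1$. The function $\mathcal{J}_n^n$ on $X_{2n}(E)$ has the following properties. (1) For every $B\in X_{2n}(E)$ and every block-diagonal $g\in GL_n(O_E)\times GL_n(O_E)\subset GL_{2n}(O_E)$, $\mathcal{J}_n^n({}^tg^*Bg)=\mathcal{J}_n^n(B)$. (2) For every $B\in X_{2n}(E)$, $\mathcal{J}_n^n(B)=\mathcal{J}_n^n(B^{\vee_n})$. (3) If $B=\begin{pmatrix} 1_n & 0 \\ 0 & B_2 \end{pmatrix}$ with $B_2\in X_n(E)$, then $\mathcal{J}_n^n(B)=\dfrac{\alpha'(1_n,\pi B_2)}{\alpha(1_n,1_n)}$.
   Context: Let $p$ be an odd prime, $F$ a finite unramified extension of $\mathbb{Q}_p$ with ring of integers $O_F$, residue field $\mathbb{F}_q$ and uniformizer $\pi$. Let $E/F$ be the unramified quadratic extension, $O_E$ its ring of integers, ${}^*$ the nontrivial automorphism of $E/F$. For a matrix $X$ over $E$, ${}^tX^*$ is the conjugate transpose. Put $V_k(E)=\{Y\in M_{k,k}(E):{}^tY^*=Y\}$, $X_k(E)=V_k(E)\cap GL_k(E)$, $V_k(O_E)=V_k(E)\cap M_{k,k}(O_E)$; $\langle X,Y\rangle=\mathrm{Tr}(XY)$; $A[X]={}^tX^*AX$. Let $\psi:F\to\mathbb{C}^\times$ be an additive character trivial on $O_F$ but not on $\pi^{-1}O_F$. For $0\le t\le n$, $0\le h\le 2n$ and integers $r\ge 0$ let $A_t=\mathrm{diag}(1_{2n-t},\pi^{-1}1_t)$, $A_t^{[r]}=\mathrm{diag}(A_t,1_{2r})$,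 and let $1_{h,t}^{[r]}$ be the characteristic function of the set of $X\in M_{2n+2r,2n}(O_E)$ whose entries in rows $2n-t+1,\dots,2n$ and columns $1,\dots,2n-h$ lie in $\pi O_E$. For $B\in X_{2n}(E)$ define $$W_{h,t}(B,r)=\int_{V_{2n}(E)}\int_{M_{2n+2r,2n}(E)}\psi(\langle Y,A_t^{[r]}[X]-B\rangle)\,1_{h,t}^{[r]}(X)\,dX\,dY,$$ with Haar measures giving $V_{2n}(O_E)$ and $M_{2n+2r,2n}(O_E)$ volume $1$ (the outer integral being understood as the limit of the integrals over $\pi^{-k}V_{2n}(O_E)$, $k\to\infty$). As a function of $r$ it is a polynomial in $x=(-q)^{-2r}$; $W_{h,t}(B,0)$ is its value at $r=0$ (i.e. $x=1$) and $W'_{h,t}(B,0)=-\frac{d}{dx}W_{h,t}(B,r)\big|_{x=1}$. For $X=\begin{pmatrix} A & B \\ C & D \end{pmatrix}\in X_{2n}(E)$ with $A$ of size $(2n-h)\times(2n-h)$ and $D$ of size $h\times h$, set $X^{\vee_h}=\begin{pmatrix} \pi D & C \\ B & \pi^{-1}A \end{pmatrix}$. The constants $\beta_i^h,\beta_j^{2n-h}$ ($0\le i,j\le n-1$) and $\delta_h$ are the unique constants such that for all $B\in X_{2n}(E)$ $$W_{h,n}'(B,0)-W_{2n-h,n}'(B^{\vee_h},0)=\sum_{i=0}^{n-1}\beta_i^hW_{h,i}(B,0)-\sum_{j=0}^{n-1}\beta_j^{2n-h}W_{2n-h,j}(B^{\vee_h},0)+\delta_hW_{h,n}(B,0).$$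 Define $\mathcal{J}_n^n(B)=\frac{1}{W_{n,n}(A_n,0)}\{W'_{n,n}(B,0)-\sum_{0\le i\le n-1}\beta_i^nW_{n,i}(B,0)\}$. Representation densities: for $A\in V_m(O_E)$ and a hermitian $k\times k$ matrix $B$ over $E$, $\alpha(A,B)=\lim_{d\to\infty}q^{-dk(2m-k)}\,\#\{x\in M_{m,k}(O_E/\pi^dO_E): A[x]\equiv B \bmod \pi^d\}$ (so it is $0$ if $B$ is not integral). As a function of $r$, $\alpha(\mathrm{diag}(A,1_{2r}),B)$ is a polynomial in $x=(-q)^{-2r}$, and $\alpha'(A,B)=-\frac{d}{dx}\alpha(\mathrm{diag}(A,1_{2r}),B)\big|_{x=1}$. *)

(* Defs.v *)
From HB Require Import structures.
From mathcomp Require Import all_boot all_order all_algebra all_field.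
From mathcomp Require Import finmap complex.
From mathcomp Require Import all_classical all_reals all_analysis.

Set Implicit Arguments.
Unset Strict Implicit.
Unset Printing Implicit Defensive.

Import Order.TTheory GRing.Theory Num.Theory numFieldNormedType.Exports.

Local Open Scope classical_set_scope.
Local Open Scope ring_scope.
Local Open Scope complex_scope.
Local Open Scope sesquilinear_scope.

(* Only the values of [v] at nonzero elements are meaningful: v 0 stands for
   +oo, so "v x >= d" must always be written [vge v d x]. *)
Definition vge (K : fieldType) (v : K -> int) (d : int) (x : K) : Prop :=
  x = 0 \/ d <= v x.

Definition normalized_valuation (K : fieldType) (v : K -> int) : Prop :=
  [/\ forall x y, x != 0 -> y != 0 -> v (x * y) = v x + v y,
      forall d x y, vge v d x -> vge v d y -> vge v d (x + y) &
      exists2 x, x != 0 & v x = 1].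

Definition uniformizer (K : fieldType) (v : K -> int) (x : K) : Prop :=
  x != 0 /\ v x = 1.

Definition vcomplete (K : fieldType) (v : K -> int) : Prop :=
  forall u : nat -> K,
    (forall d, exists N, forall i j, (N <= i)%N -> (N <= j)%N ->
       vge v d (u i - u j)) ->
    exists l, forall d, exists N, forall i, (N <= i)%N -> vge v d (u i - l).

(* (K, v) is the completion of the rationals for the p-adic valuation; this
   determines (K, v) up to a unique isomorphism. *)
Definition is_Qp (p : nat) (K : fieldType) (v : K -> int) : Prop :=
  [/\ normalized_valuation v,
      forall m : nat, (0 < m)%N -> v m%:R = (logn p m)%:Z,
      forall (d : int) (x : K), exists a : rat, vge v d (x - ratr a) &
      vcomplete v].

(* The extension L/K (finite, since L is a [fieldExtType K]) is unramified:
   the normalized valuation of L extends that of K. Residue fields are finite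
   here, so that the residue extension is automatically separable. *)
Definition unramified (K : fieldType) (v : K -> int)
    (L : fieldExtType K) (w : L -> int) : Prop :=
  normalized_valuation w /\ forall a : K, a != 0 -> w a%:A = v a.

(* The number of cosets of the subgroup [L] that meet [A]. *)
Definition ncosets (V : zmodType) (L A : set V) : nat :=
  #|` fset_set [set [set y | L (y - x)] | x in A]|.

Definition residue_card (K : fieldType) (v : K -> int) : nat :=
  ncosets (vge v 1) (vge v 0).

Section Borel.
Variable V : zmodType.

(* The topology on [V] in which the subgroups [L d] form a neighbourhood basis
   of 0. *)
Definition lattice_open (L : int -> set V) : set (set V) :=
  [set U | forall x, U x -> exists d, forall y, L d (y - x) -> U y].

Definition pointed_zmod : Type := V.
HB.instance Definition _ := GRing.Zmodule.on pointed_zmod.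
HB.instance Definition _ := isPointed.Build pointed_zmod (0 : V).

Variable L : int -> set V.

Definition borel : Type :=
  @g_sigma_algebraType pointed_zmod (lattice_open L).
HB.instance Definition _ := Measurable.copy borel
  (@g_sigma_algebraType pointed_zmod (lattice_open L)).

Definition normalized_haar (R : realType)
    (mu : {measure set borel -> \bar R}) : Prop :=
  mu (L 0 : set V) = 1%:E /\
  forall (x : V) (A : set borel), measurable A ->
    mu [set x + y | y in (A : set V)] = mu A.

End Borel.

Definition cintegral d (T : measurableType d) (R : realType)
    (mu : {measure set T -> \bar R}) (D : set T) (f : T -> R[i]) : R[i] :=
  Complex (Rintegral mu D (fun x => complex.Re (f x)))
          (Rintegral mu D (fun x => complex.Im (f x))).

Definition clim (R : realType) (u : nat -> R[i]) : R[i] :=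
  lim ((u : nat -> R[i]^o) @ \oo).

Section PolynomialInX.
Variables (R : realType) (q : nat) (f : nat -> R[i]).

(* The polynomial P with f r = P(x) for x = (-q)^(-2r), r >= 0; it is unique
   as soon as q > 1. *)
Definition xpoly : {poly R[i]} :=
  xget 0 [set P : {poly R[i]} |
          forall r : nat, P.[(- q%:R) ^- (2 * r)] = f r].

Definition xderiv : R[i] := - (xpoly^`()).[1].

End PolynomialInX.

Section Hermitian.
Variables (F : fieldType) (E : fieldExtType F) (conj : 'AEnd(E)) (k : nat).

Definition hermmx : qualifier 0 'M[E]_k := [qualify Y | Y ^t conj == Y].

Fact hermmx_zmod_closed : zmod_closed hermmx.
Proof.
split=> [|X Y]; rewrite !qualifE /=; first by rewrite trmx0 map_mx0.
by move=> /eqP hX /eqP hY; rewrite linearB /= map_mxB hX hY.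
Qed.

HB.instance Definition _ :=
  GRing.isZmodClosed.Build 'M[E]_k (has_quality 0 hermmx) hermmx_zmod_closed.

Record herm := Herm { herm_val :> 'M[E]_k; _ : herm_val \is hermmx }.
HB.instance Definition _ := [isSub for herm_val].
HB.instance Definition _ := [Choice of herm by <:].
HB.instance Definition _ := [SubChoice_isSubZmodule of herm by <:].

Definition nondeg_herm (B : 'M[E]_k) : Prop :=
  B \is hermmx /\ B \in unitmx.

End Hermitian.

(* A[X] *)
Definition hact (F : fieldType) (E : fieldExtType F) (conj : 'AEnd(E)) m k
    (A : 'M[E]_m) (X : 'M[E]_(m, k)) : 'M[E]_k :=
  X ^t conj *m A *m X.

Section Lattices.
Variables (F : fieldType) (E : fieldExtType F) (vE : E -> int).
Variable conj : 'AEnd(E).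

(* The lattice pi^d M_{m,k}(O_E). *)
Definition mxge m k (d : int) : set 'M[E]_(m, k) :=
  [set X | forall i j, vge vE d (X i j)].

(* The lattice pi^d V_k(O_E). *)
Definition hermge k (d : int) : set (herm conj k) :=
  [set Y | mxge d (Y : 'M[E]_k)].

Definition GLO k (g : 'M[E]_k) : Prop :=
  [/\ g \in unitmx, mxge 0 g & mxge 0 (invmx g)].

End Lattices.

Section Densities.
Variable R : realType.
Variables (F : fieldType) (E : fieldExtType F).
Variables (vF : F -> int) (vE : E -> int) (conj : 'AEnd(E)).

Local Notation q := (residue_card vF).

Definition alpha m k (A : 'M[E]_m) (B : 'M[E]_k) : R[i] :=
  clim (fun d : nat =>
    q%:R ^ (- ((d * k)%:Z * ((2 * m)%:Z - k%:Z))) *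
    (ncosets (mxge vE d%:Z)
       [set X : 'M[E]_(m, k) |
          mxge vE 0 X /\ mxge vE d%:Z (hact conj A X - B)])%:R).

Definition alpha' m k (A : 'M[E]_m) (B : 'M[E]_k) : R[i] :=
  xderiv q (fun r => alpha (block_mx A 0 0 1%:M : 'M[E]_(m + 2 * r)) B).

End Densities.

Section Whittaker.
Variable R : realType.
Variables (F : fieldType) (E : fieldExtType F).
Variables (vF : F -> int) (vE : E -> int) (conj : 'AEnd(E)).
Variables (pi : F) (psi : F -> R[i]).
Variable muM : forall m k, {measure set (borel (@mxge _ _ vE m k)) -> \bar R}.
Variable muV : forall k, {measure set (borel (@hermge _ _ vE conj k)) -> \bar R}.
Variable n : nat.

Local Notation q := (residue_card vF).
Local Notation piE := (pi%:A : E).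

Definition At (t : nat) : 'M[E]_(n + n) :=
  diag_mx (\row_(i < n + n) (if (i < n + n - t)%N then 1 else piE^-1)).

Definition Atr (t r : nat) : 'M[E]_(n + n + 2 * r) :=
  block_mx (At t) 0 0 1%:M.

(* Rows and columns are numbered from 0. *)
Definition support_ht (h t r : nat) : set 'M[E]_(n + n + 2 * r, n + n) :=
  [set X | mxge vE 0 X /\
     forall (i : 'I_(n + n + 2 * r)) (j : 'I_(n + n)),
       (n + n - t <= i < n + n)%N -> (j < n + n - h)%N ->
       vge vE 1 (X i j)].

Arguments support_ht : clear implicits.

(* <Y, Z> = Tr(YZ) lies in F for hermitian Y and Z; [pairF] is the
   corresponding element of F. *)
Definition pairF (Y Z : 'M[E]_(n + n)) : F :=
  xget 0 [set a : F | a%:A = \tr (Y *m Z)].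

Definition W (h t : nat) (B : 'M[E]_(n + n)) (r : nat) : R[i] :=
  clim (fun k : nat =>
    cintegral (muV (n + n)) (hermge vE (- k%:Z)) (fun Y : herm conj (n + n) =>
      cintegral (muM (n + n + 2 * r) (n + n)) setT
        (fun X : 'M[E]_(n + n + 2 * r, n + n) =>
           psi (pairF Y (hact conj (Atr t r) X - B)) *
           \1_(support_ht h t r) X))).

Definition W' (h t : nat) (B : 'M[E]_(n + n)) : R[i] :=
  xderiv q (W h t B).

Definition vee (h : nat) (hn : (h <= n + n)%N) (X : 'M[E]_(n + n))
    : 'M[E]_(n + n) :=
  let X' : 'M[E]_(n + n - h + h) :=
    castmx (esym (subnK hn), esym (subnK hn)) X in
  castmx (subnKC hn, subnKC hn)
    (block_mx (piE *: drsubmx X') (dlsubmx X')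
              (ursubmx X') (piE^-1 *: ulsubmx X')).

(* c = (beta^h, beta^{2n-h}, delta_h) *)
Definition constants_eq (h : nat) (hn : (h <= n + n)%N)
    (c : {ffun 'I_n -> R[i]} * {ffun 'I_n -> R[i]} * R[i]) : Prop :=
  let: (b, b', d) := c in
  forall B : 'M[E]_(n + n), nondeg_herm conj B ->
    W' h n B - W' (n + n - h) n (vee hn B) =
    \sum_(i < n) b i * W h i B 0
    - \sum_(j < n) b' j * W (n + n - h) j (vee hn B) 0
    + d * W h n B 0.

Definition calJ (beta : {ffun 'I_n -> R[i]}) (B : 'M[E]_(n + n)) : R[i] :=
  (W n n (At n) 0)^-1 * (W' n n B - \sum_(i < n) beta i * W n i B 0).

End Whittaker.

(* Main.v *)
Require Import Defs.
From HB Require Import structures.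
From mathcomp Require Import all_boot all_order all_algebra all_field.
From mathcomp Require Import finmap complex.
From mathcomp Require Import all_classical all_reals all_analysis.
From mathcomp Require Import ring zify.
Import Order.TTheory GRing.Theory Num.Theory numFieldNormedType.Exports.
Local Open Scope classical_set_scope.
Local Open Scope ring_scope.
Local Open Scope complex_scope.

(** The defining relation of the constants, applied to B, says
      J(B) - J(B^vee) = delta W(B, 0) / W(A_n, 0),   W = W_{n,n}.
    As A_n^vee = A_n, the same relation at B = A_n gives delta W(A_n, 0) = 0;
    hence J(B) = J(B^vee), which is (2); if W(A_n, 0) = 0 both sides are 0.

    For the other two parts the Whittaker integrals are turned into numbers of
    solutions. The k-th term of the limit that defines W_{h,t}(B, r) is an
    integral over Y in pi^-k V(O_E) and over X. The lattice V(O_E) is its own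
    dual, because E/F is unramified and p is odd, so by orthogonality of
    characters this term is a power of q times the number of X modulo pi^(k+1),
    in the support of the test function, with A_t[X] = B modulo pi^k
    ([Whittaker_term]). A block diagonal g in GL_n(O_E) x GL_n(O_E) acts by
    X |-> X g on these solutions ([ncosets_solutions_mulr]), which proves (1).

    For (3), B = diag(1_n, B_2) has B^vee = diag(pi B_2, pi^-1 1_n), and by (2)
    it is enough to compute J(B^vee). Two facts suffice.
    - If t < n then A_t does not represent pi^-1 1_n, since pi A_t has rank t
      modulo pi ([solutions_empty]); so W_{n,t}(B^vee, 0) = 0 and only W'(B^vee)
      is left.
    - A solution of A_n[X] = diag(C, pi^-1 1_n) is X = (X1 | X2), where X2 spans
      a pi^-1-modular lattice that splits off; its complement is unimodular of
      rank n + 2r, and X1 is an arbitrary representation of C by it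
      ([assemble_solutions]). The splitting is made explicit by the identity
      [push_through] and by square roots of hermitian matrices congruent to 1
      ([hermitian_sqrt]). The number of possible X2 does not depend on r and, up
      to a power of q, not on k either ([ncosets_unitary]). Therefore
      W(diag(C, pi^-1 1_n), r) = K alpha(1_{n+2r}, C) with a constant K <> 0
      ([Whittaker_dual]).
    Taking C = pi B_2 and differentiating gives W'(B^vee) = K alpha'(1_n, pi B_2);
    taking C = 1_n and r = 0 gives W(A_n, 0) = K alpha(1_n, 1_n). The quotient
    is (3). The factor K relates the terms of the two limits one by one, so it
    passes through the limit and through the derivative also where these are
    default values ([clim_scale], [xderiv_scale]).

    The arithmetic input consists of three facts about the given fields: the
    residue field of F is finite, the involution of E preserves the valuation,
    and O_E = O_F + O_F eps with conj(eps) = -eps. The first two come from an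
    integral basis of F over the p-adic numbers ([exists_integral_basis]), which
    makes F complete: a unit x whose conjugate y is not a unit would be the
    limit of the ratios of traces (x^(k+1) + y^(k+1)) / (x^k + y^k), hence lie
    in F ([conj_not_small]). *)

Set Implicit Arguments.
Unset Strict Implicit.
Unset Printing Implicit Defensive.

(** * Valuations *)

Section Valuation.
Variables (K : fieldType) (v : K -> int).
Hypothesis Hv : normalized_valuation v.

Lemma valM x y : x != 0 -> y != 0 -> v (x * y) = v x + v y.
Proof. by case: Hv => H _ _; exact: H. Qed.

Lemma vgeD d x y : vge v d x -> vge v d y -> vge v d (x + y).
Proof. by case: Hv => _ H _; exact: H. Qed.

Lemma val1 : v 1 = 0.
Proof.
by have := valM (oner_neq0 K) (oner_neq0 K); rewrite mulr1; move: (v 1) => a; lia.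
Qed.

Lemma valN1 : v (-1) = 0.
Proof.
have h : (-1 : K) != 0 by rewrite oppr_eq0 oner_neq0.
by have := valM h h; rewrite mulrNN mulr1 val1; move: (v _) => a; lia.
Qed.

Lemma valV x : x != 0 -> v x^-1 = - v x.
Proof.
move=> x0; have x0' : x^-1 != 0 by rewrite invr_eq0.
by have := valM x0 x0'; rewrite divff// val1; lia.
Qed.

Lemma valN x : v (- x) = v x.
Proof.
have [->|x0] := eqVneq x 0; first by rewrite oppr0.
by rewrite -mulN1r valM ?oppr_eq0 ?oner_neq0// valN1 add0r.
Qed.

Lemma valX x n : x != 0 -> v (x ^+ n) = n%:Z * v x.
Proof.
move=> x0; elim: n => [|n IH]; first by rewrite expr0 val1 mul0r.
by rewrite exprS valM ?expf_neq0// IH; lia.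
Qed.

Lemma valXz x (d : int) : x != 0 -> v (x ^ d) = d * v x.
Proof.
move=> x0; case: d => n; first by rewrite -exprnP valX.
by rewrite NegzE -exprnN valV ?expf_neq0// valX//; lia.
Qed.

Lemma vge0 d : vge v d 0. Proof. by left. Qed.

Lemma vge_nz d x : x != 0 -> vge v d x -> d <= v x.
Proof. by move=> /eqP x0 [|]. Qed.

Lemma vgeN d x : vge v d x -> vge v d (- x).
Proof. by case=> [->|h]; [rewrite oppr0; left|right; rewrite valN]. Qed.

Lemma vgeB d x y : vge v d x -> vge v d y -> vge v d (x - y).
Proof. by move=> hx hy; apply: vgeD => //; exact: vgeN. Qed.

Lemma vgeBC d x y : vge v d (x - y) -> vge v d (y - x).
Proof. by move/vgeN; rewrite opprB. Qed.

Lemma vgeM d e x y : vge v d x -> vge v e y -> vge v (d + e) (x * y).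
Proof.
have [->|x0] := eqVneq x 0; first by rewrite mul0r => *; left.
have [->|y0] := eqVneq y 0; first by rewrite mulr0 => *; left.
move=> /(vge_nz x0) hx /(vge_nz y0) hy; right.
by rewrite valM//; lia.
Qed.

Lemma vgeW d e x : e <= d -> vge v d x -> vge v e x.
Proof. by move=> ed [->|h]; [left|right; lia]. Qed.

Lemma vge01 : vge v 0 1. Proof. by right; rewrite val1. Qed.

Lemma vgeMl d x y : vge v 0 x -> vge v d y -> vge v d (x * y).
Proof. by move=> hx hy; have := vgeM hx hy; rewrite add0r. Qed.

Lemma vgeMr d x y : vge v d x -> vge v 0 y -> vge v d (x * y).
Proof. by move=> hx hy; have := vgeM hx hy; rewrite addr0. Qed.

Lemma vge_sum d (I : Type) (r : seq I) (P : pred I) (f : I -> K) :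
  (forall i, P i -> vge v d (f i)) -> vge v d (\sum_(i <- r | P i) f i).
Proof.
move=> h; elim/big_rec: _ => [|i x Pi hx]; first exact: vge0.
by apply: vgeD => //; exact: h.
Qed.

Lemma vge_prod (I : Type) (r : seq I) (P : pred I) (f : I -> K) :
  (forall i, P i -> vge v 0 (f i)) -> vge v 0 (\prod_(i <- r | P i) f i).
Proof.
move=> h; elim/big_rec: _ => [|i x Pi hx]; first exact: vge01.
by apply: vgeMl => //; exact: h.
Qed.

Lemma vge_scale x d e y : x != 0 -> v x = e -> vge v (d + e) (x * y) <-> vge v d y.
Proof.
move=> x0 <-; split; last first.
  by rewrite addrC => hy; apply: vgeM => //; right.
move=> h; rewrite -(mulKf x0 y).
have -> : d = - v x + (d + v x) by lia.
by apply: vgeM => //; right; rewrite valV.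
Qed.

Lemma vge_lim0 x : (forall n : nat, vge v n%:Z x) -> x = 0.
Proof.
move=> h; apply/eqP/negPn/negP => x0.
have := vge_nz x0 (h `|v x|.+1%N); lia.
Qed.

Lemma not_vge1 x : vge v 0 x -> ~ vge v 1 x -> x != 0 /\ v x = 0.
Proof.
move=> h0 h1; have x0 : x != 0 by apply/negP => /eqP e; apply: h1; left.
split=> //; have := vge_nz x0 h0.
have : ~ (1 <= v x) by move=> h; apply: h1; right.
lia.
Qed.

Lemma not_vge11 : ~ vge v 1 1.
Proof. by case=> [/eqP|]; rewrite ?oner_eq0 ?val1. Qed.

Lemma unit_perturb x y : vge v 1 (x - y) -> y != 0 -> v y = 0 -> x != 0 /\ v x = 0.
Proof.
move=> h y0 vy; apply: not_vge1.
  by rewrite -(subrK y x); apply: vgeD; [exact: vgeW h|right; rewrite vy].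
move=> hx; have : vge v 1 y by rewrite -(subKr x y); exact: vgeB.
by move/(vge_nz y0); rewrite vy.
Qed.

End Valuation.

(** * Integral bases of unramified extensions *)

Section IntegralBasis.
Variables (K : fieldType) (v : K -> int) (L : fieldExtType K) (w : L -> int).
Hypothesis Hv : normalized_valuation v.
Hypothesis Hu : unramified v w.

Let Hw : normalized_valuation w. Proof. by case: Hu. Qed.

Lemma vge_in_alg d a : vge w d (a%:A : L) <-> vge v d a.
Proof.
have [->|a0] := eqVneq a 0; first by rewrite scale0r; split=> _; left.
have a0' : (a%:A : L) != 0 by rewrite scaler_eq0 oner_eq0 orbF.
have e : w a%:A = v a by case: Hu => _; exact.
by split=> [/(vge_nz a0')|/(vge_nz a0)]; rewrite ?e => h; right; rewrite ?e.
Qed.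

Lemma vgeZ d e a x : vge v d a -> vge w e x -> vge w (d + e) (a *: x).
Proof.
by move=> /vge_in_alg ha hx; rewrite -mulr_algl; exact: vgeM ha hx.
Qed.

(** The residues of the [x i] are linearly independent over the residue field
   of [K]; quantifying over integral coefficients avoids constructing residue
   fields. *)
Definition residue_free m (x : 'I_m -> L) : Prop :=
  (forall i, vge w 0 (x i)) /\
  forall c : 'I_m -> K, (forall i, vge v 0 (c i)) ->
    vge w 1 (\sum_i c i *: x i) -> forall i, vge v 1 (c i).

(** Dividing by a coefficient of smallest valuation turns any dependence into
   one that contradicts residue independence; so the valuation of a
   combination is the smallest valuation of its coefficients. *)
Lemma residue_free_coord m (x : 'I_m -> L) : residue_free x ->
  forall d c, vge w d (\sum_i c i *: x i) -> forall i, vge v d (c i).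
Proof.
move=> [x0 xfree] d c hd i; apply: contrapT => hi.
have ci0 : c i != 0 by apply/negP => /eqP e; apply: hi; left.
case: (arg_minP (P := fun j => c j != 0) (v \o c) ci0) => j cj0 jmin.
have hj : v (c j) < d.
  have /= := jmin _ ci0; have : ~ (d <= v (c i)) by move=> h; apply: hi; right.
  by lia.
have := xfree (fun k => (c j)^-1 * c k).
move=> /(_ _ _ j)[]; last first.
- by rewrite mulVf// (val1 Hv).
- by rewrite mulVf// => /eqP; rewrite oner_eq0.
- have -> : \sum_k ((c j)^-1 * c k) *: x k = (c j)^-1 *: \sum_k c k *: x k.
    by rewrite scaler_sumr; apply: eq_bigr => k _; rewrite scalerA.
  have hh : vge w (- v (c j) + d) ((c j)^-1 *: \sum_k c k *: x k).
    by apply: vgeZ hd; right; rewrite (valV Hv).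
  by apply: vgeW hh; lia.
- move=> k; have [->|ck0] := eqVneq (c k) 0; first by rewrite mulr0; left.
  right; rewrite (valM Hv) ?invr_eq0// (valV Hv)//.
  by have /= := jmin _ ck0; lia.
Qed.

Lemma residue_free_dim m (x : 'I_m -> L) : residue_free x -> (m <= \dim {:L})%N.
Proof.
move=> xf; have xfr : free [tuple x i | i < m].
  apply/freeP => c hc i.
  have hc' : \sum_i c i *: x i = 0.
    by rewrite -[RHS]hc; apply: eq_bigr => j _; rewrite (nth_map j) ?size_enum_ord// nth_ord_enum.
  by apply: (vge_lim0 (v := v)) => d; apply: (residue_free_coord xf (d := d%:Z) (c := c)); rewrite hc'; left.
have := dimvS (subvf <<[tuple x i | i < m]>>%VS).
by move: xfr; rewrite /free size_tuple => /eqP ->.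
Qed.

(** A residue-independent family that cannot be enlarged generates the residue
   field, that is, the integers up to the maximal ideal. *)
Lemma exists_residue_basis : exists m (x : 'I_m -> L), residue_free x /\
  forall y, vge w 0 y -> exists c : 'I_m -> K,
    (forall i, vge v 0 (c i)) /\ vge w 1 (y - \sum_i c i *: x i).
Proof.
pose P m := `[< exists x : 'I_m -> L, residue_free x >].
have P0 : exists m, P m.
  by exists 0%N; apply/asboolP; exists (fun=> 0); split=> [[]|c _ _ []].
have Pb m : P m -> (m <= \dim {:L})%N by move=> /asboolP[x]; exact: residue_free_dim.
case: (ex_maxnP P0 Pb) => m /asboolP[x [x0 xf]] mmax.
exists m, x; split=> // y y0; apply: contrapT => hy.
suff : P m.+1 by move/mmax; rewrite ltnn.
apply/asboolP; exists (fun i => oapp x y (unlift ord0 i)); split.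
  by move=> i; case: unliftP => [j|] _ /=.
move=> c c0; rewrite big_ord_recl unlift_none /=.
under eq_bigr do rewrite liftK /=.
move=> hc.
have hc0 : vge v 1 (c ord0).
  apply: contrapT => h; have [n0 vc] := not_vge1 (c0 _) h.
  have hi : vge v 0 (c ord0)^-1 by right; rewrite (valV Hv)// vc.
  apply: hy; exists (fun i => - ((c ord0)^-1 * c (lift ord0 i))); split.
    by move=> i; apply: (vgeN Hv); apply: (vgeMl Hv).
  have := vgeZ hi hc; rewrite add0r scalerDr scalerA mulVf// scale1r.
  congr (vge _ _ (_ + _)); rewrite scaler_sumr -sumrN; apply: eq_bigr => i _.
  by rewrite scaleNr opprK scalerA.
have hx : vge w 1 (\sum_(i < m) c (lift ord0 i) *: x i).
  by have := vgeB Hw hc (vgeZ hc0 y0); rewrite addrC addKr.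
move=> i; case: (unliftP ord0 i) => [j ->|->//].
exact: (xf (fun k => c (lift ord0 k))).
Qed.

(** A residue basis with coefficients from a finite set of representatives
   covers the residue field of [L]. *)
Lemma residue_finite (T : finType) (s : T -> K) :
  (forall a, vge v 0 a -> exists t, vge v 1 (a - s t)) ->
  exists (T' : finType) (s' : T' -> L),
    forall y, vge w 0 y -> exists t, vge w 1 (y - s' t).
Proof.
move=> hs; have [m [x [[x0 _] hx]]] := exists_residue_basis.
exists {ffun 'I_m -> T}, (fun f : {ffun 'I_m -> T} => \sum_i s (f i) *: x i) => y /hx[c [c0 hc]].
have /choice[f hf] : forall i, exists t, vge v 1 (c i - s t) by move=> i; exact: hs.
exists [ffun i => f i].
rewrite -(subrK (\sum_i c i *: x i) y) -addrA; apply: (vgeD Hw) => //.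
rewrite -sumrB; apply: (vge_sum Hw) => i _.
by rewrite ffunE -scalerBl; rewrite -[1]addr0; exact: vgeZ.
Qed.

Hypothesis Hc : vcomplete v.

(** A residue basis expresses y modulo every power of the uniformizer; by
   [residue_free_coord] the coefficients of these approximations form Cauchy
   sequences, whose limits express y itself. *)
Lemma exists_integral_basis : exists m (x : 'I_m -> L), residue_free x /\
  forall y, exists c : 'I_m -> K, y = \sum_i c i *: x i.
Proof.
have [m [x [xf hx]]] := exists_residue_basis.
exists m, x; split=> //.
have [_ _ [pi pi0 vpi]] := Hv.
have approx y : vge w 0 y -> forall n : nat, exists c : 'I_m -> K,
    vge w n%:Z (y - \sum_i c i *: x i).
  move=> y0; elim=> [|n [c hc]].
    by exists (fun=> 0); rewrite big1 ?subr0// => i _; rewrite scale0r.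
  have hz : vge w 0 ((pi ^- n) *: (y - \sum_i c i *: x i)).
    have := vgeZ (a := pi ^- n) (d := - n%:Z) _ hc; rewrite addNr; apply.
    by right; rewrite (valV Hv) ?expf_neq0// (valX Hv)// vpi; lia.
  have [c' [_ hc']] := hx _ hz.
  exists (fun i => c i + pi ^+ n * c' i).
  have hp : vge v n%:Z (pi ^+ n) by right; rewrite (valX Hv)// vpi; lia.
  have := vgeZ hp hc'; rewrite scalerBr scalerA mulfV ?expf_neq0// scale1r.
  have -> : n%:Z + 1 = n.+1%:Z by lia.
  congr (vge _ _ _); rewrite -addrA -opprD; congr (_ - _).
  rewrite scaler_sumr -big_split; apply: eq_bigr => i _ /=.
  by rewrite scalerDl scalerA.
have int_span y : vge w 0 y -> exists c : 'I_m -> K, y = \sum_i c i *: x i.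
  move=> /approx /choice[c hc].
  have /choice[l hl] : forall i, exists l, forall d, exists N, forall k, (N <= k)%N -> vge v d (c k i - l).
    move=> i; apply: Hc => d; exists `|d|%N => j k dj dk.
    move: i; apply: (residue_free_coord xf (c := fun i => c j i - c k i)).
    under eq_bigr do rewrite scalerBl.
    rewrite sumrB -[_ - _](subrKA y) -opprB.
    have jj := hc j; have kk := hc k.
    apply: (vgeD Hw); first by apply: (vgeN Hw); apply: vgeW jj; lia.
    by apply: vgeW kk; lia.
  exists l; apply/eqP; rewrite -subr_eq0; apply/eqP; apply: (vge_lim0 (v := w)) => n.
  have /choice[N hN] : forall i, exists N, forall k, (N <= k)%N -> vge v n%:Z (c k i - l i).
    by move=> i; apply: hl.
  pose M := (n + \sum_i N i)%N.
  have hcM := hc M.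
  rewrite -(subrK (\sum_i c M i *: x i) y) -addrA; apply: (vgeD Hw).
    by apply: vgeW hcM; rewrite /M; lia.
  rewrite -sumrB; apply: (vge_sum Hw) => i _; rewrite -scalerBl.
  have -> : n%:Z = n%:Z + 0 by lia.
  apply: vgeZ; last by case: xf.
  by apply: hN; rewrite /M (bigD1 i)//=; lia.
move=> y; have [->|y0] := eqVneq y 0.
  by exists (fun=> 0); rewrite big1// => i _; rewrite scale0r.
have pz0 : pi ^ (- w y) != 0 by rewrite expfz_neq0.
have [|c hc] := int_span (pi ^ (- w y) *: y).
  rewrite -[0](addNr (w y)); apply: vgeZ; last by right.
  by right; rewrite (valXz Hv)// vpi; lia.
exists (fun i => pi ^ w y * c i).
under eq_bigr do rewrite -scalerA.
rewrite -scaler_sumr -hc scalerA -expfzDr// subrr expr0z scale1r.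
by [].
Qed.

(** In an integral basis the valuation is the minimum over the coordinates, so
   Cauchy sequences converge coordinate by coordinate. *)
Lemma unramified_complete : vcomplete w.
Proof.
have [m [x [xf hx]]] := exists_integral_basis.
move=> u hu; have /choice[c hc] := fun j => hx (u j).
have /choice[l hl] : forall i, exists l, forall d, exists N, forall k, (N <= k)%N -> vge v d (c k i - l).
  move=> i; apply: Hc => d; have [N hN] := hu d; exists N => j k Nj Nk.
  move: i; apply: (residue_free_coord xf (c := fun i => c j i - c k i)).
  under eq_bigr do rewrite scalerBl.
  by rewrite sumrB -!hc; exact: hN.
exists (\sum_i l i *: x i) => d.
have /choice[N hN] : forall i, exists N, forall k, (N <= k)%N -> vge v d (c k i - l i).
  by move=> i; apply: hl.
exists (\sum_i N i)%N => k hk; rewrite hc -sumrB.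
apply: (vge_sum Hw) => i _; rewrite -scalerBl -[d]addr0.
apply: vgeZ; last by case: xf.
by apply: hN; rewrite (leq_trans _ hk)// (bigD1 i)//= leq_addr.
Qed.

End IntegralBasis.

(** * The residue field of the p-adic numbers *)

Section Padic.
Variables (p : nat) (K : fieldType) (v : K -> int).
Hypotheses (pp : prime p) (HK : is_Qp p v).

Let Hv : normalized_valuation v. Proof. by case: HK. Qed.

(** If m = 0 then v(m) = v(p m), although their p-adic orders differ by 1. *)
Lemma padic_nat_neq0 m : (0 < m)%N -> (m%:R : K) != 0.
Proof.
move=> m0; apply/negP => /eqP e.
case: HK => _ h _ _; have := h _ m0; have := h (m * p)%N.
rewrite muln_gt0 m0 (prime_gt0 pp) natrM e mul0r => /(_ isT) ->.
by rewrite lognM ?(prime_gt0 pp)// (logn_prime p pp) eqxx; lia.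
Qed.

Lemma padic_vge_dvd (m : int) : (p%:Z %| m)%Z -> vge v 1 (m%:~R).
Proof.
move=> /dvdzP[k ->]; rewrite intrM; apply: (vgeMl Hv).
  elim/int_rec: k => [|n IH|n IH]; first by left.
    by rewrite -addn1 PoszD intrD; apply: (vgeD Hv) => //; exact: vge01.
  by rewrite -addn1 PoszD opprD intrD; apply: (vgeD Hv) => //; apply: (vgeN Hv); exact: vge01.
right; case: HK => _ -> //; last exact: prime_gt0.
by rewrite logn_prime// eqxx.
Qed.

(** Rational numbers are dense; one that approximates a p-adic integer modulo p
   has denominator prime to p, hence is congruent to one of 0, ..., p - 1. *)
Lemma padic_residue_finite a : vge v 0 a ->
  exists t : 'I_p, vge v 1 (a - (t : nat)%:R).
Proof.
case: HK => _ hnat hdense _ a0; have [r hr] := hdense 1 a.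
have r0 : vge v 0 (ratr r : K).
  by rewrite -(subKr a (ratr r)); apply: (vgeB Hv) => //; exact: vgeW hr.
have hd0 : ((denq r)%:~R : K) != 0.
  by rewrite -absz_denq; apply: padic_nat_neq0; rewrite absz_gt0 denq_eq0.
have nd : coprimez (p%:Z) (denq r).
  rewrite coprimezE /= prime_coprime//; apply/negP => pd.
  have pn : ~~ (p %| `|numq r|)%N.
    apply/negP => pn; have := coprime_num_den r.
    rewrite /coprime => /eqP; have := dvdn_gcd p `|numq r| `|denq r|.
    by rewrite pn pd => + e; rewrite e dvdn1 => /eqP e1; move: pp; rewrite e1.
  have n0 : (0 < `|numq r|)%N by case: `|numq r|%N pn; rewrite ?dvdn0.
  have h1 : vge v 1 ((denq r)%:~R * ratr r).
    by apply: (vgeMr Hv) => //; apply: padic_vge_dvd; rewrite /dvdz /=.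
  have e1 : ((denq r)%:~R * ratr r : K) = (numq r)%:~R.
    by rewrite /ratr mulrC divfK.
  rewrite e1 in h1.
  have : vge v 1 (`|numq r|%:R : K).
    case: (intP (numq r)) h1 => [|n|n] //.
    by rewrite intrN => /(vgeN Hv); rewrite opprK abszN.
  move/vge_nz => /(_ (padic_nat_neq0 n0)); rewrite hnat//.
  by rewrite lognE pp n0 (negbTE pn).
have [u1 [u2 hu]] := Bezoutz p%:Z (denq r).
move: hu; rewrite (eqP nd) => hu.
pose k := ((numq r * u2) %% p%:Z)%Z.
have p0 : (p%:Z : int) != 0 by rewrite eqz_nat -lt0n prime_gt0.
have k0 : 0 <= k by rewrite modz_ge0.
have kp : (`|k| < p)%N by have := ltz_mod (numq r * u2) p0; lia.
exists (Ordinal kp) => /=.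
rewrite -(subrK (ratr r) a) -addrA; apply: (vgeD Hv) => //.
have -> : ratr r - `|k|%:R = (denq r)%:~R^-1 * (numq r - k * denq r)%:~R :> K.
  rewrite intrB intrM mulrBr mulrCA mulVf// mulr1 /ratr mulrC; congr (_ - _).
  by rewrite -{2}(gez0_abs k0).
apply: (vgeMl Hv).
  right; rewrite (valV Hv)// -absz_denq /= -[_%:~R]/(`|denq r|%:R) hnat ?absz_gt0 ?denq_eq0//.
  rewrite lognE pp absz_gt0 denq_eq0 /=.
  move: nd; rewrite coprimezE /= prime_coprime// => /negbTE ->.
  by [].
apply: padic_vge_dvd; apply/dvdzP.
have := divz_eq (numq r * u2) p%:Z; rewrite -/k => hk.
exists (numq r * u1 + (numq r * u2 %/ p%:Z)%Z * denq r).
have e2 : numq r = numq r * (u1 * p%:Z + u2 * denq r) by rewrite hu mulr1.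
have -> : k = numq r * u2 - (numq r * u2 %/ p%:Z)%Z * p%:Z by rewrite {1}hk addrC addKr.
by rewrite {1}e2; ring.
Qed.

End Padic.

(** * The involution of an unramified quadratic extension *)

Section Quadratic.
Variables (F : fieldType) (E : fieldExtType F).
Variables (vF : F -> int) (vE : E -> int) (conj : 'AEnd(E)).
Hypothesis HvF : normalized_valuation vF.
Hypothesis HcF : vcomplete vF.
Hypothesis HuE : unramified vF vE.
Hypothesis Hdim : \dim {:E} = 2%N.
Hypothesis Hconj : conj != \1%AF.

Let HvE : normalized_valuation vE. Proof. by case: HuE. Qed.

Lemma quadratic_span (x : E) : x \notin 1%VS ->
  forall y, exists a b : F, y = a%:A + b *: x.
Proof.
move=> x1 y; have sub1 : (1 <= 1 + <[x]>)%VS by exact: addvSl.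
have : (1 + <[x]> == fullv)%VS.
  rewrite eqEdim subvf Hdim /= ltnNge; apply/negP => h.
  have : (1 == 1 + <[x]>)%VS by rewrite eqEdim sub1 dimv1.
  move=> /eqP e; move: x1; rewrite e => /negP; apply.
  by apply: (subvP (addvSr 1%VS <[x]>%VS)); exact: memv_line.
move=> /eqP e; have : y \in (1 + <[x]>)%VS by rewrite e memvf.
by case/memv_addP => _ /vlineP[a ->] [_ /vlineP[b ->] ->]; exists a, b.
Qed.

Lemma conjZ a x : conj (a *: x) = a *: conj x.
Proof. by rewrite linearZ. Qed.

Lemma conj_alg a : conj (a%:A) = a%:A :> E.
Proof. by rewrite linearZ /= rmorph1. Qed.

Lemma exists_conj_neq : exists x, conj x != x.
Proof.
apply: contrapT => h; case/negP: Hconj; apply/eqP/val_inj/lfunP => x /=.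
by rewrite lfunE /=; apply/eqP/negPn/negP => hx; apply: h; exists x.
Qed.

Lemma conj_fixed x : conj x = x -> exists a, x = a%:A.
Proof.
move=> hx; have [/vlineP[a ->]|x1] := boolP (x \in 1%VS); first by exists a.
have [y] := exists_conj_neq; have [a [b ->]] := quadratic_span x1 y.
by rewrite linearD /= conj_alg conjZ hx eqxx.
Qed.

(** The conjugate of a generator x0 is the second root of the quadratic
   equation of x0. *)
Lemma conjK : involutive conj.
Proof.
have [x0 hx0] := exists_conj_neq.
have x1 : x0 \notin 1%VS.
  by apply/negP => /vlineP[a e]; move: hx0; rewrite e conj_alg eqxx.
have [a [b hsq]] := quadratic_span x1 (x0 * x0).
have h : (conj x0 - x0) * (conj x0 - (b%:A - x0)) = 0.
  have := congr1 conj hsq; rewrite rmorphM linearD /= conj_alg conjZ => hsq'.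
  have e1 : b *: conj x0 = b%:A * conj x0 by rewrite mulr_algl.
  have e2 : b *: x0 = b%:A * x0 by rewrite mulr_algl.
  rewrite e1 in hsq'; rewrite e2 in hsq.
  transitivity ((conj x0 * conj x0 - b%:A * conj x0) - (x0 * x0 - b%:A * x0)); first by ring.
  by rewrite hsq hsq'; ring.
have hc : conj x0 = b%:A - x0.
  move/eqP: h; rewrite mulf_eq0 subr_eq0 (negbTE hx0) /= subr_eq0 => /eqP ->.
  by [].
move=> y; have [c [d ->]] := quadratic_span x1 y.
by rewrite linearD /= conj_alg conjZ hc linearD /= conj_alg conjZ linearB /= conj_alg hc subKr.
Qed.

(** If x is a unit whose conjugate y lies in the maximal ideal, the traces
   t_k = x^k + y^k satisfy t_(k+1) / t_k -> x; as F is complete, x would lie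
   in F. *)
Lemma conj_not_small x : x != 0 -> vE x = 0 -> ~ vge vE 1 (conj x).
Proof.
move=> x0 vx; set y := conj x => hy.
have /choice[a ha] : forall k : nat, exists a, x ^+ k + y ^+ k = a%:A.
  move=> k; have [|a ea] := @conj_fixed (x ^+ k + y ^+ k); last by exists a.
  by rewrite rmorphD !rmorphXn /= /y conjK addrC.
have hyk k : vge vE k%:Z (y ^+ k).
  elim: k => [|k IH]; first exact: (vge01 HvE).
  rewrite exprS; have -> : k.+1%:Z = 1 + k%:Z by lia.
  exact: (vgeM HvE).
have hak k : ((a k.+1)%:A : E) != 0 /\ vE (a k.+1)%:A = 0.
  apply: (unit_perturb HvE (y := x ^+ k.+1)).
  - by rewrite -ha addrC addKr; apply: vgeW (hyk _); lia.
  - by rewrite expf_neq0.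
  - by rewrite (valX HvE)// vx mulr0.
pose u k := (a k.+1)^-1 * a k.+2.
have hu k : vge vE k%:Z ((u k)%:A - x).
  have [a0 va] := hak k.
  have -> : (u k)%:A - x = ((a k.+1)%:A)^-1 * (y ^+ k.+1 * (y - x)).
    apply: (mulfI a0); rewrite mulVKf//.
    have a0' : a k.+1 != 0 by move: a0; rewrite scaler_eq0 oner_eq0 orbF.
    rewrite mulrBr mulr_algl /u scalerA mulVKf// -!ha !exprS; ring.
  apply: (vgeMl HvE); first by right; rewrite (valV HvE)// va.
  apply: (vgeMr HvE); first by apply: vgeW (hyk _); lia.
  by apply: (vgeB HvE); [apply: vgeW hy|right; rewrite vx].
have [l hl] : exists l, forall d, exists N, forall i, (N <= i)%N -> vge vF d (u i - l).
  apply: HcF => d; exists `|d|%N => i j hi hj.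
  apply/(vge_in_alg HuE); rewrite scalerBl -(subrKA x).
  apply: (vgeD HvE).
    by apply: vgeW (hu i); lia.
  by apply: (vgeBC HvE); apply: vgeW (hu j); lia.
have e : x = l%:A.
  apply/eqP; rewrite -subr_eq0; apply/eqP; apply: (vge_lim0 (v := vE)) => n.
  have [N hN] := hl n%:Z; pose i := maxn N n.
  rewrite -(subrKA (u i)%:A); apply: (vgeD HvE).
    by apply: (vgeBC HvE); apply: vgeW (hu i); rewrite /i; lia.
  rewrite -scalerBl; apply/(vge_in_alg HuE); apply: hN; exact: leq_maxl.
have : vge vE 1 x by move: hy; rewrite /y e conj_alg.
by move/(vge_nz x0); rewrite vx.
Qed.

(** A power of the uniformizer, which is fixed by the involution, makes x a
   unit; applied to x and to its inverse, [conj_not_small] excludes both signs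
   of the valuation of the conjugate. *)
Lemma val_conj x : vE (conj x) = vE x.
Proof.
have [->|x0] := eqVneq x 0; first by rewrite rmorph0.
have c0 (z : E) : z != 0 -> conj z != 0 by move=> ?; rewrite fmorph_eq0.
have [_ _ [pi pi0 vpi]] := HvF.
have piE0 : (pi%:A : E) != 0 by rewrite scaler_eq0 oner_eq0 orbF.
have vpiE : vE pi%:A = 1 by case: HuE => _ /(_ _ pi0) ->.
pose y := x * (pi%:A) ^ (- vE x).
have y0 : y != 0 by rewrite mulf_neq0// expfz_neq0.
have vy : vE y = 0 by rewrite (valM HvE) ?expfz_neq0// (valXz HvE)// vpiE; lia.
have hcy : vE (conj y) = vE (conj x) - vE x.
  rewrite rmorphM /= fmorphXz /= conj_alg (valM HvE) ?c0 ?expfz_neq0//.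
  by rewrite (valXz HvE)// vpiE; lia.
have h1 := conj_not_small y0 vy.
have yi0 : y^-1 != 0 by rewrite invr_eq0.
have vyi : vE y^-1 = 0 by rewrite (valV HvE)// vy.
have h2 := conj_not_small yi0 vyi.
have h1' : ~ (1 <= vE (conj y)) by move=> h; apply: h1; right.
have h2' : ~ (1 <= - vE (conj y)).
  by move=> h; apply: h2; right; rewrite fmorphV (valV HvE)// c0.
lia.
Qed.

Lemma vge_conj d x : vge vE d x -> vge vE d (conj x).
Proof. by case=> [->|h]; [rewrite rmorph0; left|right; rewrite val_conj]. Qed.

Lemma exists_antifixed : (2 : F) != 0 ->
  exists eps : E, [/\ eps != 0, vE eps = 0 & conj eps = - eps].
Proof.
move=> two0; have [x hx] := exists_conj_neq.
have [_ _ [pi pi0 vpi]] := HvF.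
have piE0 : (pi%:A : E) != 0 by rewrite scaler_eq0 oner_eq0 orbF.
have vpiE : vE pi%:A = 1 by case: HuE => _ /(_ _ pi0) ->.
pose y := x - conj x; have y0 : y != 0 by rewrite subr_eq0 eq_sym.
exists (y * (pi%:A) ^ (- vE y)); split.
- by rewrite mulf_neq0// expfz_neq0.
- by rewrite (valM HvE) ?expfz_neq0// (valXz HvE)// vpiE; lia.
- by rewrite rmorphM /= fmorphXz /= conj_alg /y rmorphB /= conjK -opprB mulNr.
Qed.

End Quadratic.

(** * Integral matrices and GL(O) *)

Section IntegralMatrices.
Variables (F : fieldType) (E : fieldExtType F) (vE : E -> int).
Hypothesis Hv : normalized_valuation vE.

Section Lattice.
Variables m k : nat.
Implicit Types X Y : 'M[E]_(m, k).

Lemma mxge0 d : mxge vE d (0 : 'M[E]_(m, k)).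
Proof. by move=> i j; rewrite mxE; left. Qed.

Lemma mxgeD d X Y : mxge vE d X -> mxge vE d Y -> mxge vE d (X + Y).
Proof. by move=> hX hY i j; rewrite mxE; exact: (vgeD Hv). Qed.

Lemma mxgeN d X : mxge vE d X -> mxge vE d (- X).
Proof. by move=> hX i j; rewrite mxE; exact: (vgeN Hv). Qed.

Lemma mxgeB d X Y : mxge vE d X -> mxge vE d Y -> mxge vE d (X - Y).
Proof. by move=> hX hY; apply: mxgeD => //; exact: mxgeN. Qed.

Lemma mxgeBC d X Y : mxge vE d (X - Y) -> mxge vE d (Y - X).
Proof. by move/mxgeN; rewrite opprB. Qed.

Lemma mxgeW d e X : e <= d -> mxge vE d X -> mxge vE e X.
Proof. by move=> ed hX i j; exact: vgeW (hX i j). Qed.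

Lemma mxgeZ d e a X : vge vE d a -> mxge vE e X -> mxge vE (d + e) (a *: X).
Proof. by move=> ha hX i j; rewrite mxE; exact: (vgeM Hv). Qed.

Lemma mxge_scale a d e X : a != 0 -> vE a = e ->
  mxge vE (d + e) (a *: X) <-> mxge vE d X.
Proof.
move=> a0 va; split=> h i j; first by apply/(vge_scale Hv d _ a0 va); have := h i j; rewrite mxE.
by rewrite mxE; apply/(vge_scale Hv).
Qed.

Lemma mxge_exists X : exists b : nat, mxge vE (- b%:Z) X.
Proof.
exists (\sum_i \sum_j `|vE (X i j)|)%N => i j; right.
by rewrite (bigD1 i)//= (bigD1 j)//=; lia.
Qed.

End Lattice.

Lemma mxge1 k : mxge vE 0 (1%:M : 'M[E]_k).
Proof. by move=> i j; rewrite mxE; case: eqP => _ /=; [exact: vge01|left]. Qed.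

Lemma mxgeM m k l d e (X : 'M[E]_(m, k)) (Y : 'M[E]_(k, l)) :
  mxge vE d X -> mxge vE e Y -> mxge vE (d + e) (X *m Y).
Proof.
by move=> hX hY i j; rewrite mxE; apply: (vge_sum Hv) => t _; exact: (vgeM Hv).
Qed.

Lemma mxgeMl m k l d (X : 'M[E]_(m, k)) (Y : 'M[E]_(k, l)) :
  mxge vE 0 X -> mxge vE d Y -> mxge vE d (X *m Y).
Proof. by move=> hX hY; rewrite -[d]add0r; exact: mxgeM. Qed.

Lemma mxgeMr m k l d (X : 'M[E]_(m, k)) (Y : 'M[E]_(k, l)) :
  mxge vE d X -> mxge vE 0 Y -> mxge vE d (X *m Y).
Proof. by move=> hX hY; rewrite -[d]addr0; exact: mxgeM. Qed.

Lemma mxge_col m1 m2 k d (X : 'M[E]_(m1, k)) (Y : 'M[E]_(m2, k)) :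
  mxge vE d (col_mx X Y) <-> mxge vE d X /\ mxge vE d Y.
Proof.
split=> [h|[hX hY]]; last by move=> i j; rewrite mxE; case: splitP.
by split=> i j; [have := h (lshift _ i) j|have := h (rshift _ i) j]; rewrite ?col_mxEu ?col_mxEd.
Qed.

Lemma mxge_row m k1 k2 d (X : 'M[E]_(m, k1)) (Y : 'M[E]_(m, k2)) :
  mxge vE d (row_mx X Y) <-> mxge vE d X /\ mxge vE d Y.
Proof.
split=> [h|[hX hY]]; last by move=> i j; rewrite mxE; case: splitP.
by split=> i j; [have := h i (lshift _ j)|have := h i (rshift _ j)]; rewrite ?row_mxEl ?row_mxEr.
Qed.

Lemma mxge_block m1 m2 k1 k2 d (A : 'M[E]_(m1, k1)) (B : 'M[E]_(m1, k2))
    (C : 'M[E]_(m2, k1)) (D : 'M[E]_(m2, k2)) :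
  mxge vE d (block_mx A B C D) <->
  [/\ mxge vE d A, mxge vE d B, mxge vE d C & mxge vE d D].
Proof.
rewrite /block_mx; split=> [/mxge_col[/mxge_row[? ?] /mxge_row[? ?]]//|[? ? ? ?]].
by apply/mxge_col; split; apply/mxge_row.
Qed.

Lemma mxge_mulmx_cong m k l d (X X' : 'M[E]_(m, k)) (Y Y' : 'M[E]_(k, l)) :
  mxge vE 0 X' -> mxge vE 0 Y ->
  mxge vE d (X - X') -> mxge vE d (Y - Y') -> mxge vE d (X *m Y - X' *m Y').
Proof.
move=> hX hY hXX hYY; rewrite -(subrKA (X' *m Y)) -mulmxBl -mulmxBr.
by apply: mxgeD; [exact: mxgeMr|exact: mxgeMl].
Qed.

Lemma vge_sign n : vge vE 0 ((-1) ^+ n).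
Proof.
elim: n => [|n IH]; first exact: vge01.
by rewrite exprS mulN1r; exact: (vgeN Hv).
Qed.

Lemma mxge_det k (X : 'M[E]_k) : mxge vE 0 X -> vge vE 0 (\det X).
Proof.
move=> hX; apply: (vge_sum Hv) => s _; apply: (vgeMl Hv).
  exact: vge_sign.
by apply: (vge_prod Hv) => i _; exact: hX.
Qed.

Lemma vge_prod_cong d (I : eqType) (r : seq I) (f g : I -> E) :
  (forall i, vge vE 0 (f i)) -> (forall i, vge vE 0 (g i)) ->
  (forall i, vge vE d (f i - g i)) ->
  vge vE d (\prod_(i <- r) f i - \prod_(i <- r) g i).
Proof.
move=> f0 g0 fg; elim: r => [|i r IH]; first by rewrite !big_nil subrr; left.
rewrite !big_cons -(subrKA (g i * \prod_(j <- r) f j)) -mulrBl -mulrBr.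
apply: (vgeD Hv); last exact: (vgeMl Hv).
by apply: (vgeMr Hv) => //; apply: (vge_prod Hv).
Qed.

Lemma mxge_det_cong k d (X Y : 'M[E]_k) :
  mxge vE 0 X -> mxge vE 0 Y -> mxge vE d (X - Y) ->
  vge vE d (\det X - \det Y).
Proof.
move=> hX hY hXY; rewrite -sumrB; apply: (vge_sum Hv) => s _.
rewrite -mulrBr; apply: (vgeMl Hv).
  exact: vge_sign.
apply: vge_prod_cong => i //.
have h j : vge vE d (X i j - Y i j) by have := hXY i j; rewrite !mxE.
exact: h.
Qed.

(** Cramer's rule: the inverse is the adjugate over the determinant. *)
Lemma GLO_det k (X : 'M[E]_k) : mxge vE 0 X -> \det X != 0 -> vE (\det X) = 0 ->
  GLO vE X.
Proof.
move=> hX d0 vd; have uX : X \in unitmx by rewrite unitmxE unitfE.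
split=> //; rewrite /invmx uX; rewrite -[0]addr0; apply: mxgeZ.
  by right; rewrite (valV Hv)// vd.
move=> i j; rewrite mxE /cofactor; apply: (vgeMl Hv).
  exact: vge_sign.
by apply: mxge_det => a b; rewrite !mxE.
Qed.

(** The determinants of X and Y are integral and their product is a unit. *)
Lemma GLO_left_inv k (X Y : 'M[E]_k) :
  mxge vE 0 X -> mxge vE 0 Y -> mxge vE 1 (Y *m X - 1%:M) -> GLO vE X.
Proof.
move=> hX hY hYX; have h := mxge_det_cong (mxgeM hY hX) (@mxge1 _) hYX.
rewrite det1 in h; have [d0 vd] := unit_perturb Hv h (oner_neq0 _) (val1 Hv).
move: d0 vd; rewrite det_mulmx mulf_eq0 negb_or => /andP[dY dX].
rewrite (valM Hv)// => vd; apply: GLO_det => //.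
have := vge_nz dY (mxge_det hY); have := vge_nz dX (mxge_det hX).
by move: (vE (\det X)) (vE (\det Y)) vd => x y; lia.
Qed.

Lemma GLO1 k (X : 'M[E]_k) : mxge vE 1 (X - 1%:M) -> GLO vE X.
Proof.
move=> h; apply: (@GLO_left_inv _ _ 1%:M); rewrite ?mul1mx//; last exact: mxge1.
by rewrite -(subrK 1%:M X); apply: mxgeD; [exact: mxgeW h|exact: mxge1].
Qed.

Lemma GLO_mxgel k l d (g : 'M[E]_k) (X : 'M[E]_(k, l)) : GLO vE g ->
  mxge vE d (g *m X) <-> mxge vE d X.
Proof.
move=> [ug hg hgi]; split=> h; last exact: mxgeMl.
by rewrite -(mulKmx ug X); exact: mxgeMl.
Qed.

Lemma GLO_mxger k l d (g : 'M[E]_k) (X : 'M[E]_(l, k)) : GLO vE g ->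
  mxge vE d (X *m g) <-> mxge vE d X.
Proof.
move=> [ug hg hgi]; split=> h; last exact: mxgeMr.
by rewrite -(mulmxK ug X); exact: mxgeMr.
Qed.

Lemma GLO_inv k (g : 'M[E]_k) : GLO vE g -> GLO vE (invmx g).
Proof. by case=> ug hg hgi; split; rewrite ?unitmx_inv ?invmxK. Qed.

Lemma GLO_inv_cong k d (g h : 'M[E]_k) : GLO vE g -> GLO vE h ->
  mxge vE d (g - h) -> mxge vE d (invmx g - invmx h).
Proof.
move=> Gg Gh hd; apply/(GLO_mxgel _ _ Gg)/(GLO_mxger _ _ Gh).
have [ug _ _] := Gg; have [uh _ _] := Gh.
by rewrite mulmxBr mulmxBl mulmxV// mul1mx -mulmxA mulVmx// mulmx1; exact: mxgeBC.
Qed.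

End IntegralMatrices.

(** * Conjugate transposes and hermitian square roots *)

Section Adjoint.
Variables (F : fieldType) (E : fieldExtType F) (vE : E -> int) (conj : 'AEnd(E)).
Hypothesis Hv : normalized_valuation vE.
Hypothesis cK : involutive conj.
Hypothesis cV : forall d x, vge vE d x -> vge vE d (conj x).

(** The entries are typed in the field E rather than in the vector space that
   is the codomain of the linear map [conj], so that the operations on matrices
   over E apply. *)
Definition adj m k (X : 'M[E]_(m, k)) : 'M[E]_(k, m) := \matrix_(i, j) conj (X j i).

Lemma hactE m k (A : 'M[E]_m) (X : 'M[E]_(m, k)) : hact conj A X = adj X *m A *m X.
Proof.
by rewrite /hact; congr (_ *m _ *m _); apply/matrixP => i j; rewrite !mxE.
Qed.

Lemma hermmxE k (X : 'M[E]_k) : (X \is hermmx conj k) <-> adj X = X.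
Proof.
have e : map_mx conj X^T = adj X by apply/matrixP => i j; rewrite !mxE.
by rewrite qualifE /= e; split=> /eqP.
Qed.

Lemma adjM m k l (X : 'M[E]_(m, k)) (Y : 'M[E]_(k, l)) :
  adj (X *m Y) = adj Y *m adj X.
Proof.
apply/matrixP => i j; rewrite !mxE rmorph_sum; apply: eq_bigr => t _.
by rewrite !mxE rmorphM mulrC.
Qed.

Lemma adjD m k (X Y : 'M[E]_(m, k)) : adj (X + Y) = adj X + adj Y.
Proof. by apply/matrixP => i j; rewrite !mxE rmorphD. Qed.

Lemma adjN m k (X : 'M[E]_(m, k)) : adj (- X) = - adj X.
Proof. by apply/matrixP => i j; rewrite !mxE rmorphN. Qed.

Lemma adjB m k (X Y : 'M[E]_(m, k)) : adj (X - Y) = adj X - adj Y.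
Proof. by rewrite adjD adjN. Qed.

Lemma adjZ m k a (X : 'M[E]_(m, k)) : adj (a *: X) = (conj a : E) *: adj X.
Proof. by apply/matrixP => i j; rewrite !mxE rmorphM. Qed.

Lemma adjK m k (X : 'M[E]_(m, k)) : adj (adj X) = X.
Proof. by apply/matrixP => i j; rewrite !mxE cK. Qed.

Lemma adj1 k : adj (1%:M : 'M[E]_k) = 1%:M.
Proof. by apply/matrixP => i j; rewrite !mxE eq_sym rmorph_nat. Qed.

Lemma adj0 m k : adj (0 : 'M[E]_(m, k)) = 0.
Proof. by apply/matrixP => i j; rewrite !mxE rmorph0. Qed.

Lemma adj_col m1 m2 k (A : 'M[E]_(m1, k)) (B : 'M[E]_(m2, k)) :
  adj (col_mx A B) = row_mx (adj A) (adj B).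
Proof. by apply/matrixP => i j; rewrite !mxE; case: splitP => t _; rewrite mxE. Qed.

Lemma adj_row m k1 k2 (A : 'M[E]_(m, k1)) (B : 'M[E]_(m, k2)) :
  adj (row_mx A B) = col_mx (adj A) (adj B).
Proof. by apply/matrixP => i j; rewrite !mxE; case: splitP => t _; rewrite mxE. Qed.

Lemma adj_block m1 m2 k1 k2 (A : 'M[E]_(m1, k1)) (B : 'M[E]_(m1, k2))
    (C : 'M[E]_(m2, k1)) (D : 'M[E]_(m2, k2)) :
  adj (block_mx A B C D) = block_mx (adj A) (adj C) (adj B) (adj D).
Proof. by rewrite [RHS]block_mxEh {1}/block_mx adj_col !adj_row. Qed.

Lemma adj_inv k (X : 'M[E]_k) : X \in unitmx -> adj X \in unitmx /\ adj (invmx X) = invmx (adj X).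
Proof.
move=> uX; have h : adj X *m adj (invmx X) = 1%:M by rewrite -adjM mulVmx// adj1.
have [u _] := mulmx1_unit h; split=> //.
by rewrite -[LHS](mulKmx u) h mulmx1.
Qed.

Lemma mxge_adj d m k (X : 'M[E]_(m, k)) : mxge vE d X -> mxge vE d (adj X).
Proof. by move=> hX i j; rewrite !mxE; exact: cV. Qed.

Lemma mxge_adjB d m k (X Y : 'M[E]_(m, k)) :
  mxge vE d (X - Y) -> mxge vE d (adj X - adj Y).
Proof. by rewrite -adjB; exact: mxge_adj. Qed.

Lemma GLO_adj k (g : 'M[E]_k) : GLO vE g -> GLO vE (adj g).
Proof.
case=> ug hg hgi; have [u e] := adj_inv ug.
by split=> //; [exact: mxge_adj|rewrite -e; exact: mxge_adj].
Qed.

Hypothesis two0 : (2 : E) != 0.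
Hypothesis v2 : vE 2 = 0.

(** A hermitian matrix congruent to 1 is T^* T to any precision: since p is
   odd, T + R / 2 improves T when R is the current error, for
   (R T + T^* R) / 2 = R up to higher order. *)
Lemma hermitian_sqrt k (M : 'M[E]_k) : adj M = M -> mxge vE 1 (M - 1%:M) ->
  forall d : nat, exists T, mxge vE 1 (T - 1%:M) /\ mxge vE d%:Z (adj T *m T - M).
Proof.
move=> hM M1 d; suff [T [T1 hT]] : exists T, mxge vE 1 (T - 1%:M) /\
    mxge vE d.+1%:Z (adj T *m T - M).
  by exists T; split=> //; apply: mxgeW hT; lia.
elim: d => [|d [T [T1 hT]]].
  exists 1%:M; split; first by rewrite subrr; exact: mxge0.
  by rewrite adj1 mulmx1; exact: (mxgeBC Hv).
have hh : vge vE 0 (2^-1 : E) by right; rewrite (valV Hv)// v2.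
set R := M - adj T *m T.
have hR : adj R = R by rewrite /R adjB adjM adjK hM.
have Rd : mxge vE d.+1%:Z R by exact: (mxgeBC Hv).
have eM : M = adj T *m T + R by rewrite /R addrC subrK.
clearbody R.
have c2 : conj (2^-1) = 2^-1 by rewrite fmorphV rmorph_nat.
exists (T + 2^-1 *: R); split.
  rewrite addrAC; apply: (mxgeD Hv) => //.
  by rewrite -[1]add0r; apply: (mxgeZ Hv) => //; apply: mxgeW Rd; lia.
have -> : adj (T + 2^-1 *: R) *m (T + 2^-1 *: R) - M =
  2^-1 *: (R *m (T - 1%:M) + adj (T - 1%:M) *m R) + 2^-1 *: R *m (2^-1 *: R).
  rewrite {1}eM.
  rewrite adjD adjZ hR c2 adjB adj1 !mulmxDl !mulmxDr mulmxN mulNmx mulmx1 mul1mx.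
  rewrite -!scalemxAl -!scalemxAr.
  move: (adj T *m T) (R *m T) (adj T *m R) (R *m R) => a b c e.
  by apply/matrixP => i j; rewrite !mxE; field.
apply: (mxgeD Hv); last first.
  have -> : 2^-1 *: R *m (2^-1 *: R) = 2^-1 *: (2^-1 *: (R *m R)).
    by rewrite -scalemxAl -scalemxAr.
  rewrite -[_%:Z]add0r; apply: (mxgeZ Hv) => //.
  rewrite -[_%:Z]add0r; apply: (mxgeZ Hv) => //.
  have := mxgeM Hv Rd Rd; apply: mxgeW; lia.
rewrite -[_%:Z]add0r; apply: (mxgeZ Hv) => //; apply: (mxgeD Hv).
  by have := mxgeM Hv Rd T1; apply: mxgeW; lia.
by have := mxgeM Hv (mxge_adj T1) Rd; apply: mxgeW; lia.
Qed.

End Adjoint.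

(** * Counting cosets *)

Section Transversals.

Definition subgroup_set (V : zmodType) (L : set V) :=
  L 0 /\ forall x y, L x -> L y -> L (x - y).

Lemma subgroupN (V : zmodType) (L : set V) x : subgroup_set L -> L x -> L (- x).
Proof. by case=> L0 LB Lx; rewrite -sub0r; exact: LB. Qed.

Lemma subgroupD (V : zmodType) (L : set V) x y :
  subgroup_set L -> L x -> L y -> L (x + y).
Proof. by move=> HL Lx Ly; rewrite -[y]opprK; case: (HL) => _; apply=> //; exact: subgroupN. Qed.

Lemma subgroupBC (V : zmodType) (L : set V) x y :
  subgroup_set L -> L (x - y) -> L (y - x).
Proof. by move=> HL /(subgroupN HL); rewrite opprB. Qed.

Lemma subgroup_trans (V : zmodType) (L : set V) x y z :
  subgroup_set L -> L (x - y) -> L (y - z) -> L (x - z).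
Proof. by move=> HL h1 h2; rewrite -(subrKA y); exact: subgroupD. Qed.

(** Representatives in [A] of the cosets of [L] that meet [A], indexed by a
   finite type: integrals over [A] become sums over [T]. *)
Definition transversal (V : zmodType) (L A : set V) (T : finType) (s : T -> V) :=
  [/\ forall t, A (s t), forall t u, L (s t - s u) -> t = u &
      forall x, A x -> exists t, L (x - s t)].

Definition finmod (V : zmodType) (L A : set V) :=
  exists (T : finType) (s : T -> V), transversal L A s.

Lemma transversal_card (V : zmodType) (L A : set V) (T : finType) (s : T -> V) :
  subgroup_set L -> transversal L A s -> ncosets L A = #|T|.
Proof.
move=> HL [sA sinj ssurj]; rewrite /ncosets.
pose f t := [set y | L (y - s t)].
have finj : injective f.
  move=> t u e; apply: sinj; have : f t (s t) by rewrite /f /= subrr; case: HL.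
  by rewrite e.
have -> : [set [set y | L (y - x)] | x in A] = [set` [fset f t | t in T]%fset].
  apply/seteqP; split=> [_ [x /ssurj[t ht] <-]|_ /imfsetP[t _ ->]]; last by exists (s t).
  apply/imfsetP; exists t => //; apply/seteqP; split=> y /= hy; rewrite /f /=.
    exact: subgroup_trans hy ht.
  by apply: subgroup_trans hy _ => //; exact: subgroupBC.
by rewrite set_fsetK card_imfset//= -cardE.
Qed.

(** The cosets themselves, finite in number, index a transversal. *)
Lemma finmod_cover (V : zmodType) (L A : set V) (T : finType) (s : T -> V) :
  subgroup_set L -> (forall x, A x -> exists t, L (x - s t)) -> finmod L A.
Proof.
move=> HL hs; pose cos x := [set y | L (y - x)].
have cosE x y : L (x - y) -> cos x = cos y.
  move=> h; apply/seteqP; split=> z /= hz; first exact: subgroup_trans hz h.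
  by apply: subgroup_trans hz _ => //; exact: subgroupBC.
have cos_mem x y : cos x = cos y -> L (x - y).
  move=> e; have : cos x x by rewrite /cos /= subrr; case: HL.
  by rewrite e.
have fS : finite_set (cos @` A).
  apply: (@sub_finite_set _ _ ((cos \o s) @` setT)); last exact: finite_image.
  by move=> _ [x /hs[t ht] <-]; exists t => //=; rewrite (cosE _ _ ht).
pose r (c : fset_set (cos @` A)) := xget 0 [set x | A x /\ cos x = val c].
have rP c : A (r c) /\ cos (r c) = val c.
  have := valP c; rewrite in_fset_set// inE => -[x Ax e].
  exact: (@xgetPex _ 0 [set x | A x /\ cos x = val c] (ex_intro _ x (conj Ax e))).
exists (fset_set (cos @` A)), r; split=> [c|c d h|x Ax].
- by case: (rP c).
- by apply: val_inj; rewrite -(rP c).2 -(rP d).2; exact: cosE.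
- have hx : cos x \in fset_set (cos @` A) by rewrite in_fset_set// inE; exists x.
  by exists [` hx]%fset; apply: cos_mem; rewrite (rP _).2.
Qed.

Lemma finmod_sub (V : zmodType) (L A B : set V) :
  subgroup_set L -> B `<=` A -> finmod L A -> finmod L B.
Proof.
move=> HL BA [T [s [_ _ ss]]]; apply: (@finmod_cover _ _ _ T s) => // x /BA; exact: ss.
Qed.

Lemma transversal_map (V V' : zmodType) (L A : set V) (L' A' : set V')
    (T : finType) (s : T -> V) (phi : V -> V') :
  subgroup_set L' -> transversal L A s ->
  (forall x, A x -> A' (phi x)) ->
  (forall x y, A x -> A y -> L' (phi x - phi y) <-> L (x - y)) ->
  (forall x', A' x' -> exists2 x, A x & L' (x' - phi x)) ->
  transversal L' A' (phi \o s).
Proof.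
move=> HL' [sA sinj ssurj] hA hL hs; split=> [t|t u /hL h|x' /hs[x Ax hx]].
- exact: hA.
- by apply: sinj; apply: h.
- have [t ht] := ssurj _ Ax; exists t => /=.
  by apply: subgroup_trans hx _ => //; apply/hL.
Qed.

Lemma ncosets_map (V V' : zmodType) (L A : set V) (L' A' : set V') (phi : V -> V') :
  subgroup_set L -> subgroup_set L' -> finmod L A ->
  (forall x, A x -> A' (phi x)) ->
  (forall x y, A x -> A y -> L' (phi x - phi y) <-> L (x - y)) ->
  (forall x', A' x' -> exists2 x, A x & L' (x' - phi x)) ->
  finmod L' A' /\ ncosets L' A' = ncosets L A.
Proof.
move=> HL HL' [T [s hs]] h1 h2 h3.
have h := transversal_map HL' hs h1 h2 h3; split; first by exists T, (phi \o s).
by rewrite (transversal_card HL hs) (transversal_card HL' h).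
Qed.

Lemma subgroup_setX (V V' : zmodType) (L : set V) (L' : set V') :
  subgroup_set L -> subgroup_set L' -> subgroup_set (L `*` L' : set (V * V')%type).
Proof.
move=> [L0 LB] [L0' LB']; split=> [|[x x'] [y y'] [/= h1 h2] [/= h3 h4]]; first by split.
by split=> /=; [exact: LB|exact: LB'].
Qed.

Lemma transversal_prod (V V' : zmodType) (L A : set V) (L' A' : set V')
    (T T' : finType) (s : T -> V) (s' : T' -> V') :
  transversal L A s -> transversal L' A' s' ->
  transversal (L `*` L' : set (V * V')%type) (A `*` A') (fun t : T * T' => (s t.1, s' t.2)).
Proof.
move=> [sA si ss] [sA' si' ss']; split=> [t|[t t'] [u u'] [/= h h']|[x x'] [/= Ax Ax']].
- by split; [exact: sA|exact: sA'].
- by rewrite (si _ _ h) (si' _ _ h').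
- by have [t ht] := ss _ Ax; have [t' ht'] := ss' _ Ax'; exists (t, t').
Qed.

Lemma ncosets_prod (V V' : zmodType) (L A : set V) (L' A' : set V') :
  subgroup_set L -> subgroup_set L' -> finmod L A -> finmod L' A' ->
  finmod (L `*` L' : set (V * V')%type) (A `*` A') /\
  ncosets (L `*` L' : set (V * V')%type) (A `*` A') = (ncosets L A * ncosets L' A')%N.
Proof.
move=> HL HL' [T [s hs]] [T' [s' hs']]; have h := transversal_prod hs hs'.
split; first by exists (T * T')%type, (fun t : T * T' => (s t.1, s' t.2)).
rewrite (transversal_card (subgroup_setX HL HL') h) (transversal_card HL hs).
by rewrite (transversal_card HL' hs') card_prod.
Qed.

Lemma transversal_chain (V : zmodType) (L2 L A : set V) (T U : finType)
    (s : T -> V) (u : U -> V) :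
  subgroup_set L -> L2 `<=` L ->
  (forall x y, A x -> L y -> A (x + y)) ->
  transversal L A s -> transversal L2 L u ->
  transversal L2 A (fun t : T * U => s t.1 + u t.2).
Proof.
move=> HL L2L AL [sA si ss] [uA ui us]; split=> [t|[t w] [t' w'] /= h|x Ax].
- exact: AL.
- have e : t = t'.
    apply: si; have -> : s t - s t' = (s t + u w - (s t' + u w')) - (u w - u w').
      by rewrite opprD addrACA addrK.
    by case: (HL) => _; apply; [exact: L2L|apply: (HL.2); exact: uA].
  by rewrite -e in h *; rewrite (ui w w')//; move: h; rewrite opprD addrACA subrr add0r.
- have [t ht] := ss _ Ax; have [w hw] := us _ ht; exists (t, w) => /=.
  by rewrite opprD addrA.
Qed.

Lemma ncosets_chain (V : zmodType) (L2 L A : set V) :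
  subgroup_set L -> subgroup_set L2 -> L2 `<=` L ->
  (forall x y, A x -> L y -> A (x + y)) -> finmod L A -> finmod L2 L ->
  finmod L2 A /\ ncosets L2 A = (ncosets L A * ncosets L2 L)%N.
Proof.
move=> HL HL2 L2L AL [T [s hs]] [U [u hu]].
have h := transversal_chain HL L2L AL hs hu.
split; first by exists (T * U)%type, (fun t : T * U => s t.1 + u t.2).
by rewrite (transversal_card HL hs) (transversal_card HL2 hu) (transversal_card HL2 h) card_prod.
Qed.

Lemma ncosets_neq0 (V : zmodType) (L A : set V) x :
  subgroup_set L -> finmod L A -> A x -> (0 < ncosets L A)%N.
Proof.
move=> HL [T [s hs]] Ax; rewrite (transversal_card HL hs).
by case: hs => _ _ /(_ _ Ax)[t _]; apply/card_gt0P; exists t.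
Qed.

End Transversals.

(** * Haar integrals of locally constant functions *)

Section Haar.
Variables (V : zmodType) (L : int -> set V) (R : realType).
Variable mu : {measure set (borel L) -> \bar R}.
Hypothesis Lsub : forall d, subgroup_set (L d).
Hypothesis Lfin : forall d e, e <= d -> finmod (L d) (L e).
Hypothesis Lle : forall d e, e <= d -> L d `<=` L e.
Hypothesis Hmu : normalized_haar mu.

(** A set stable under translation by some [L d] is open. *)
Lemma measurable_invariant d (A : set V) :
  (forall x y, A x -> L d y -> A (x + y)) -> measurable (A : set (borel L)).
Proof.
move=> hA; apply: sub_gen_smallest => /= x Ax; exists d => y hy.
by rewrite -(subrK x y) addrC; exact: hA.
Qed.

Lemma measurable_coset d x : measurable ([set x + y | y in L d] : set (borel L)).
Proof.
apply: (@measurable_invariant d) => _ z [y Ly <-] Lz.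
by exists (y + z); [exact: subgroupD|rewrite addrA].
Qed.

Lemma measurable_lattice d : measurable (L d : set (borel L)).
Proof. by apply: (@measurable_invariant d) => x y; exact: subgroupD. Qed.

Lemma bigsetU_transversal d (A : set V) (T : finType) (s : T -> V) :
  transversal (L d) A s -> (forall x y, A x -> L d y -> A (x + y)) ->
  \big[setU/set0]_(t <- enum T) ([set s t + y | y in L d] : set (borel L)) = A.
Proof.
move=> [sA _ ss] hA; rewrite -bigcup_seq; apply/seteqP; split.
  by move=> _ [t _ [y Ly <-]]; exact: hA.
move=> x Ax; have [t ht] := ss _ Ax; exists t; first by rewrite /= mem_enum.
by exists (x - s t) => //; rewrite addrC subrK.
Qed.

Lemma trivIset_transversal d (A : set V) (T : finType) (s : T -> V) (D : set T) :
  transversal (L d) A s ->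
  trivIset D (fun t => [set s t + y | y in L d] : set (borel L)).
Proof.
move=> [_ si _]; apply/trivIsetP => t u _ _ tu; apply/eqP/negPn/negP => /eqP/eqP/set0P.
move=> [_ [[y Ly <-] [z Lz e]]]; move/eqP: tu; apply; apply: si.
have -> : s t - s u = z - y by apply/eqP; rewrite subr_eq addrAC eq_sym subr_eq addrC e addrC.
by case: (Lsub d) => _; apply.
Qed.

Section Integral.
Variables (d : int) (A : set V) (T : finType) (s : T -> V) (f : V -> R).
Hypothesis hs : transversal (L d) A s.
Hypothesis hA : forall x y, A x -> L d y -> A (x + y).
Hypothesis hf : forall x y, A x -> L d y -> f (x + y) = f x.

Let fb : borel L -> R := f.

(** [A] is a disjoint union of translates of [L d], on each of which [f] is
   constant. *)
Lemma integral_transversal :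
  (\int[mu]_(x in (A : set (borel L))) (fb x)%:E =
   \sum_(t <- enum T) (f (s t))%:E * mu (L d : set (borel L)))%E.
Proof.
have mA : measurable (A : set (borel L)) by apply: (@measurable_invariant d).
rewrite -{1}(bigsetU_transversal hs hA) integral_bigsetU_EFin//; first last.
- rewrite (bigsetU_transversal hs hA); move=> _ Y mY.
  apply: (@measurable_invariant d) => x y [Ax Yx] Ly; split; first exact: hA.
  by rewrite /preimage /= /fb hf.
- exact: trivIset_transversal hs.
- exact: enum_uniq.
- by move=> t; exact: measurable_coset.
apply: eq_bigr => t _.
rewrite (eq_integral (cst (f (s t))%:E)); last first.
  by move=> x; rewrite inE => -[y Ly <-]; rewrite /fb hf//; case: hs.
rewrite integral_cst; last exact: measurable_coset.
by rewrite Hmu.2//; exact: measurable_lattice.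
Qed.

End Integral.

Lemma haar_measure_transversal d (A : set V) (T : finType) (s : T -> V) :
  transversal (L d) A s -> (forall x y, A x -> L d y -> A (x + y)) ->
  (mu (A : set (borel L)) = \sum_(t <- enum T) mu (L d : set (borel L)))%E.
Proof.
move=> hs hA; have mA : measurable (A : set (borel L)) by exact: (measurable_invariant hA).
have := integral_transversal (f := fun=> 1) hs hA (fun _ _ _ _ => erefl).
rewrite (_ : (fun=> 1%:E) = cst 1%:E)// integral_cst// mul1e => ->.
by apply: eq_bigr => t _; rewrite mul1e.
Qed.

(** The volume that translation invariance and vol (L 0) = 1 impose on
   [L d]. *)
Definition lattice_vol d : R :=
  if 0 <= d then (ncosets (L d) (L 0))%:R^-1 else (ncosets (L 0) (L d))%:R.

Lemma haar_lattice d : mu (L d : set (borel L)) = (lattice_vol d)%:E.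
Proof.
have mu0 : mu (L 0 : set (borel L)) = 1%:E := Hmu.1.
have inv e e' : e' <= e -> forall x y, L e' x -> L e y -> L e' (x + y).
  by move=> le x y Lx Ly; apply: subgroupD => //; exact: (Lle le).
rewrite /lattice_vol; case: ifPn => [d0|]; last first.
  rewrite -ltNge => /ltW d0; have [T [s hs]] := Lfin d0.
  rewrite (haar_measure_transversal hs (inv _ _ d0)) mu0 sumEFin big_enum sumr_const.
  by rewrite (transversal_card (Lsub _) hs).
have [T [s hs]] := Lfin d0; rewrite (transversal_card (Lsub _) hs).
have := haar_measure_transversal hs (inv _ _ d0); rewrite mu0.
have : (mu (L d : set (borel L)) <= 1%:E)%E.
  rewrite -mu0; apply: le_measure; rewrite ?inE; last exact: Lle.
  - exact: measurable_lattice.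
  - exact: measurable_lattice.
have : (0 <= mu (L d : set (borel L)))%E by exact: measure_ge0.
case: (mu (L d : set (borel L))) => [r| |]// r0 r1.
rewrite sumEFin big_enum sumr_const => -[e]; congr (_%:E).
rewrite -mulr_natl in e.
have T0 : (#|T|%:R : R) != 0.
  by apply/eqP => T0; move: e; rewrite T0 mul0r => /eqP; rewrite oner_eq0.
by apply: (mulfI T0); rewrite mulfV.
Qed.

Lemma cintegral_transversal d (A : set V) (T : finType) (s : T -> V) (f : V -> R[i]) :
  transversal (L d) A s -> (forall x y, A x -> L d y -> A (x + y)) ->
  (forall x y, A x -> L d y -> f (x + y) = f x) ->
  cintegral mu (A : set (borel L)) (f : borel L -> R[i]) =
  (\sum_t f (s t)) * (lattice_vol d)%:C.
Proof.
move=> hs hA hf; rewrite /cintegral /Rintegral.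
have h (g : R[i] -> R) :
  fine (\int[mu]_(x in (A : set (borel L))) (g ((f : borel L -> R[i]) x))%:E)%E =
  \sum_t g (f (s t)) * lattice_vol d.
  have hg x y : A x -> L d y -> (g \o f) (x + y) = (g \o f) x by move=> Ax Ly; rewrite /= hf.
  rewrite (integral_transversal (f := g \o f) hs hA hg) haar_lattice.
  rewrite (eq_bigr (fun t => (g (f (s t)) * lattice_vol d)%:E)); last by move=> t _; rewrite EFinM.
  by rewrite sumEFin big_enum.
rewrite !h -!mulr_suml.
have -> : \sum_t f (s t) = Complex (\sum_t complex.Re (f (s t))) (\sum_t complex.Im (f (s t))).
  by apply/eqP; rewrite eq_complex /= !raddf_sum !eqxx.
by apply/eqP; rewrite eq_complex /= !mulr0 subr0 add0r !eqxx.
Qed.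

Lemma cintegral_setT (A : set V) (f : V -> R[i]) :
  (forall x, ~ A x -> f x = 0) ->
  cintegral mu (setT : set (borel L)) (f : borel L -> R[i]) =
  cintegral mu (A : set (borel L)) (f : borel L -> R[i]).
Proof.
move=> hf; rewrite /cintegral; congr (Complex _ _); rewrite [RHS]Rintegral_mkcond;
  apply: eq_Rintegral => x _; rewrite patchE; case: ifPn => // /negP;
  by rewrite inE => /hf ->.
Qed.

End Haar.

(** * Indices of lattices *)

Lemma subgroup_vge (K : fieldType) (v : K -> int) d :
  normalized_valuation v -> subgroup_set (vge v d).
Proof. by move=> Hv; split; [exact: vge0|move=> x y; exact: (vgeB Hv)]. Qed.

Lemma subgroup_mxge (F : fieldType) (E : fieldExtType F) (vE : E -> int) m k d :
  normalized_valuation vE -> subgroup_set (@mxge _ _ vE m k d).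
Proof. by move=> Hv; split; [exact: mxge0|move=> x y; exact: (mxgeB Hv)]. Qed.

Section HermitianLattice.
Variables (F : fieldType) (E : fieldExtType F) (vE : E -> int) (conj : 'AEnd(E)).
Hypothesis HvE : normalized_valuation vE.
Local Notation adj := (adj conj).

Lemma herm_adj k (Y : herm conj k) : adj Y = Y :> 'M[E]_k.
Proof. by apply/hermmxE; exact: (valP Y). Qed.

Lemma herm_valD k (X Y : herm conj k) : (X + Y : herm conj k) = (X : 'M[E]_k) + (Y : 'M[E]_k) :> 'M[E]_k.
Proof. exact: (raddfD \val). Qed.

Lemma herm_valB k (X Y : herm conj k) : (X - Y : herm conj k) = (X : 'M[E]_k) - (Y : 'M[E]_k) :> 'M[E]_k.
Proof. exact: (raddfB \val). Qed.

Lemma herm_val0 k : (0 : herm conj k) = 0 :> 'M[E]_k.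
Proof. exact: (raddf0 \val). Qed.

Lemma hermE k (X : 'M[E]_k) : adj X = X -> exists Y : herm conj k, Y = X :> 'M[E]_k.
Proof. by move=> /hermmxE h; exists (Herm h). Qed.

Lemma subgroup_hermge k d : subgroup_set (hermge vE d : set (herm conj k)).
Proof.
split.
  suff: mxge vE d ((0 : herm conj k) : 'M[E]_k) by [].
  by rewrite herm_val0; exact: mxge0.
move=> x y hx hy; suff: mxge vE d ((x - y : herm conj k) : 'M[E]_k) by [].
by rewrite herm_valB; exact: (mxgeB HvE).
Qed.

End HermitianLattice.

Section Filtration.
Variables (V : zmodType) (L : int -> set V) (Q : nat).
Hypothesis Lsub : forall d, subgroup_set (L d).
Hypothesis Lle : forall d e, e <= d -> L d `<=` L e.
Hypothesis Lstep : forall d, finmod (L (d + 1)) (L d) /\ ncosets (L (d + 1)) (L d) = Q.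

Lemma filtration_index d (n : nat) :
  finmod (L (d + n%:Z)) (L d) /\ ncosets (L (d + n%:Z)) (L d) = (Q ^ n)%N.
Proof.
elim: n => [|n [IH1 IH2]].
  have h : transversal (L d) (L d) (fun t : unit => 0).
    split=> [_|[] []//|x Lx]; first by case: (Lsub d).
    by exists tt; rewrite subr0.
  rewrite addr0 expn0 (transversal_card (Lsub _) h) card_unit; split=> //.
  by exists unit, (fun=> 0).
have [f1 f2] := Lstep (d + n%:Z).
have e : d + n.+1%:Z = d + n%:Z + 1 by lia.
have [g1 g2] := ncosets_chain (Lsub _) (Lsub _) (Lle (d := d + n%:Z + 1) (e := d + n%:Z) ltac:(lia))
   (fun x y Lx Ly => subgroupD (Lsub d) Lx (Lle (d := d + n%:Z) (e := d) ltac:(lia) Ly)) IH1 f1.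
by rewrite e g2 IH2 f2 expnSr.
Qed.

Lemma filtration_finmod d e : e <= d -> finmod (L d) (L e).
Proof.
move=> ed; have -> : d = e + (`|d - e|%N)%:Z by lia.
by case: (filtration_index e `|d - e|%N).
Qed.

Lemma filtration_lattice_vol (R : realType) (d : int) :
  (0 < Q)%N -> lattice_vol L R d = Q%:R ^ (- d).
Proof.
move=> Q0; rewrite /lattice_vol; case: ifPn => d0.
  have {1}-> : d = 0 + (`|d|%N)%:Z by lia.
  rewrite (filtration_index 0 _).2 natrX.
  by rewrite exprnN; congr (_ ^ _); lia.
have {1}-> : 0 = d + (`|d|%N)%:Z by lia.
rewrite (filtration_index d _).2 natrX exprnP; congr (_ ^ _); lia.
Qed.

End Filtration.

Section Indices.
Variables (F : fieldType) (E : fieldExtType F).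
Variables (vF : F -> int) (vE : E -> int) (conj : 'AEnd(E)) (pi : F) (eps : E).
Hypothesis HvF : normalized_valuation vF.
Hypothesis HuE : unramified vF vE.
Hypothesis cK : involutive conj.
Hypothesis cV : forall d x, vge vE d x -> vge vE d (conj x).
Hypothesis cfix : forall x, conj x = x -> exists a, x = a%:A.
Hypothesis piU : uniformizer vF pi.
Hypothesis two0 : (2 : E) != 0.
Hypothesis v2 : vE 2 = 0.
Hypothesis eps0 : eps != 0.
Hypothesis veps : vE eps = 0.
Hypothesis ceps : conj eps = - eps.
Hypothesis Ffin : finmod (vge vF 1) (vge vF 0).

Local Notation q := (residue_card vF).
Local Notation adj := (adj conj).

Let HvE : normalized_valuation vE. Proof. by case: HuE. Qed.

Let conjA a : conj (a%:A) = a%:A :> E.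
Proof. by rewrite linearZ /= rmorph1. Qed.

Lemma index_residue d : finmod (vge vF (d + 1)) (vge vF d) /\
  ncosets (vge vF (d + 1)) (vge vF d) = q.
Proof.
case: piU => pi0 vpi; have p0 : pi ^ d != 0 by rewrite expfz_neq0.
have vp : vF (pi ^ d) = d by rewrite (valXz HvF)// vpi mulr1.
apply: (@ncosets_map _ _ (vge vF 1) (vge vF 0) _ _ (fun x => pi ^ d * x)) => //.
- exact: subgroup_vge.
- exact: subgroup_vge.
- by move=> x x0; have := vge_scale HvF 0 x p0 vp; rewrite add0r => ->.
- by move=> x y _ _; rewrite -mulrBr addrC; exact: (vge_scale HvF).
- move=> x hx; exists ((pi ^ d)^-1 * x); last by rewrite mulVKf// subrr; left.
  by rewrite -(addNr d); apply: (vgeM HvF) => //; right; rewrite (valV HvF)// vp.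
Qed.

Let two_inv : vge vE 0 (2^-1 : E).
Proof. by right; rewrite (valV HvE)// v2. Qed.

Let eps_inv : vge vE 0 (eps^-1 : E).
Proof. by right; rewrite (valV HvE)// veps. Qed.

Lemma half_add (x : E) : 2^-1 * (x + x) = x.
Proof. by field. Qed.

(** O_E = O_F + O_F eps, as 2 is a unit. *)
Lemma vge_eps d (a b : F) : vge vE d (a%:A + b *: eps) <-> vge vF d a /\ vge vF d b.
Proof.
have eb : b *: eps = b%:A * eps by rewrite mulr_algl.
split=> [h|[ha hb]]; last first.
  apply: (vgeD HvE); first exact/(vge_in_alg HuE).
  rewrite eb; apply: (vgeMr HvE); first exact/(vge_in_alg HuE).
  by right; rewrite veps.
have h' : vge vE d (a%:A - b *: eps).
  have := cV h; rewrite linearD /= conjA (_ : conj (b *: eps) = - (b *: eps))//.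
  by rewrite linearZ /= ceps scalerN.
have ha : vge vE d (a%:A : E).
  rewrite -[a%:A]half_add; apply: (vgeMl HvE) => //.
  by have := vgeD HvE h h'; rewrite addrACA subrr addr0.
split; first exact/(vge_in_alg HuE).
apply/(vge_in_alg HuE); rewrite -[b%:A](mulfK eps0) -eb; apply: (vgeMr HvE) => //.
by have := vgeB HvE h ha; rewrite addrAC subrr add0r.
Qed.

Lemma eps_span (x : E) : exists a b : F, x = a%:A + b *: eps.
Proof.
have [|a ha] := @cfix (2^-1 * (x + conj x)).
  by rewrite rmorphM fmorphV rmorph_nat rmorphD /= cK [conj x + x]addrC.
have [|b hb] := @cfix (2^-1 * eps^-1 * (x - conj x)).
  rewrite !rmorphM !fmorphV /= rmorph_nat rmorphB /= cK ceps -[conj x - x]opprB.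
  by rewrite invrN !mulrN mulNr opprK.
exists a, b; rewrite -ha -[b *: eps]mulr_algl -hb; field.
by rewrite eps0 two0.
Qed.

Lemma index_residueE d : finmod (vge vE (d + 1)) (vge vE d) /\
  ncosets (vge vE (d + 1)) (vge vE d) = (q ^ 2)%N.
Proof.
have [f1 f2] := index_residue d.
have HL := subgroup_vge (d + 1) HvF.
have [g1 g2] := ncosets_prod HL HL f1 f1.
have [|||h1 h2] := @ncosets_map _ _ (vge vF (d + 1) `*` vge vF (d + 1) : set (F * F)%type)
  (vge vF d `*` vge vF d) (vge vE (d + 1)) (vge vE d) (fun x => x.1%:A + x.2 *: eps)
  (subgroup_setX HL HL) (subgroup_vge _ HvE) g1.
- by move=> [a b] [/= ha hb]; apply/vge_eps.
- move=> [a b] [a' b'] _ _ /=.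
  have -> : a%:A + b *: eps - (a'%:A + b' *: eps) = (a - a')%:A + (b - b') *: eps.
    by rewrite !scalerBl; ring.
  by rewrite vge_eps.
- move=> x hx; have [a [b e]] := eps_span x; exists (a, b); last first.
    by rewrite /= e subrr; left.
  by apply/vge_eps; rewrite /= -e.
by split=> //; rewrite h2 g2 f2 mulnn.
Qed.

Lemma index_mxge m k d : finmod (@mxge _ _ vE m k (d + 1)) (mxge vE d) /\
  ncosets (@mxge _ _ vE m k (d + 1)) (mxge vE d) = (q ^ (2 * (m * k)))%N.
Proof.
have [[T [s hs]] f2] := index_residueE d.
have cT := transversal_card (subgroup_vge _ HvE) hs.
have h : transversal (@mxge _ _ vE m k (d + 1)) (mxge vE d)
    (fun M : 'M[T]_(m, k) => map_mx s M).
  case: hs => sA si ss; split=> [M i j|M N hMN|X hX].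
  - by rewrite mxE; exact: sA.
  - by apply/matrixP => i j; apply: si; have := hMN i j; rewrite !mxE.
  - have /choice[g hg] : forall ij : 'I_m * 'I_k, exists t, vge vE (d + 1) (X ij.1 ij.2 - s t).
      by move=> [i j]; apply: ss; exact: hX.
    exists (\matrix_(i, j) g (i, j)) => i j; rewrite !mxE; exact: (hg (i, j)).
split; first by exists 'M[T]_(m, k), (fun M : 'M[T]_(m, k) => map_mx s M).
rewrite (transversal_card (subgroup_mxge _ _ _ HvE) h) card_mx.
by rewrite -cT f2 -expnM.
Qed.

Lemma mxge_herm_eps k d (X Y : 'M[E]_k) : adj X = X -> adj Y = Y ->
  mxge vE d (X + eps *: Y) <-> mxge vE d X /\ mxge vE d Y.
Proof.
move=> hX hY.
have he : vge vE 0 eps by right; rewrite veps.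
split=> [h|[h1 h2]]; last first.
  by apply: (mxgeD HvE) => //; rewrite -[d]add0r; exact: (mxgeZ HvE).
have h' : mxge vE d (X - eps *: Y).
  by have := mxge_adj cV h; rewrite adjD adjZ hX hY ceps scaleNr.
have h1 : mxge vE d X.
  have -> : X = 2^-1 *: ((X + eps *: Y) + (X - eps *: Y)).
    by apply/matrixP => i j; rewrite !mxE; field.
  by rewrite -[d]add0r; apply: (mxgeZ HvE) => //; exact: (mxgeD HvE).
split=> //; have -> : Y = eps^-1 *: ((X + eps *: Y) - X).
  by apply/matrixP => i j; rewrite !mxE; field.
by rewrite -[d]add0r; apply: (mxgeZ HvE) => //; exact: (mxgeB HvE).
Qed.

(** M_k(E) = V_k(E) + eps V_k(E), compatibly with the lattices, so that the
   index for hermitian matrices is a square root of the one for all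
   matrices. *)
Lemma index_hermge k d : finmod (hermge vE (d + 1) : set (herm conj k)) (hermge vE d) /\
  ncosets (hermge vE (d + 1) : set (herm conj k)) (hermge vE d) = (q ^ (k ^ 2))%N.
Proof.
have [[T [s hs]] f2] := index_mxge k k d.
have HL := subgroup_hermge conj HvE k (d + 1).
have g1 : finmod (hermge vE (d + 1) : set (herm conj k)) (hermge vE d).
  have /choice[u hu] : forall t, exists Y : herm conj k, Y = 2^-1 *: (s t + adj (s t)) :> 'M[E]_k.
    by move=> t; apply: hermE; rewrite adjZ adjD adjK// fmorphV rmorph_nat addrC.
  apply: (@finmod_cover _ _ _ T u) => // Y hY.
  case: hs => _ _ /(_ (Y : 'M[E]_k) hY)[t ht]; exists t.
  suff: mxge vE (d + 1) ((Y - u t : herm conj k) : 'M[E]_k) by [].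
  rewrite herm_valB hu.
  have -> : (Y : 'M[E]_k) - 2^-1 *: (s t + adj (s t)) =
      2^-1 *: (((Y : 'M[E]_k) - s t) + adj ((Y : 'M[E]_k) - s t)).
    rewrite adjB herm_adj; apply/matrixP => i j; rewrite !mxE; field.
    by rewrite two0.
  rewrite -[d + 1]add0r; apply: (mxgeZ HvE) => //; apply: (mxgeD HvE) => //.
  exact: mxge_adj.
have [h1 h2] := ncosets_prod HL HL g1 g1.
have [|||_ e2] := @ncosets_map _ _ (hermge vE (d + 1) `*` hermge vE (d + 1) : set (herm conj k * herm conj k)%type)
  (hermge vE d `*` hermge vE d) (@mxge _ _ vE k k (d + 1)) (mxge vE d)
  (fun x => (x.1 : 'M[E]_k) + eps *: (x.2 : 'M[E]_k))
  (subgroup_setX HL HL) (subgroup_mxge _ _ _ HvE) h1.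
- by move=> [X Y] [/= hX hY]; apply/mxge_herm_eps; rewrite ?herm_adj.
- move=> [X Y] [X' Y'] _ _ /=.
  have -> : (X : 'M[E]_k) + eps *: (Y : 'M[E]_k) - ((X' : 'M[E]_k) + eps *: (Y' : 'M[E]_k)) =
      ((X : 'M[E]_k) - (X' : 'M[E]_k)) + eps *: ((Y : 'M[E]_k) - (Y' : 'M[E]_k)).
    by rewrite scalerBr opprD addrACA.
  by rewrite mxge_herm_eps -?herm_valB ?herm_adj.
- move=> X hX.
  have [|X1 e1] := @hermE _ _ conj k (2^-1 *: (X + adj X)).
    by rewrite adjZ adjD adjK// fmorphV rmorph_nat addrC.
  have [|X2 e2] := @hermE _ _ conj k ((2^-1 * eps^-1) *: (X - adj X)).
    rewrite adjZ adjB adjK// rmorphM !fmorphV /= rmorph_nat ceps invrN mulrN scaleNr.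
    by rewrite -scalerN opprB.
  have e : X = (X1 : 'M[E]_k) + eps *: (X2 : 'M[E]_k).
    by rewrite e1 e2; apply/matrixP => i j; rewrite !mxE; field; rewrite eps0 two0.
  exists (X1, X2); last by rewrite /= -e subrr; exact: mxge0.
  by apply/mxge_herm_eps; rewrite ?herm_adj// -e.
split=> //; apply/eqP; rewrite -(eqn_exp2r _ _ (ltn0Sn 1)) -mulnn -h2 -e2 f2.
by rewrite -expnM mulnC mulnn.
Qed.

End Indices.

(** * Whittaker integrals as numbers of solutions *)

Lemma card_transversal_sub (V : zmodType) (L A B : set V) (T : finType) (s : T -> V) :
  subgroup_set L -> transversal L A s -> B `<=` A ->
  (forall x y, B x -> L y -> B (x + y)) ->
  ncosets L B = #|[pred t | `[< B (s t) >]]|.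
Proof.
move=> HL [sA si ss] BA BL.
have h : transversal L B (fun t : {t | `[< B (s t) >]} => s (val t)).
  split=> [[t /= /asboolP]//|t u /si|x Bx]; first exact: val_inj.
  have [t ht] := ss _ (BA _ Bx).
  have hB : `[< B (s t) >].
    apply/asboolP; rewrite -(subrK x (s t)) addrC; apply: BL => //.
    exact: subgroupBC.
  by exists (exist _ t hB).
by rewrite (transversal_card HL h) card_sig.
Qed.

(** Orthogonality of characters: translation by a point where chi is not 1
   permutes the classes. *)
Lemma character_sum0 (C : fieldType) (V : zmodType) (L A : set V) (T : finType)
    (s : T -> V) (chi : V -> C) a :
  subgroup_set L -> subgroup_set A -> transversal L A s ->
  (forall x y, A x -> A y -> chi (x + y) = chi x * chi y) ->
  (forall x, L x -> chi x = 1) -> L `<=` A -> A a -> chi a != 1 ->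
  \sum_t chi (s t) = 0.
Proof.
move=> HL HA [sA si ss] chiM chiL LA Aa chia.
have /choice[tau htau] : forall t, exists u, L (a + s t - s u).
  by move=> t; apply: ss; exact: subgroupD.
have tau_inj : injective tau.
  move=> t u e; apply: si.
  have -> : s t - s u = (a + s t - s (tau t)) - (a + s u - s (tau u)).
    by rewrite e opprB addrA subrK opprD addrACA subrr add0r.
  by case: HL => _; apply.
have e : chi a * \sum_t chi (s t) = \sum_t chi (s t).
  rewrite [RHS](reindex_inj tau_inj) mulr_sumr; apply: eq_bigr => t _.
  rewrite -chiM// -[a + s t](subrK (s (tau t))) chiM//; last exact: LA.
  by rewrite chiL ?mul1r//; exact: htau.
apply/eqP; move/eqP: e; rewrite -subr_eq0 -{2}[\sum_t _]mul1r -mulrBl mulf_eq0.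
by rewrite subr_eq0 (negbTE chia).
Qed.

Section Fourier.
Variable R : realType.
Variables (F : fieldType) (E : fieldExtType F).
Variables (vF : F -> int) (vE : E -> int) (conj : 'AEnd(E)) (pi : F).
Hypothesis HvF : normalized_valuation vF.
Hypothesis HuE : unramified vF vE.
Hypothesis cK : involutive conj.
Hypothesis cV : forall d x, vge vE d x -> vge vE d (conj x).
Hypothesis cfix : forall x, conj x = x -> exists a, x = a%:A.
Hypothesis piU : uniformizer vF pi.
Hypothesis two0 : (2 : E) != 0.
Hypothesis v2 : vE 2 = 0.

Variable psi : F -> R[i].
Hypothesis psi_additive : forall x y, psi (x + y) = psi x * psi y.
Hypothesis psi_trivial : forall x, vge vF 0 x -> psi x = 1.
Hypothesis psi_nontrivial : exists2 x, vge vF 0 x & psi (pi^-1 * x) != 1.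

Local Notation adj := (adj conj).
Local Notation herm k := (herm conj k).

Let HvE : normalized_valuation vE. Proof. by case: HuE. Qed.

Lemma conj_in_alg a : conj (a%:A) = a%:A :> E.
Proof. by rewrite linearZ /= rmorph1. Qed.

Lemma in_alg_inj (a b : F) : a%:A = b%:A :> E -> a = b.
Proof. exact: (fmorph_inj (in_alg E)). Qed.

Section Pairing.
Variable n : nat.
Implicit Types Y Z : 'M[E]_(n + n).

Lemma pairFE Y Z : adj Y = Y -> adj Z = Z -> (pairF Y Z)%:A = \tr (Y *m Z).
Proof.
move=> hY hZ; have [|a ha] := @cfix (\tr (Y *m Z)).
  have e : conj (\tr (Y *m Z)) = \tr (adj (Y *m Z)).
    by rewrite /mxtrace rmorph_sum; apply: eq_bigr => i _; rewrite [in RHS]mxE.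
  by rewrite e adjM hY hZ mxtrace_mulC.
exact: (@xgetPex _ 0 [set a : F | a%:A = \tr (Y *m Z)] (ex_intro _ a (esym ha))).
Qed.

Lemma vge_pairF d e Y Z : adj Y = Y -> adj Z = Z -> mxge vE d Y -> mxge vE e Z ->
  vge vF (d + e) (pairF Y Z).
Proof.
move=> hY hZ dY eZ; apply/(vge_in_alg HuE); rewrite pairFE//.
by apply: (vge_sum HvE) => i _; exact: (mxgeM HvE dY eZ).
Qed.

Lemma psi_pairDl Y Y' Z : adj Y = Y -> adj Y' = Y' -> adj Z = Z ->
  psi (pairF (Y + Y') Z) = psi (pairF Y Z) * psi (pairF Y' Z).
Proof.
move=> hY hY' hZ; rewrite -psi_additive; congr psi; apply: in_alg_inj.
by rewrite scalerDl !pairFE// ?adjD ?hY ?hY'// mulmxDl mxtraceD.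
Qed.

Lemma psi_pairDr Y Z Z' : adj Y = Y -> adj Z = Z -> adj Z' = Z' ->
  psi (pairF Y (Z + Z')) = psi (pairF Y Z) * psi (pairF Y Z').
Proof.
move=> hY hZ hZ'; rewrite -psi_additive; congr psi; apply: in_alg_inj.
by rewrite scalerDl !pairFE// ?adjD ?hZ ?hZ'// mulmxDr mxtraceD.
Qed.

Lemma mxtrace_delta (i j : 'I_(n + n)) Z : \tr (delta_mx j i *m Z) = Z i j.
Proof.
rewrite /mxtrace (bigD1 j)//= big1 ?addr0 => [|a aj]; rewrite mxE.
  rewrite (bigD1 i)//= big1 ?addr0 => [|b bi]; first by rewrite mxE !eqxx mul1r.
  by rewrite mxE (negbTE bi) andbF mul0r.
by apply: big1 => b _; rewrite mxE (negbTE aj) mul0r.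
Qed.

Lemma delta_hermitian (i j : 'I_(n + n)) (y : E) :
  adj (y *: delta_mx j i + conj y *: delta_mx i j) = y *: delta_mx j i + conj y *: delta_mx i j.
Proof.
by apply/matrixP => a b; rewrite !mxE rmorphD !rmorphM /= cK !rmorph_nat addrC ![(b == _) && _]andbC.
Qed.

(** The lattice V(O_E) is its own dual: an entry of Z outside pi^k O_E is
   detected by a matrix Y supported on that entry and its transpose. *)
Lemma psi_pair_nontrivial (k : int) Z : adj Z = Z -> ~ mxge vE k Z ->
  exists Y, [/\ adj Y = Y, mxge vE (- k) Y & psi (pairF Y Z) != 1].
Proof.
move=> hZ /existsNP[i /existsNP[j hij]].
have z0 : Z i j != 0 by apply/negP => /eqP e; apply: hij; left.
have vz : vE (Z i j) < k.
  have : ~ (k <= vE (Z i j)) by move=> h; apply: hij; right.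
  by lia.
have [x x0 hx] := psi_nontrivial; pose c := pi^-1 * x.
have [pi0 vpi] := piU.
have vc : vge vE (-1) (c%:A : E).
  apply/(vge_in_alg HuE); apply: (vgeMr HvF) => //.
  by right; rewrite (valV HvF)// vpi.
pose y : E := c%:A * (2 * Z i j)^-1.
have vy : vge vE (- k) y.
  have h : vge vE (- vE (Z i j)) (2 * Z i j)^-1.
    by right; rewrite (valV HvE) ?mulf_neq0// (valM HvE)// v2; lia.
  by apply: vgeW (vgeM HvE vc h); lia.
exists (y *: delta_mx j i + conj y *: delta_mx i j); split.
- exact: delta_hermitian.
- have vb (c' : bool) : vge vE 0 (c'%:R : E).
    by case: c'; [exact: vge01|left].
  move=> a b; rewrite !mxE; apply: (vgeD HvE); apply: (vgeMr HvE) => //.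
  exact: cV.
suff -> : pairF (y *: delta_mx j i + conj y *: delta_mx i j) Z = c by [].
apply: in_alg_inj; rewrite pairFE//; last exact: delta_hermitian.
rewrite mulmxDl -!scalemxAl mxtraceD !mxtraceZ !mxtrace_delta.
have ez : conj (Z i j) = Z j i by rewrite -{2}hZ mxE.
have e1 : y * Z i j = 2^-1 * c%:A by rewrite /y; field; rewrite z0 two0.
rewrite -ez -rmorphM /= e1 rmorphM fmorphV /= rmorph_nat conj_in_alg.
by field.
Qed.

End Pairing.

Lemma adj_hact m k (A : 'M[E]_m) (X : 'M[E]_(m, k)) :
  adj A = A -> adj (hact conj A X) = hact conj A X.
Proof. by move=> hA; rewrite !hactE !adjM adjK// hA mulmxA. Qed.

Lemma hact_shift (d : int) m k (A : 'M[E]_m) (X D : 'M[E]_(m, k)) :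
  mxge vE (-1) A -> 0 <= d -> mxge vE 0 X -> mxge vE (d + 1) D ->
  mxge vE d (hact conj A (X + D) - hact conj A X).
Proof.
move=> A1 d0 X0 D1; rewrite !hactE adjD !mulmxDl !mulmxDr.
have X0' := mxge_adj cV X0; have D1' := mxge_adj cV D1.
have -> : adj X *m A *m X + adj X *m A *m D + (adj D *m A *m X + adj D *m A *m D) -
   adj X *m A *m X = adj X *m A *m D + (adj D *m A *m X + adj D *m A *m D).
  by rewrite addrAC [X in X + _]addrAC subrr add0r.
have h1 := mxgeM HvE (mxgeM HvE X0' A1) D1.
have h2 := mxgeM HvE (mxgeM HvE D1' A1) X0.
have h3 := mxgeM HvE (mxgeM HvE D1' A1) D1.
apply: (mxgeD HvE); last apply: (mxgeD HvE).
- by apply: mxgeW h1; lia.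
- by apply: mxgeW h2; lia.
- by apply: mxgeW h3; lia.
Qed.

Section Whittaker.
Variables (muM : forall m k, {measure set (borel (@mxge _ _ vE m k)) -> \bar R})
  (muV : forall k, {measure set (borel (@hermge _ _ vE conj k)) -> \bar R}).
Hypothesis muM_haar : forall m k, normalized_haar (muM m k).
Hypothesis muV_haar : forall k, normalized_haar (muV k).
Hypothesis Mfin : forall m k (d e : int), e <= d -> finmod (@mxge _ _ vE m k d) (mxge vE e).
Hypothesis Vfin : forall k (d e : int), e <= d ->
  finmod (hermge vE d : set (herm k)) (hermge vE e).
Variables (n h t r : nat) (B : 'M[E]_(n + n)).
Hypothesis hB : adj B = B.

Local Notation A := (Atr E pi n t r).

Lemma adj_Atr : adj A = A.
Proof.
rewrite /Atr adj_block adj1 !adj0; congr (block_mx _ _ _ _).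
apply/matrixP => i j; rewrite !mxE eq_sym rmorphMn /=.
have [->|_] := eqVneq i j; last by rewrite !mulr0n.
by rewrite !mulr1n; case: ifP => _; rewrite ?rmorph1// fmorphV /= conj_in_alg.
Qed.

Lemma mxge_Atr : mxge vE (-1) A.
Proof.
have [pi0 vpi] := piU.
have piE0 : (pi%:A : E) != 0 by rewrite scaler_eq0 oner_eq0 orbF.
apply/mxge_block; split; try exact: mxge0; last first.
  by apply: mxgeW (@mxge1 _ _ _ HvE _).
move=> i j; rewrite !mxE; case: eqP => _; last by left.
rewrite mulr1n; case: ifP => _; first by apply: vgeW (vge01 HvE).
right; rewrite (valV HvE)//; have -> : vE pi%:A = 1 by case: HuE => _ /(_ _ pi0) ->.
by [].
Qed.

Definition solutions (k : nat) : set 'M[E]_(n + n + 2 * r, n + n) :=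
  [set X | support_ht vE h t X /\ mxge vE k%:Z (hact conj A X - B)].

Lemma support_shift (k : nat) X D :
  @support_ht _ _ vE n h t r X -> mxge vE (k%:Z + 1) D -> support_ht vE h t (X + D).
Proof.
move=> [X0 X1] D1; split=> [|i j hi hj].
  by apply: (mxgeD HvE) => //; apply: mxgeW D1; lia.
by rewrite mxE; apply: (vgeD HvE); [exact: X1|apply: vgeW (D1 i j); lia].
Qed.

Lemma solutions_shift k X D :
  solutions k X -> mxge vE (k%:Z + 1) D -> solutions k (X + D).
Proof.
move=> [sX hX] D1; split; first exact: support_shift D1.
rewrite -(subrKA (hact conj A X)); apply: (mxgeD HvE) => //.
by apply: hact_shift => //; [exact: mxge_Atr|case: sX].
Qed.

(** Integrating over Y detects the congruence A[X] = B modulo pi^k, by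
   orthogonality of characters and the self-duality of V(O_E); all functions
   are locally constant with compact support, so the integrals are finite
   sums and may be exchanged. *)
Lemma Whittaker_term (k : nat) :
  cintegral (muV (n + n)) (hermge vE (- k%:Z)) (fun Y : herm (n + n) =>
      cintegral (muM (n + n + 2 * r) (n + n)) setT
        (fun X : 'M[E]_(n + n + 2 * r, n + n) =>
           psi (pairF Y (hact conj A X - B)) *
           \1_(support_ht vE h t (r := r)) X)) =
  (ncosets (mxge vE (k%:Z + 1)) (solutions k))%:R *
  (lattice_vol (@mxge _ _ vE (n + n + 2 * r) (n + n)) R (k%:Z + 1))%:C *
  (lattice_vol (@hermge _ _ vE conj (n + n)) R (- k%:Z))%:C.
Proof.
set m := (n + n + 2 * r)%N.
pose f (Y : herm (n + n)) (X : 'M[E]_(m, n + n)) : R[i] :=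
  psi (pairF Y (hact conj A X - B)) * \1_(support_ht vE h t (r := r)) X.
have f0 Y X : ~ mxge vE 0 X -> f Y X = 0.
  move=> hX; rewrite /f indicE memNset ?mulr0//.
  by case.
have Zh X : adj (hact conj A X - B) = hact conj A X - B.
  by rewrite adjB hB adj_hact ?adj_Atr.
have subM d := @subgroup_mxge _ _ vE m (n + n) d HvE.
have subV d := subgroup_hermge conj HvE (n + n) d.
have leM (d e : int) : e <= d -> @mxge _ _ vE m (n + n) d `<=` mxge vE e.
  by move=> ed X; exact: mxgeW.
have leV (d e : int) : e <= d -> @hermge _ _ vE conj (n + n) d `<=` hermge vE e.
  by move=> ed X; exact: mxgeW.
have [b hb] := mxge_exists vE B.
(* M is so large that psi(<Y, A[X] - B>) only depends on Y modulo pi^M *)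
pose M : int := (k + b + 1)%:Z.
have [T [s hs]] := Vfin (n + n) (d := M) (e := - k%:Z) ltac:(lia).
have [U [u hu]] := Mfin m (n + n) (d := k%:Z + 1) (e := 0) ltac:(lia).
have hZ X : mxge vE 0 X -> mxge vE (- M) (hact conj A X - B).
  move=> X0; apply: (mxgeB HvE); last by apply: mxgeW hb; rewrite /M; lia.
  rewrite hactE; have := mxgeM HvE (mxgeM HvE (mxge_adj cV X0) mxge_Atr) X0.
  by apply: mxgeW; rewrite /M; lia.
have inner (Y : herm (n + n)) : hermge vE (- k%:Z) Y ->
    cintegral (muM m (n + n)) setT (f Y) =
    (\sum_a f Y (u a)) * (lattice_vol (@mxge _ _ vE m (n + n)) R (k%:Z + 1))%:C.
  move=> hY; rewrite (cintegral_setT _ (A := mxge vE 0)); last exact: f0.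
  apply: (cintegral_transversal subM (Mfin m (n + n)) leM (muM_haar _ _) hu) => X D X0 D1.
    by apply: (mxgeD HvE) => //; apply: mxgeW D1; lia.
  have hD := hact_shift mxge_Atr (d := k%:Z) ltac:(lia) X0 D1.
  rewrite /f; congr (_ * _).
    have Dh : adj (hact conj A (X + D) - hact conj A X) = hact conj A (X + D) - hact conj A X.
      by rewrite adjB !adj_hact ?adj_Atr.
    rewrite -[hact conj A (X + D)](subrK (hact conj A X)) -addrA.
    rewrite (psi_pairDr (herm_adj Y) Dh (Zh X)) (psi_trivial (x := pairF Y (hact conj A (X + D) - _))) ?mul1r//.
    by apply: vgeW (vge_pairF (herm_adj Y) Dh hY hD); lia.
  rewrite !indicE; congr (nat_of_bool _)%:R; apply/idP/idP; rewrite !inE => hX.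
    rewrite -[X](addrK D); apply: support_shift hX _; exact: (mxgeN HvE).
  exact: support_shift hX _.
have fY (Y D : herm (n + n)) : hermge vE M D -> f (Y + D) = f Y.
  move=> hD; apply/funext => X.
  have [X0|X0] := pselect (mxge vE 0 X); last by rewrite !f0.
  rewrite /f herm_valD psi_pairDl ?herm_adj// (psi_trivial (x := pairF D _)) ?mulr1//.
  by apply: vgeW (vge_pairF (herm_adj D) (Zh X) hD (hZ _ X0)); lia.
rewrite (cintegral_transversal subV (Vfin (n + n)) leV (muV_haar _) hs); first last.
- by move=> Y D hY hD; rewrite -/(f _) fY.
- by move=> Y D hY hD; apply: (subgroupD (subV _)) => //; apply: leV hD; rewrite /M; lia.
rewrite (eq_bigr (fun a => (\sum_b f (s a) (u b)) *
  (lattice_vol (@mxge _ _ vE m (n + n)) R (k%:Z + 1))%:C)); last first.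
  by move=> a _; rewrite -inner//; case: hs.
rewrite -mulr_suml exchange_big /=.
have sumY b' : \sum_a f (s a) (u b') = (`[< solutions k (u b') >] : nat)%:R * #|T|%:R.
  rewrite /f -mulr_suml.
  have [X0 _ _] := hu; set Z := hact conj A (u b') - B.
  have [hk|hk] := pselect (mxge vE k%:Z Z).
    rewrite (eq_bigr (fun=> 1)); last first.
      move=> a _; apply: psi_trivial; have [sa _ _] := hs.
      by apply: vgeW (vge_pairF (herm_adj (s a)) (Zh _) (sa a) hk); lia.
    rewrite sumr_const mulrC indicE; congr ((nat_of_bool _)%:R * _).
    by apply/idP/asboolP; [rewrite inE => ?; split|move=> [? _]; rewrite inE].
  have -> : `[< solutions k (u b') >] = false by apply/asboolPn => -[].
  have [Y0 [hY0 dY0 pY0]] := psi_pair_nontrivial (Zh (u b')) hk.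
  have [Y1 e1] := hermE hY0.
  rewrite (character_sum0 (V := herm (n + n)) (chi := fun Y : herm (n + n) => psi (pairF Y Z))
    (subV _) (subV _) hs (a := Y1)) ?mul0r//.
  - by move=> x y hx hy; rewrite herm_valD psi_pairDl ?herm_adj//; exact: Zh.
  - move=> x hx; apply: psi_trivial.
    by apply: vgeW (vge_pairF (herm_adj x) (Zh _) hx (hZ _ (X0 b'))); lia.
  - by apply: leV; rewrite /M; lia.
  - by rewrite /hermge /= e1.
  - by rewrite e1.
rewrite (eq_bigr (fun b' => (`[< solutions k (u b') >] : nat)%:R * #|T|%:R)); last first.
  by move=> b' _; exact: sumY.
rewrite -mulr_suml -natr_sum.
have -> : (\sum_b' `[< solutions k (u b') >])%N = ncosets (mxge vE (k%:Z + 1)) (solutions k).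
  rewrite (card_transversal_sub (subM _) hu); first last.
  - by move=> X D; exact: solutions_shift.
  - by move=> X [[]].
  by rewrite -sum1_card [RHS]big_mkcond; apply: eq_bigr => b' _ /=; rewrite inE; case: asboolP.
have -> : lattice_vol (@hermge _ _ vE conj (n + n)) R (- k%:Z) =
    #|T|%:R * lattice_vol (@hermge _ _ vE conj (n + n)) R M.
  have inv (x y : herm (n + n)) : hermge vE (- k%:Z) x -> hermge vE M y -> hermge vE (- k%:Z) (x + y).
    by move=> hx hy; apply: (subgroupD (subV _)) => //; apply: leV hy; rewrite /M; lia.
  have := haar_measure_transversal subV (muV_haar (n + n)) hs inv.
  rewrite !(haar_lattice subV (Vfin (n + n)) leV (muV_haar (n + n))).
  by rewrite sumEFin big_enum sumr_const mulr_natl => -[].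
rewrite (rmorphM (real_complex R)) (rmorph_nat (real_complex R)); ring.
Qed.

End Whittaker.
End Fourier.

(** * Splitting off a pi^-1-modular summand *)

Lemma At_block (F : fieldType) (E : fieldExtType F) (pi : F) n :
  At E pi n n = block_mx 1%:M 0 0 ((pi%:A)^-1)%:M.
Proof.
apply/matrixP => i j; rewrite !mxE addnK.
case: (splitP i) => a ea; rewrite mxE; case: (splitP j) => b eb; rewrite !mxE.
- by rewrite -val_eqE /= ea eb val_eqE.
- rewrite (_ : (i == j) = false) ?mulr0n//; apply/negbTE; rewrite -val_eqE /= ea eb.
  by have := ltn_ord a; lia.
- rewrite (_ : (i == j) = false) ?mulr0n//; apply/negbTE; rewrite -val_eqE /= ea eb.
  by have := ltn_ord b; lia.
- by rewrite -val_eqE /= ea eb eqn_add2l val_eqE.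
Qed.

Section Parametrization.
Variables (F : fieldType) (E : fieldExtType F).
Variables (vF : F -> int) (vE : E -> int) (conj : 'AEnd(E)) (pi : F).
Hypothesis HvE : normalized_valuation vE.
Hypothesis cK : involutive conj.
Hypothesis cV : forall d x, vge vE d x -> vge vE d (conj x).
Hypothesis two0 : (2 : E) != 0.
Hypothesis v2 : vE 2 = 0.

Local Notation adj := (adj conj).
Local Notation p := (pi%:A : E).

Hypothesis p0 : p != 0.
Hypothesis vp : vE p = 1.

Let cp : conj p = p. Proof. by rewrite linearZ /= rmorph1. Qed.

Let vgep : vge vE 1 p. Proof. by right; rewrite vp. Qed.

(** The choice depends on the set of admissible T only, hence on the class of M
   modulo pi^d; constructions that use this root are compatible with
   congruences. *)
Definition sqrt_mod (d : nat) k (M : 'M[E]_k) : 'M[E]_k :=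
  xget 1%:M [set T | mxge vE 1 (T - 1%:M) /\ mxge vE d%:Z (adj T *m T - M)].

Lemma sqrt_modP d k (M : 'M[E]_k) : adj M = M -> mxge vE 1 (M - 1%:M) ->
  GLO vE (sqrt_mod d M) /\
  mxge vE d%:Z (adj (sqrt_mod d M) *m sqrt_mod d M - M).
Proof.
move=> hM M1; have ex := hermitian_sqrt HvE cK cV two0 v2 hM M1 d.
have [h1 h2] := @xgetPex _ 1%:M
  [set T | mxge vE 1 (T - 1%:M) /\ mxge vE d%:Z (adj T *m T - M)] ex.
by split=> //; exact: GLO1.
Qed.

Lemma sqrt_mod_cong d k (M M' : 'M[E]_k) : mxge vE d%:Z (M - M') ->
  sqrt_mod d M = sqrt_mod d M'.
Proof.
move=> h; congr (xget _ _); apply/seteqP; split=> T [h1 h2]; split=> //.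
  by rewrite -(subrKA M); exact: (mxgeD HvE).
by rewrite -(subrKA M'); apply: (mxgeD HvE) => //; exact: (mxgeBC HvE).
Qed.

Lemma GLO_almost_unitary k (b N : 'M[E]_k) : mxge vE 0 b ->
  mxge vE 1 (N - 1%:M) -> mxge vE 1 (adj b *m b - N) -> GLO vE b.
Proof.
move=> b0 N1 hb; apply: (GLO_left_inv HvE b0 (mxge_adj cV b0)).
by rewrite -(subrKA N); exact: (mxgeD HvE).
Qed.

Section Gram.
Variables (m k : nat) (e : 'M[E]_(m, k)).
Hypothesis e0 : mxge vE 0 e.

Definition gram_in : 'M[E]_k := 1%:M - p *: (adj e *m e).
Definition gram_out : 'M[E]_m := 1%:M - p *: (e *m adj e).

Lemma gram_inP : adj gram_in = gram_in /\ mxge vE 1 (gram_in - 1%:M).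
Proof.
split; first by rewrite /gram_in adjB adj1 adjZ adjM adjK// cp.
rewrite /gram_in addrAC subrr add0r; apply: (mxgeN HvE); rewrite -[1]addr0.
by apply: (mxgeZ HvE) => //; apply: (mxgeMl HvE) => //; exact: mxge_adj.
Qed.

Lemma gram_outP : adj gram_out = gram_out /\ mxge vE 1 (gram_out - 1%:M).
Proof.
split; first by rewrite /gram_out adjB adj1 adjZ adjM adjK// cp.
rewrite /gram_out addrAC subrr add0r; apply: (mxgeN HvE); rewrite -[1]addr0.
by apply: (mxgeZ HvE) => //; apply: (mxgeMl HvE) => //; exact: mxge_adj.
Qed.

(** The push-through identity (1 - pi e e^* ) e = e (1 - pi e^* e) shows that
   1 + pi e (b^* b)^-1 e^* is inverse to 1 - pi e e^* = T^* T when
   b^* b = 1 - pi e^* e. *)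
Lemma push_through (d : int) (b : 'M[E]_k) (T : 'M[E]_m) : GLO vE b -> GLO vE T ->
  mxge vE d (adj b *m b - gram_in) -> mxge vE d (adj T *m T - gram_out) ->
  mxge vE d (T *m (1%:M + p *: (e *m invmx b *m adj (invmx b) *m adj e)) *m adj T - 1%:M).
Proof.
move=> Gb GT hb hT; set beta := invmx b; set G := 1%:M + _.
have [ub b0 bi0] := Gb; have [uT T0 Ti0] := GT.
have p00 : vge vE 0 p by apply: vgeW vgep.
have e0' := mxge_adj cV e0; have bi0' := mxge_adj cV bi0.
have G0 : mxge vE 0 G.
  apply: (mxgeD HvE); first exact: mxge1.
  rewrite -[0]addr0; apply: (mxgeZ HvE) => //.
  by do 3![apply: (mxgeMl HvE) => //]; do ?[apply: (mxgeMr HvE) => //].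
have MG : mxge vE d (gram_out *m G - 1%:M).
  have eN : gram_out *m e = e *m gram_in.
    by rewrite mulmxBl mulmxBr mul1mx mulmx1 -scalemxAl -scalemxAr mulmxA.
  have -> : gram_out *m G - 1%:M =
      p *: (e *m ((gram_in - adj b *m b) *m beta *m adj beta) *m adj e).
    rewrite mulmxDr mulmx1 -scalemxAr !mulmxA eN.
    have -> : e *m gram_in *m beta *m adj beta *m adj e =
        e *m (gram_in - adj b *m b) *m beta *m adj beta *m adj e + e *m adj e.
      rewrite -{1}(subrK (adj b *m b) gram_in) mulmxDr !mulmxDl; congr (_ + _).
      rewrite -!mulmxA mulKVmx//; have [uab ->] := adj_inv conj ub.
      by rewrite mulKVmx.
    rewrite scalerDr /gram_out; move: (p *: (e *m adj e)) (p *: _) (1%:M) => a c o.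
    by apply/matrixP => i j; rewrite !mxE; ring.
  rewrite -[d]add0r; apply: (mxgeZ HvE) => //.
  apply: (mxgeMr HvE) => //; apply: (mxgeMl HvE) => //.
  by do 2![apply: (mxgeMr HvE) => //]; exact: (mxgeBC HvE).
have GTa := GLO_adj cV GT.
apply/(GLO_mxgel HvE _ _ GTa); have [uTa _ _] := GTa.
apply/(GLO_mxger HvE (g := invmx (adj T)) _ _ (GLO_inv GTa)).
have -> : adj T *m (T *m G *m adj T - 1%:M) *m invmx (adj T) =
    (adj T *m T - gram_out) *m G + (gram_out *m G - 1%:M).
  rewrite mulmxBr mulmx1 !mulmxBl mulmxV// !mulmxA -[_ *m adj T *m _]mulmxA mulmxV// mulmx1.
  by rewrite addrA subrK.
by apply: (mxgeD HvE) => //; exact: (mxgeMr HvE).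
Qed.

End Gram.

Section Build.
Variables n r : nat.
Local Notation m := (n + 2 * r)%N.

(** The first n columns consist of blocks u, pi v, w and the last n columns of
   blocks a, b, c, where z = (u, w) and e = (a, c): the blocks v and b belong to
   the pi^-1-modular part of the form. *)
Definition build (z : 'M[E]_(m, n)) (v : 'M[E]_n) (e : 'M[E]_(m, n)) (b : 'M[E]_n) :
    'M[E]_(n + n + 2 * r, n + n) :=
  col_mx (block_mx (usubmx z) (usubmx e) (p *: v) b) (row_mx (dsubmx z) (dsubmx e)).

Lemma mxge_vsub d (z : 'M[E]_(m, n)) :
  mxge vE d z <-> mxge vE d (usubmx z) /\ mxge vE d (dsubmx z).
Proof. by rewrite -{1}(vsubmxK z) mxge_col. Qed.

Lemma mxge_build d z v e b : mxge vE d (build z v e b) <->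
  [/\ mxge vE d z, mxge vE d (p *: v), mxge vE d e & mxge vE d b].
Proof.
rewrite /build mxge_col mxge_block mxge_row.
split=> [[[h1 h2 h3 h4] [h5 h6]]|[/mxge_vsub[h1 h5] h3 /mxge_vsub[h2 h6] h4]]; last by [].
by split=> //; apply/mxge_vsub.
Qed.

Lemma buildB z v e b z' v' e' b' :
  build z v e b - build z' v' e' b' = build (z - z') (v - v') (e - e') (b - b').
Proof.
rewrite /build opp_col_mx add_col_mx opp_block_mx add_block_mx opp_row_mx add_row_mx.
have uB (x y : 'M[E]_(m, n)) : usubmx (x - y) = usubmx x - usubmx y.
  by apply/matrixP => i j; rewrite !mxE.
have dB (x y : 'M[E]_(m, n)) : dsubmx (x - y) = dsubmx x - dsubmx y.
  by apply/matrixP => i j; rewrite !mxE.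
by rewrite !uB !dB scalerBr.
Qed.

Lemma hact_build z v e b :
  hact conj (Atr E pi n n r) (build z v e b) =
  block_mx (adj z *m z + p *: (adj v *m v)) (adj z *m e + adj v *m b)
           (adj e *m z + adj b *m v) (adj e *m e + p^-1 *: (adj b *m b)).
Proof.
have gram (x y : 'M[E]_(m, n)) :
    adj x *m y = adj (usubmx x) *m usubmx y + adj (dsubmx x) *m dsubmx y.
  by rewrite -{1}(vsubmxK x) -{1}(vsubmxK y) adj_col mul_row_col.
rewrite hactE /Atr At_block /build adj_col adj_block adj_row adjZ cp.
rewrite mul_row_block !mulmx0 addr0 add0r mulmx1 mul_row_col mulmx_block mulmx_block.
rewrite !mulmx0 !mulmx1 !addr0 !add0r mul_col_row add_block_mx.
rewrite !mul_mx_scalar !gram -!scalemxAl -!scalemxAr !scalerA mulVf// mul1r !scale1r.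
by congr block_mx; rewrite addrAC.
Qed.

Lemma build_surj X : @support_ht _ _ vE n n n r X ->
  exists z v e b, X = build z v e b /\
    [/\ mxge vE 0 z, mxge vE 0 v, mxge vE 0 e & mxge vE 0 b].
Proof.
move=> [X0 X1]; pose P : 'M[E]_(n + n, n + n) := usubmx X; pose Q := dsubmx X.
exists (col_mx (ulsubmx P) (lsubmx Q)), (p^-1 *: dlsubmx P),
  (col_mx (ursubmx P) (rsubmx Q)), (drsubmx P).
have e1 : X = build (col_mx (ulsubmx P) (lsubmx Q)) (p^-1 *: dlsubmx P)
    (col_mx (ursubmx P) (rsubmx Q)) (drsubmx P).
  by rewrite /build !col_mxKu !col_mxKd scalerA mulfV// scale1r submxK hsubmxK vsubmxK.
split=> //; move: X0; rewrite {1}e1 => /mxge_build[h1 _ h3 h4]; split=> //.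
have hp : vge vE (-1) p^-1 by right; rewrite (valV HvE)// vp.
have hd : mxge vE 1 (dlsubmx P).
  move=> i j; rewrite !mxE; apply: X1 => /=; last by rewrite addnK.
  by rewrite addnK leq_addr ltn_add2l ltn_ord.
by have := mxgeZ HvE hp hd; rewrite addNr.
Qed.

Lemma build_support z v e b : mxge vE 0 z -> mxge vE 0 v -> mxge vE 0 e ->
  mxge vE 0 b -> @support_ht _ _ vE n n n r (build z v e b).
Proof.
move=> z0 v0 e0 b0.
have hpv : mxge vE 1 (p *: v) by rewrite -[1]addr0; exact: (mxgeZ HvE).
split; first by apply/mxge_build; split=> //; apply: mxgeW hpv.
move=> i j; rewrite !addnK => hi hj; rewrite /build mxE.
case: splitP => i' ei; last by move: hi; rewrite ei; clear; lia.
rewrite mxE; case: splitP => i'' ei'; first by move: hi (ltn_ord i''); rewrite ei ei'; clear; lia.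
rewrite mxE; case: splitP => j' ej; last by move: hj; rewrite ej; clear; lia.
exact: hpv.
Qed.

End Build.

End Parametrization.

Section SplitCount.
Variables (F : fieldType) (E : fieldExtType F).
Variables (vE : E -> int) (conj : 'AEnd(E)) (pi : F).
Hypothesis HvE : normalized_valuation vE.
Hypothesis cK : involutive conj.
Hypothesis cV : forall d x, vge vE d x -> vge vE d (conj x).
Hypothesis two0 : (2 : E) != 0.
Hypothesis v2 : vE 2 = 0.
Local Notation adj := (adj conj).
Local Notation p := (pi%:A : E).
Hypothesis p0 : p != 0.
Hypothesis vp : vE p = 1.

Let cp : conj p = p. Proof. by rewrite linearZ /= rmorph1. Qed.

Let vgep : vge vE 0 p. Proof. by right; rewrite vp. Qed.

Definition unitary_mod n (d : nat) : set 'M[E]_n :=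
  [set b | mxge vE 0 b /\ mxge vE d%:Z (adj b *m b - 1%:M)].

Definition gram_solutions m n (d : nat) (C : 'M[E]_n) : set 'M[E]_(m, n) :=
  [set z | mxge vE 0 z /\ mxge vE d%:Z (adj z *m z - C)].

Variables n r k : nat.
Variable C : 'M[E]_n.
Local Notation m := (n + 2 * r)%N.
Local Notation B := (block_mx C 0 0 (p^-1 *: 1%:M) : 'M[E]_(n + n)).
Local Notation d := (k%:Z + 1).

Let dE : d = k.+1%:Z. Proof. by clear; lia. Qed.

Definition inner_sqrt (e : 'M[E]_(m, n)) := sqrt_mod vE conj k.+1 (gram_in conj pi e).
Definition outer_sqrt (e : 'M[E]_(m, n)) := sqrt_mod vE conj k.+1 (gram_out conj pi e).

(** The solutions X = (X1 | X2) of A[X] = diag(C, pi^-1): given e, the columns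
   X2 are determined by an approximately unitary b', and splitting off their
   span leaves z' with z'^* z' = C on the orthogonal complement. *)
Definition assemble (x : ('M[E]_(m, n) * 'M[E]_n) * ('M[E]_(m, n) * 'M[E]_n))
    : 'M[E]_(n + n + 2 * r, n + n) :=
  let: ((z', v'), (e, b')) := x in
  let b := b' *m inner_sqrt e in
  let z := adj (outer_sqrt e) *m z' in
  build pi z (v' - adj (invmx b) *m adj e *m z) e b.

Lemma inner_sqrtP e : mxge vE 0 e -> GLO vE (inner_sqrt e) /\
  mxge vE d (adj (inner_sqrt e) *m inner_sqrt e - gram_in conj pi e).
Proof.
move=> e0; have [h1 h2] := gram_inP HvE cK cV vp e0.
by rewrite dE; exact: sqrt_modP.
Qed.

Lemma outer_sqrtP e : mxge vE 0 e -> GLO vE (outer_sqrt e) /\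
  mxge vE d (adj (outer_sqrt e) *m outer_sqrt e - gram_out conj pi e).
Proof.
move=> e0; have [h1 h2] := gram_outP HvE cK cV vp e0.
by rewrite dE; exact: sqrt_modP.
Qed.

Lemma sqrt_unitary e (b' : 'M[E]_n) : mxge vE 0 e -> mxge vE 0 b' ->
  let b := b' *m inner_sqrt e in
  mxge vE d (adj b *m b - gram_in conj pi e) <-> mxge vE d (adj b' *m b' - 1%:M).
Proof.
move=> e0 b'0 b; have [GS hS] := inner_sqrtP e0; set S := inner_sqrt e in GS hS b *.
have GSa := GLO_adj cV GS.
have eq : adj b *m b - gram_in conj pi e =
    adj S *m (adj b' *m b' - 1%:M) *m S + (adj S *m S - gram_in conj pi e).
  by rewrite /b adjM mulmxBr mulmx1 mulmxBl !mulmxA addrA subrK.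
have hZ := iff_trans (GLO_mxger HvE d (adj S *m (adj b' *m b' - 1%:M)) GS)
  (GLO_mxgel HvE d (adj b' *m b' - 1%:M) GSa).
rewrite eq -hZ; split=> h; last exact: (mxgeD HvE).
by have := mxgeB HvE h hS; rewrite addrK.
Qed.

(** In these coordinates the lower right block of the equation concerns b'
   only, the off-diagonal blocks are v'^* b and its adjoint, and once v' = 0 the
   upper left block is z'^* z' - C, by [push_through]. *)
Lemma assemble_solutions z' v' e b' :
  mxge vE 0 z' -> mxge vE 0 e -> mxge vE 0 b' ->
  @solutions _ _ vE conj pi n n n r B k (assemble ((z', v'), (e, b'))) <->
  [/\ gram_solutions k C z', mxge vE k%:Z v' & unitary_mod k.+1 b'].
Proof.
move=> z'0 e0 b'0; rewrite /assemble.
have bU := sqrt_unitary e0 b'0.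
have [GS hS] := inner_sqrtP e0; have [GT hT] := outer_sqrtP e0.
set S := inner_sqrt e in GS hS bU *; set T := outer_sqrt e in GT hT *.
set b := b' *m S in bU *; set z := adj T *m z'.
set beta := invmx b; set w := adj beta *m adj e *m z.
have [uS S0 Si0] := GS; have [uT T0 Ti0] := GT.
have e0' := mxge_adj cV e0.
have b0 : mxge vE 0 b by exact: (mxgeMl HvE).
have z0 : mxge vE 0 z by apply: (mxgeMl HvE) => //; exact: mxge_adj.
have h22 : mxge vE k%:Z (adj e *m e + p^-1 *: (adj b *m b) - p^-1 *: 1%:M) <->
    mxge vE d (adj b' *m b' - 1%:M).
  rewrite -bU -(mxge_scale HvE _ _ p0 vp).
  suff -> : p *: (adj e *m e + p^-1 *: (adj b *m b) - p^-1 *: 1%:M) =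
      adj b *m b - gram_in conj pi e by [].
  rewrite scalerBr scalerDr !scalerA mulfV// !scale1r /gram_in opprB.
  by rewrite [in RHS]addrA [X in _ = X + _]addrC.
have Gb : mxge vE d (adj b' *m b' - 1%:M) -> GLO vE b.
  move/bU => h; have [_ N1] := gram_inP HvE cK cV vp e0.
  by apply: (GLO_almost_unitary HvE cV b0 N1); apply: mxgeW h; lia.
have h12 : GLO vE b -> adj z *m e + adj (v' - w) *m b = adj v' *m b.
  move=> [ub _ _]; rewrite adjB mulmxBl /w !adjM !adjK// -!mulmxA mulVmx// mulmx1.
  by rewrite addrC subrK.
(* only w contributes, as v' = 0 modulo pi^k, and push_through turns
   z^* z + pi w^* w into z'^* z' *)
have h11 : mxge vE d (adj b' *m b' - 1%:M) -> mxge vE k%:Z v' ->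
    mxge vE k%:Z (adj z *m z + p *: (adj (v' - w) *m (v' - w)) - C) <->
    mxge vE k%:Z (adj z' *m z' - C).
  move=> hb' vk; have Gb' := Gb hb'; have [ub _ bi0] := Gb'.
  have w0 : mxge vE 0 w.
    by apply: (mxgeMl HvE) => //; apply: (mxgeMl HvE) => //; exact: mxge_adj.
  have k0 : (0 : int) <= k%:Z by lia.
  have vw0 : mxge vE 0 (v' - w) := mxgeB HvE (mxgeW k0 vk) w0.
  have hP := push_through HvE cV vp e0 Gb' GT (bU.2 hb') hT.
  rewrite -/beta in hP.
  suff hd : mxge vE k%:Z (adj z *m z + p *: (adj (v' - w) *m (v' - w)) - adj z' *m z').
    split=> h.
      by rewrite -(subrKA (adj z *m z + p *: (adj (v' - w) *m (v' - w)))); apply: (mxgeD HvE) => //; exact: (mxgeBC HvE).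
    by rewrite -(subrKA (adj z' *m z')); exact: (mxgeD HvE).
  rewrite -(subrKA (adj z *m z + p *: (adj w *m w))); apply: (mxgeD HvE).
    rewrite opprD addrACA subrr add0r -scalerBr -[k%:Z]add0r; apply: (mxgeZ HvE) => //.
    have hvw : mxge vE k%:Z (v' - w - - w) by rewrite opprK subrK.
    have e1 : adj w *m w = adj (- w) *m (- w) by rewrite adjN mulNmx mulmxN opprK.
    rewrite e1; apply: (mxge_mulmx_cong HvE) => //.
      by apply: mxge_adj => //; exact: (mxgeN HvE).
    exact: mxge_adjB.
  have -> : adj z *m z + p *: (adj w *m w) - adj z' *m z' =
    adj z' *m (T *m (1%:M + p *: (e *m beta *m adj beta *m adj e)) *m adj T - 1%:M) *m z'.
    rewrite mulmxBr mulmx1 mulmxBl; congr (_ - _).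
    rewrite /w /z !adjM !adjK// mulmxDr mulmxDl mulmx1 mulmxDr mulmxDl.
    by rewrite -!(scalemxAl, scalemxAr) !mulmxA.
  apply: (mxgeMr HvE) => //; apply: (mxgeMl HvE); first exact: mxge_adj.
  by apply: mxgeW hP; lia.
have split_sol X11 X12 X21 X22 :
    mxge vE k%:Z (block_mx X11 X12 X21 X22 - B) <->
    [/\ mxge vE k%:Z (X11 - C), mxge vE k%:Z X12, mxge vE k%:Z X21 &
        mxge vE k%:Z (X22 - p^-1 *: 1%:M)].
  by rewrite opp_block_mx add_block_mx !oppr0 !addr0 mxge_block.
rewrite /solutions /= (hact_build conj p0) split_sol /unitary_mod /gram_solutions /= -dE.
split=> [[sX [c11 c12 _ c22]]|[[_ hz] hv [_ hb]]].
  have hb' := h22.1 c22; have Gb' := Gb hb'.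
  rewrite (h12 Gb') in c12.
  have vk : mxge vE k%:Z v'.
    have := c12; rewrite (GLO_mxger HvE _ _ Gb') => h.
    by rewrite -[v'](adjK cK); exact: mxge_adj.
  by split=> //; split=> //; exact/h11.
have Gb' := Gb hb; have [ub _ bi0] := Gb'.
have w0 : mxge vE 0 w.
  apply: (mxgeMl HvE) => //; apply: (mxgeMl HvE) => //; exact: mxge_adj.
have c12 : mxge vE k%:Z (adj z *m e + adj (v' - w) *m b).
  by rewrite h12//; apply: (mxgeMr HvE) => //; exact: mxge_adj.
have k0 : (0 : int) <= k%:Z by lia.
split; first exact: (build_support HvE vp z0 (mxgeB HvE (mxgeW k0 hv) w0) e0 b0).
split=> //; [exact/h11| |exact/h22].
have adj_sum (x y : 'M[E]_(m, n)) (s t : 'M[E]_n) :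
    adj (adj x *m y + adj s *m t) = adj y *m x + adj t *m s.
  by rewrite adjD !adjM !adjK.
by rewrite -adj_sum; exact: mxge_adj.
Qed.

Lemma gram_in_cong e e' : mxge vE 0 e -> mxge vE 0 e' -> mxge vE d (e - e') ->
  inner_sqrt e = inner_sqrt e' /\ outer_sqrt e = outer_sqrt e'.
Proof.
move=> e0 e0' he; have ha := mxge_adjB cV he.
have ae := mxge_adj cV e0; have ae' := mxge_adj cV e0'.
have cancel s (x y z : 'M[E]_s) : x - y - (x - z) = z - y.
  by rewrite opprB addrC addrA subrK.
split; apply: sqrt_mod_cong => //; rewrite -dE cancel -scalerBr -[d]add0r;
  by apply: (mxgeZ HvE) => //; apply: (mxge_mulmx_cong HvE) => //; exact: (mxgeBC HvE).
Qed.

(** Congruent matrices e have the same square roots, so the triangular change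
   of coordinates respects congruences. *)
Lemma assemble_cong z1 v1 e1 b1 z2 v2' e2 b2 :
  mxge vE 0 z1 -> mxge vE 0 z2 -> mxge vE 0 e1 -> mxge vE 0 e2 ->
  unitary_mod k.+1 b1 -> unitary_mod k.+1 b2 ->
  mxge vE d (assemble ((z1, v1), (e1, b1)) - assemble ((z2, v2'), (e2, b2))) <->
  [/\ mxge vE d (z1 - z2), mxge vE k%:Z (v1 - v2'), mxge vE d (e1 - e2) &
      mxge vE d (b1 - b2)].
Proof.
move=> z10 z20 e10 e20 [b10 U1] [b20 U2]; rewrite /assemble buildB mxge_build.
rewrite -!dE in U1 U2.
suff H : mxge vE d (e1 - e2) ->
  [/\ mxge vE d (adj (outer_sqrt e1) *m z1 - adj (outer_sqrt e2) *m z2),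
      mxge vE d (p *: (v1 - adj (invmx (b1 *m inner_sqrt e1)) *m adj e1 *m (adj (outer_sqrt e1) *m z1) -
                (v2' - adj (invmx (b2 *m inner_sqrt e2)) *m adj e2 *m (adj (outer_sqrt e2) *m z2))))
    & mxge vE d (b1 *m inner_sqrt e1 - b2 *m inner_sqrt e2)] <->
  [/\ mxge vE d (z1 - z2), mxge vE k%:Z (v1 - v2') & mxge vE d (b1 - b2)].
  by split=> [[h1 h2 h3 h4]|[h1 h2 h3 h4]]; have [] := H h3; [move=> /(_ _)[]|move=> _ /(_ _)[]].
move=> he; have [eS eT] := gram_in_cong e10 e20 he.
have sq1 := (sqrt_unitary e10 b10).2 U1; have sq2 := (sqrt_unitary e20 b20).2 U2.
have [GS _] := inner_sqrtP e10; have [GT _] := outer_sqrtP e10.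
have [_ N1] := gram_inP HvE cK cV vp e10; have [_ N2] := gram_inP HvE cK cV vp e20.
have [uS S0 _] := GS; have [uT T0 _] := GT.
rewrite -?eS -?eT in sq1 sq2 *; set S := inner_sqrt e1 in GS S0 sq1 sq2 *.
set T := outer_sqrt e1 in GT T0 *.
have G1 : GLO vE (b1 *m S).
  by apply: (GLO_almost_unitary HvE cV _ N1); [exact: (mxgeMl HvE)|apply: mxgeW sq1; lia].
have G2 : GLO vE (b2 *m S).
  by apply: (GLO_almost_unitary HvE cV _ N2); [exact: (mxgeMl HvE)|apply: mxgeW sq2; lia].
have [_ _ i10] := G1; have [_ _ i20] := G2.
have hz : mxge vE d (adj T *m z1 - adj T *m z2) <-> mxge vE d (z1 - z2).
  by rewrite -mulmxBr; exact: (GLO_mxgel HvE _ _ (GLO_adj cV GT)).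
have hb : mxge vE d (b1 *m S - b2 *m S) <-> mxge vE d (b1 - b2).
  by rewrite -mulmxBl; exact: (GLO_mxger HvE _ _ GS).
set w1 := _ *m _ *m (adj T *m z1); set w2 := _ *m _ *m (adj T *m z2).
have hw : mxge vE d (z1 - z2) -> mxge vE d (b1 - b2) -> mxge vE d (w1 - w2).
  move=> /hz h1 /hb /(GLO_inv_cong HvE G1 G2) h2; rewrite /w1 /w2.
  have hA := mxge_mulmx_cong HvE (mxge_adj cV i20) (mxge_adj cV e10)
    (mxge_adjB cV h2) (mxge_adjB cV he).
  have A0 := mxgeMl HvE (mxge_adj cV i20) (mxge_adj cV e20).
  have Z0 := mxgeMl HvE (mxge_adj cV T0) z10.
  exact: (mxge_mulmx_cong HvE A0 Z0 hA h1).
have sub4 (x y z t : 'M[E]_n) : x - y - (z - t) = (x - z) - (y - t).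
  by rewrite !opprB addrACA [RHS]addrACA [- y - z]addrC.
rewrite sub4; have hp := mxge_scale HvE k%:Z (v1 - v2' - (w1 - w2)) p0 vp.
have kd : k%:Z <= d by lia.
clearbody w1 w2; split=> [[/hz h1 /hp h2 /hb h3]|[h1 h2 h3]]; split.
- exact: h1.
- by have := mxgeD HvE h2 (mxgeW kd (hw h1 h3)); rewrite subrK.
- exact: h3.
- exact/hz.
- exact/hp/(mxgeB HvE h2 (mxgeW kd (hw h1 h3))).
- exact/hb.
Qed.

End SplitCount.

(** * Counting the solutions *)

Section Counting.
Variables (F : fieldType) (E : fieldExtType F).
Variables (vE : E -> int) (conj : 'AEnd(E)) (pi : F) (q : nat).
Hypothesis HvE : normalized_valuation vE.
Hypothesis cK : involutive conj.
Hypothesis cV : forall d x, vge vE d x -> vge vE d (conj x).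
Hypothesis two0 : (2 : E) != 0.
Hypothesis v2 : vE 2 = 0.
Local Notation adj := (adj conj).
Local Notation p := (pi%:A : E).
Local Notation herm k := (herm conj k).
Hypothesis p0 : p != 0.
Hypothesis vp : vE p = 1.
Hypothesis q_gt0 : (0 < q)%N.
Hypothesis idxM : forall m k d (N : nat),
  finmod (@mxge _ _ vE m k (d + N%:Z)) (mxge vE d) /\
  ncosets (@mxge _ _ vE m k (d + N%:Z)) (mxge vE d) = ((q ^ (2 * (m * k))) ^ N)%N.
Hypothesis idxV : forall k d (N : nat),
  finmod (hermge vE (d + N%:Z) : set (herm k)) (hermge vE d) /\
  ncosets (hermge vE (d + N%:Z) : set (herm k)) (hermge vE d) = ((q ^ (k ^ 2)) ^ N)%N.

Let subM m k d := @subgroup_mxge _ _ vE m k d HvE.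

Let subV k d := subgroup_hermge conj HvE k d.

Lemma finmod_mxge0 m k (N : nat) : finmod (@mxge _ _ vE m k N%:Z) (mxge vE 0).
Proof. by have [h _] := idxM m k 0 N; rewrite add0r in h. Qed.

Lemma ncosets_mxge0 m k (N : nat) :
  ncosets (@mxge _ _ vE m k N%:Z) (mxge vE 0) = ((q ^ (2 * (m * k))) ^ N)%N.
Proof. by have [_ h] := idxM m k 0 N; rewrite add0r in h. Qed.

Lemma finmod_gram_solutions m n k (C : 'M[E]_n) (N : nat) :
  finmod (@mxge _ _ vE m n N%:Z) (gram_solutions vE conj k C).
Proof.
by apply: (finmod_sub (subM _ _ _) _ (finmod_mxge0 _ _ _)) => z [].
Qed.

Lemma finmod_unitary_mod n d (N : nat) :
  finmod (@mxge _ _ vE n n N%:Z) (unitary_mod vE conj d).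
Proof.
by apply: (finmod_sub (subM _ _ _) _ (finmod_mxge0 _ _ _)) => z [].
Qed.

Lemma gram_shift m n (k : nat) (z D : 'M[E]_(m, n)) : mxge vE 0 z -> mxge vE k%:Z D ->
  mxge vE k%:Z (adj (z + D) *m (z + D) - adj z *m z).
Proof.
move=> z0 hD; have k0 : (0 : int) <= k%:Z by clear; lia.
have zD : mxge vE k%:Z (z + D - z) by rewrite addrC addKr.
exact: (mxge_mulmx_cong HvE (mxge_adj cV z0) (mxgeD HvE z0 (mxgeW k0 hD)) (mxge_adjB cV zD) zD).
Qed.

(** The condition on z only depends on z modulo pi^k. *)
Lemma ncosets_gram_refine m n k (C : 'M[E]_n) :
  ncosets (@mxge _ _ vE m n k.+1%:Z) (gram_solutions vE conj k C) =
  (ncosets (mxge vE k%:Z) (gram_solutions vE conj k C : set 'M[E]_(m, n)) * q ^ (2 * (m * n)))%N.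
Proof.
have [f1 e1] := idxM m n k%:Z 1; rewrite expn1 in e1.
have ek : k%:Z + 1%:Z = k.+1%:Z by clear; lia.
have k0 : (0 : int) <= k%:Z by clear; lia.
rewrite ek in f1 e1; rewrite -e1.
have [||_ ->//] := ncosets_chain (subM m n k%:Z) (subM m n k.+1%:Z) _ _ (finmod_gram_solutions m k C k) f1.
  by move=> X; apply: mxgeW; clear; lia.
move=> z D [z0 hz] hD; split; first exact: (mxgeD HvE z0 (mxgeW k0 hD)).
rewrite -(subrKA (adj z *m z)); exact: (mxgeD HvE (gram_shift z0 hD) hz).
Qed.

(** Hensel's lemma for the unitary group: (b, Y) |-> b (1 + Y)^(1/2) matches
   the solutions modulo pi with the solutions modulo pi^(k+1) together with a
   hermitian Y in pi V(O_E). *)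
Lemma ncosets_unitary n k :
  ncosets (mxge vE k.+1%:Z) (@unitary_mod _ _ vE conj n k.+1) =
  (ncosets (mxge vE 1) (@unitary_mod _ _ vE conj n 1) * (q ^ (n ^ 2)) ^ k)%N.
Proof.
pose d : int := k.+1%:Z.
pose S (Y : herm n) := sqrt_mod vE conj k.+1 (1%:M + (Y : 'M[E]_n)).
have [fV eV] := idxV n 1 k.
have dE : 1 + k%:Z = d by rewrite /d; clear; lia.
have d1 : 1 <= d by rewrite /d; clear; lia.
rewrite dE in fV eV.
have SP (Y : herm n) : hermge vE 1 Y -> GLO vE (S Y) /\
    mxge vE d (adj (S Y) *m S Y - (1%:M + (Y : 'M[E]_n))).
  move=> hY; apply: (sqrt_modP HvE cK cV two0 v2); first by rewrite adjD adj1 herm_adj.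
  by rewrite addrAC subrr add0r.
have SS (Y : herm n) (b : 'M[E]_n) : hermge vE 1 Y -> unitary_mod vE conj k.+1 b ->
    mxge vE d (adj (b *m S Y) *m (b *m S Y) - (1%:M + (Y : 'M[E]_n))).
  move=> hY [b0 hb]; have [[uS S0 _] hS] := SP Y hY.
  rewrite -(subrKA (adj (S Y) *m S Y)); apply: (mxgeD HvE _ hS).
  have -> : adj (b *m S Y) *m (b *m S Y) - adj (S Y) *m S Y =
      adj (S Y) *m (adj b *m b - 1%:M) *m S Y.
    by rewrite adjM mulmxBr mulmx1 mulmxBl !mulmxA.
  exact: (mxgeMr HvE (mxgeMl HvE (mxge_adj cV S0) hb) S0).
have [f1 e1] := ncosets_prod (subM n n d) (subV n d) (finmod_unitary_mod n k.+1 k.+1) fV.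
have [|||_ e2] := @ncosets_map _ _ (mxge vE d `*` hermge vE d : set ('M[E]_n * herm n)%type)
  (unitary_mod vE conj k.+1 `*` hermge vE 1) (mxge vE d) (unitary_mod vE conj 1)
  (fun x => x.1 *m S x.2) (subgroup_setX (subM n n d) (subV n d)) (subM n n d) f1.
- move=> [b Y] [/= hb hY]; have [[uS S0 _] hS] := SP Y hY.
  split; first by apply: (mxgeMl HvE _ S0); case: hb.
  have h := mxgeW d1 (SS Y b hY hb).
  have h' := mxgeD HvE h hY; move: h'; congr (mxge vE _ _).
  by rewrite opprD addrA subrK.
- move=> [b Y] [b' Y'] [/= hb hY] [/= hb' hY'].
  suff main : S Y = S Y' -> mxge vE d (b *m S Y - b' *m S Y') <-> mxge vE d (b - b').
    split=> [h|[/= h1 h2]]; last first.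
      apply/main => //; apply: sqrt_mod_cong => //.
      have h2' : mxge vE d ((Y - Y' : herm n) : 'M[E]_n) := h2.
      by rewrite herm_valB in h2'; rewrite opprD addrACA subrr add0r.
    have hYY : mxge vE d ((Y : 'M[E]_n) - (Y' : 'M[E]_n)).
      have [[_ S0 _] _] := SP Y hY; have [[_ S0' _] _] := SP Y' hY'.
      have X0 := mxgeMl HvE hb.1 S0; have X0' := mxgeMl HvE hb'.1 S0'.
      have hh := mxge_mulmx_cong HvE (mxge_adj cV X0') X0 (mxge_adjB cV h) h.
      have hs := SS Y b hY hb; have hs' := SS Y' b' hY' hb'.
      have hd := mxgeB HvE (mxgeD HvE hh hs') hs; move: hd; congr (mxge vE _ _).
      move: (adj (b *m _) *m _) (adj (b' *m _) *m _) (1%:M) => x x' o.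
      by apply/matrixP => i j; rewrite !mxE; ring.
    have eS : S Y = S Y'.
      by apply: sqrt_mod_cong => //; rewrite opprD addrACA subrr add0r.
    split=> /=; first exact/main.
    suff: mxge vE d ((Y - Y' : herm n) : 'M[E]_n) by [].
    by rewrite herm_valB.
  move=> <-; rewrite -mulmxBl; have [GS _] := SP Y hY.
  exact: (GLO_mxger HvE d (b - b') GS).
- move=> b [b0 hb].
  have [|Y eY] := @hermE _ _ conj n (adj b *m b - 1%:M).
    by rewrite adjB adj1 adjM adjK.
  have hY : hermge vE 1 Y by rewrite /hermge /= eY.
  have [GS hS] := SP Y hY; have [uS S0 Si0] := GS.
  exists (b *m invmx (S Y), Y); last by rewrite /= mulmxKV// subrr; exact: mxge0.
  split=> //=; split; first exact: (mxgeMl HvE).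
  have eb : 1%:M + (Y : 'M[E]_n) = adj b *m b by rewrite eY addrC subrK.
  rewrite eb in hS; have [uSa eSi] := adj_inv conj uS.
  have -> : adj (b *m invmx (S Y)) *m (b *m invmx (S Y)) - 1%:M =
      adj (invmx (S Y)) *m (adj b *m b - adj (S Y) *m S Y) *m invmx (S Y).
    rewrite adjM mulmxBr mulmxBl eSi !mulmxA mulVmx// mul1mx mulmxV//.
  exact: (mxgeMr HvE (mxgeMl HvE (mxge_adj cV Si0) (mxgeBC HvE hS)) Si0).
have e3 : ncosets (mxge vE d) (@unitary_mod _ _ vE conj n 1) =
    (ncosets (mxge vE 1) (@unitary_mod _ _ vE conj n 1) * (q ^ (2 * (n * n))) ^ k)%N.
  have [fM eM] := idxM n n 1 k; rewrite dE in fM eM.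
  rewrite -eM; have [||_ ->//] := ncosets_chain (subM n n 1) (subM n n d) _ _
    (finmod_unitary_mod n 1 1) fM.
    by move=> X; exact: mxgeW.
  move=> z D [z0 hz] hD; split; first exact: (mxgeD HvE z0 (mxgeW _ hD)).
  by rewrite -(subrKA (adj z *m z)); exact: (mxgeD HvE (gram_shift z0 hD) hz).
have Q0 : (0 < (q ^ (n ^ 2)) ^ k)%N by rewrite !expn_gt0 q_gt0.
apply/eqP; rewrite -(eqn_pmul2r Q0) -eV -e1 -e2 e3 -mulnA; apply/eqP; congr (_ * _)%N.
by rewrite eV -expnMn -expnD mulnn addnn mul2n.
Qed.

(** The map [assemble] is a bijection on classes from the quadruples
   (z', v', e, b') of [assemble_solutions]. *)
Lemma ncosets_solutions n r k (C : 'M[E]_n) :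
  ncosets (mxge vE (k%:Z + 1)) (@solutions _ _ vE conj pi n n n r
    (block_mx C 0 0 (p^-1 *: 1%:M)) k) =
  (ncosets (mxge vE k.+1%:Z) (gram_solutions vE conj k C : set 'M[E]_(n + 2 * r, n)) *
   ((q ^ (2 * ((n + 2 * r) * n))) ^ k.+1 *
    ncosets (mxge vE k.+1%:Z) (@unitary_mod _ _ vE conj n k.+1)))%N.
Proof.
set m := (n + 2 * r)%N.
have dE : k%:Z + 1 = k.+1%:Z by clear; lia.
have k0 : (0 : int) <= k%:Z by clear; lia.
have [fk ek] : finmod (@mxge _ _ vE n n k%:Z) (mxge vE k%:Z) /\
    ncosets (@mxge _ _ vE n n k%:Z) (mxge vE k%:Z) = 1%N.
  by have := idxM n n k%:Z 0; rewrite addr0 expn0.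
have [f1 e1] := ncosets_prod (subM m n k.+1%:Z) (subM n n k%:Z) (finmod_gram_solutions m k C k.+1) fk.
have [f2 e2] := ncosets_prod (subM m n k.+1%:Z) (subM n n k.+1%:Z) (finmod_mxge0 m n k.+1)
  (finmod_unitary_mod n k.+1 k.+1).
have s1 := subgroup_setX (subM m n k.+1%:Z) (subM n n k%:Z).
have s2 := subgroup_setX (subM m n k.+1%:Z) (subM n n k.+1%:Z).
have [f3 e3] := ncosets_prod s1 s2 f1 f2.
rewrite ek muln1 in e1; rewrite e1 e2 ncosets_mxge0 in e3; rewrite -e3.
apply: (ncosets_map (phi := assemble vE conj pi k (n := n) (r := r)) (subgroup_setX s1 s2)
  (subM _ _ _) f3 _ _ _).2.
- move=> [[z v] [e b]] [[/= hz hv] [/= he hb]].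
  by apply/(assemble_solutions HvE cK cV two0 v2 p0 vp k C v hz.1 he hb.1).
- move=> [[z v] [e b]] [[z' v'] [e' b']] [[/= hz hv] [/= he hb]] [[/= hz' hv'] [/= he' hb']].
  have H := assemble_cong HvE cK cV two0 v2 p0 vp v v' hz.1 hz'.1 he he' hb hb'.
  rewrite dE in H *; split=> [/H[]//|[[/= h1 h2] [/= h3 h4]]].
  exact/H.
- move=> X hX; have [z [v [e [b [eX [z0 v0 e0 b0]]]]]] := build_surj HvE p0 vp hX.1.
  have [GS _] := inner_sqrtP HvE cK cV two0 v2 vp k e0.
  have [GT _] := outer_sqrtP HvE cK cV two0 v2 vp k e0.
  set S := inner_sqrt _ _ _ _ _ in GS; set T := outer_sqrt _ _ _ _ _ in GT.
  have [uS S0 Si0] := GS; have [uTa Ta0 Tai0] := GLO_adj cV GT.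
  pose x : ('M[E]_(m, n) * 'M[E]_n) * ('M[E]_(m, n) * 'M[E]_n) :=
    ((invmx (adj T) *m z, v + adj (invmx b) *m adj e *m z), (e, b *m invmx S)).
  have ex : assemble vE conj pi k x = X.
    rewrite eX /x /assemble -/S -/T mulmxKV// mulKVmx//.
    by rewrite addrK.
  have z'0 := mxgeMl HvE Tai0 z0; have b'0 := mxgeMl HvE b0 Si0.
  have H := assemble_solutions HvE cK cV two0 v2 p0 vp k C
    (v + adj (invmx b) *m adj e *m z) z'0 e0 b'0.
  rewrite -/x ex in H; have [h1 h2 h3] := H.1 hX.
  by exists x; [|rewrite ex subrr; exact: mxge0].
Qed.

End Counting.

(** * Limits and polynomials in (-q)^(-2r) *)

Section Limits.
Variable R : realType.

(** A divergent sequence has the default value 0 as its limit, and remains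
   divergent when it is scaled by a nonzero constant. *)
Lemma clim_scale (c : R[i]) (u : nat -> R[i]) : c != 0 ->
  clim (fun k => c * u k) = c * clim u.
Proof.
move=> c0; rewrite /clim.
have [cu|ncu] := pselect (cvg ((u : nat -> R[i]^o) @ \oo)).
  have h := cvgZl_tmp (V := R[i]^o) (k := c) cu.
  exact: (cvg_lim (@norm_hausdorff _ (R[i]^o)) (h _)).
rewrite (dvgP ncu) (@dvgP (R[i]^o)); first by rewrite mulr0.
by have := @is_cvgZlE _ (R[i]^o) _ \oo _ c (u : nat -> R[i]^o) c0; move=> e cu; apply: ncu; rewrite -e.
Qed.

Lemma clim0 : clim (fun _ : nat => 0 : R[i]) = 0.
Proof. exact: (@norm_lim_cst _ (R[i]^o)). Qed.

Variable q : nat.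
Hypothesis q_gt1 : (1 < q)%N.

Lemma xpoly_nodes_inj : injective (fun r : nat => (- q%:R : R[i]) ^- (2 * r)).
Proof.
move=> r s /invr_inj; rewrite !exprM sqrrN -!exprM -!natrX => /eqP.
by rewrite eqr_nat => /eqP /(expnI q_gt1) /eqP; rewrite eqn_pmul2l// => /eqP.
Qed.

(** The nodes are infinite in number, as q > 1. *)
Lemma poly_eq_nodes (P Q : {poly R[i]}) :
  (forall r : nat, P.[(- q%:R) ^- (2 * r)] = Q.[(- q%:R) ^- (2 * r)]) -> P = Q.
Proof.
move=> h; apply/eqP; rewrite -subr_eq0; apply/negPn/negP => PQ0.
pose rs := [seq (- q%:R : R[i]) ^- (2 * r) | r <- iota 0 (size (P - Q))].
have hu : uniq rs by rewrite (map_inj_uniq xpoly_nodes_inj) iota_uniq.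
have ha : all (root (P - Q)) rs.
  by apply/allP => _ /mapP[r _ ->]; rewrite /root !hornerE h subrr.
by have := max_poly_roots PQ0 ha hu; rewrite size_map size_iota ltnn.
Qed.

Lemma xpolyP (f : nat -> R[i]) (P : {poly R[i]}) :
  (forall r : nat, P.[(- q%:R) ^- (2 * r)] = f r) -> xpoly q f = P.
Proof.
move=> hP; apply: poly_eq_nodes => r.
by rewrite hP; exact: (@xgetPex _ 0 [set P : {poly R[i]} | forall r, P.[(- q%:R) ^- (2 * r)] = f r] (ex_intro _ P hP)).
Qed.

(** If no polynomial interpolates f then none interpolates c f, and both
   derivatives are those of the default polynomial 0. *)
Lemma xderiv_scale (c : R[i]) (f : nat -> R[i]) : c != 0 ->
  xderiv q (fun r => c * f r) = c * xderiv q f.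
Proof.
move=> c0; rewrite /xderiv; suff -> : xpoly q (fun r => c * f r) = c *: xpoly q f.
  by rewrite derivZ hornerZ mulrN.
have [[P hP]|nP] := pselect (exists P : {poly R[i]}, forall r : nat, P.[(- q%:R) ^- (2 * r)] = f r).
  by rewrite (xpolyP hP); apply: xpolyP => r; rewrite hornerZ hP.
rewrite [xpoly q f]/xpoly xgetPN => [|P hP]; last by apply: nP; exists P.
rewrite scaler0 /xpoly xgetPN// => P hP; apply: nP; exists (c^-1 *: P) => r.
by rewrite hornerZ hP mulKf.
Qed.

End Limits.

(** * Invariance and vanishing of the solution sets *)

Section Vee.
Variables (F : fieldType) (E : fieldExtType F) (pi : F) (n : nat).
Local Notation p := (pi%:A : E).

(** For h = n the casts in [vee] are between equal dimensions. *)
Lemma vee_block (a b c d : 'M[E]_n) :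
  vee pi (leq_addr n n) (block_mx a b c d) = block_mx (p *: d) c b (p^-1 *: a).
Proof.
have H m (e : (n + n = m + n)%N) (e' : (n + m = n + n)%N) : m = n ->
    let X' := castmx (e, e) (block_mx a b c d) in
    castmx (e', e') (block_mx (p *: drsubmx X') (dlsubmx X') (ursubmx X')
      (p^-1 *: ulsubmx X')) = block_mx (p *: d) c b (p^-1 *: a).
  move=> em; move: e e'; rewrite em => e e' /=.
  by rewrite !castmx_id block_mxKdr block_mxKdl block_mxKur block_mxKul.
exact: (H (n + n - n)%N _ _ (addnK n n)).
Qed.

End Vee.

Section Solutions.
Variables (F : fieldType) (E : fieldExtType F).
Variables (vE : E -> int) (conj : 'AEnd(E)) (pi : F).
Hypothesis HvE : normalized_valuation vE.
Hypothesis cK : involutive conj.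
Hypothesis cV : forall d x, vge vE d x -> vge vE d (conj x).
Local Notation adj := (adj conj).
Local Notation p := (pi%:A : E).
Hypothesis p0 : p != 0.
Hypothesis vp : vE p = 1.
Hypothesis Mfin : forall m k (d e : int), e <= d -> finmod (@mxge _ _ vE m k d) (mxge vE e).

Lemma hact_mulr m k l (A : 'M[E]_m) (X : 'M[E]_(m, k)) (g : 'M[E]_(k, l)) :
  hact conj A (X *m g) = hact conj (hact conj A X) g.
Proof. by rewrite !hactE adjM !mulmxA. Qed.

Lemma solutions_mulr n t r k (B : 'M[E]_(n + n)) (g1 g2 : 'M[E]_n) X :
  mxge vE 0 g1 -> mxge vE 0 g2 ->
  @solutions _ _ vE conj pi n n t r B k X ->
  @solutions _ _ vE conj pi n n t r (hact conj B (block_mx g1 0 0 g2)) k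
    (X *m block_mx g1 0 0 g2).
Proof.
move=> g10 g20 [[X0 X1] hX]; set g := block_mx g1 0 0 g2.
have g0 : mxge vE 0 g by apply/mxge_block; split=> //; exact: mxge0.
split; [split; first exact: (mxgeMl HvE X0 g0)|].
  move=> i j hi hj; rewrite mxE; apply: (vge_sum HvE) => l _.
  have [ln|nl] := ltnP l n.
    by apply: (vgeMr HvE) => //; apply: X1 => //; rewrite addnK.
  rewrite /g mxE; case: splitP => l' el; first by move: nl; rewrite el leqNgt ltn_ord.
  rewrite mxE; case: splitP => j' ej; first by rewrite mxE mulr0; left.
  by move: hj; rewrite addnK ej ltnNge leq_addr.
rewrite hact_mulr; have -> : hact conj (hact conj (Atr E pi n t r) X) g - hact conj B g =
    adj g *m (hact conj (Atr E pi n t r) X - B) *m g.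
  by rewrite mulmxBr mulmxBl !(hactE conj _ g).
by apply: (mxgeMr HvE _ g0); apply: (mxgeMl HvE) => //; exact: mxge_adj.
Qed.

Lemma ncosets_solutions_mulr n t r k (B : 'M[E]_(n + n)) (g1 g2 : 'M[E]_n) d :
  0 <= d -> GLO vE g1 -> GLO vE g2 ->
  ncosets (mxge vE d) (@solutions _ _ vE conj pi n n t r (hact conj B (block_mx g1 0 0 g2)) k) =
  ncosets (mxge vE d) (@solutions _ _ vE conj pi n n t r B k).
Proof.
move=> d0 [u1 g10 gi10] [u2 g20 gi20]; set g := block_mx g1 0 0 g2.
pose h := block_mx (invmx g1) 0 0 (invmx g2).
have gh : g *m h = 1%:M.
  by rewrite mulmx_block !mulmx0 !mul0mx !addr0 !add0r !mulmxV// -scalar_mx_block.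
have hg : h *m g = 1%:M.
  by rewrite mulmx_block !mulmx0 !mul0mx !addr0 !add0r !mulVmx// -scalar_mx_block.
have g0 : mxge vE 0 g by apply/mxge_block; split=> //; exact: mxge0.
have h0 : mxge vE 0 h by apply/mxge_block; split=> //; exact: mxge0.
apply: (ncosets_map (phi := fun X => X *m g) (subgroup_mxge _ _ _ HvE) (subgroup_mxge _ _ _ HvE) _ _ _ _).2.
- by apply: (finmod_sub (subgroup_mxge _ _ _ HvE) _ (Mfin _ _ d0)) => X [[]].
- by move=> X; exact: solutions_mulr.
- move=> X Y _ _; rewrite -mulmxBl; split=> H; last exact: (mxgeMr HvE H g0).
  by rewrite -[X - Y]mulmx1 -gh mulmxA; exact: (mxgeMr HvE H h0).
- move=> X hX; exists (X *m h); last first.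
    by rewrite -mulmxA hg mulmx1 subrr; exact: mxge0.
  have := solutions_mulr gi10 gi20 hX; rewrite -/h.
  by rewrite !hactE -/g -!mulmxA gh mulmx1 !mulmxA -adjM gh adj1 mul1mx.
Qed.

Lemma Atr_entry n t r (i j : 'I_(n + n + 2 * r)) :
  Atr E pi n t r i j = (if (n + n - t <= i < n + n)%N then p^-1 else 1) *+ (i == j).
Proof.
rewrite /Atr mxE; case: splitP => a ea; rewrite mxE; case: splitP => b eb.
- rewrite !mxE -(val_eqE i j) /= ea eb val_eqE; case: eqP => [_|_]; last by rewrite !mulr0n.
  by rewrite andbT; case: (ltnP a (n + n - t)).
- rewrite mxE (_ : (i == j) = false)// -val_eqE /= ea eb; apply/negbTE.
  by have := ltn_ord a; lia.
- rewrite mxE (_ : (i == j) = false)// -val_eqE /= ea eb; apply/negbTE.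
  by have := ltn_ord b; lia.
- rewrite mxE -(val_eqE i j) /= ea eb eqn_add2l val_eqE.
  by rewrite andbF.
Qed.

(** Modulo pi the form pi A_t has rank t < n, so it cannot represent the
   invertible form 1_n: A_t does not represent diag(C, pi^-1 1_n). *)
Lemma solutions_empty n t r k h (C : 'M[E]_n) : (t < n)%N ->
  @solutions _ _ vE conj pi n h t r (block_mx C 0 0 (p^-1 *: 1%:M)) k = set0.
Proof.
move=> tn; rewrite -subset0 => X [[X0 _] hX].
pose N := (n + n + 2 * r)%N; pose s := (n + n - t)%N.
pose J : 'M[E]_(n + n, n) := col_mx 0 1%:M.
pose Y := X *m J.
have J0 : mxge vE 0 J by apply/mxge_col; split; [exact: mxge0|exact: mxge1].
have Y0 : mxge vE 0 Y := mxgeMl HvE X0 J0.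
have aY0 := mxge_adj cV Y0.
have hY : mxge vE 0 (hact conj (Atr E pi n t r) Y - p^-1 *: 1%:M).
  have -> : hact conj (Atr E pi n t r) Y - p^-1 *: 1%:M =
      adj J *m (hact conj (Atr E pi n t r) X - block_mx C 0 0 (p^-1 *: 1%:M)) *m J.
    rewrite mulmxBr mulmxBl /Y hact_mulr hactE; congr (_ - _).
    rewrite /J adj_col adj0 adj1 mul_row_block !mul0mx !add0r mulmx0 mul1mx.
    by rewrite mul_row_col mul0mx add0r mulmx1.
  apply: (mxgeMr HvE _ J0); apply: (mxgeMl HvE (mxge_adj cV J0)).
  by apply: mxgeW hX; lia.
(* L L^T is the reduction of pi A_t: the coordinate projection on the last t
   rows of the first 2n *)
pose L : 'M[E]_(N, t) := \matrix_(i, l) ((i : nat) == s + l)%N%:R.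
have hL : mxge vE 1 (p *: Atr E pi n t r - L *m L^T).
  have entry (A : 'M[E]_N) i j :
      (p *: A - L *m L^T) i j = p * A i j - \sum_l L i l * L^T l j by rewrite !mxE.
  move=> i j; rewrite entry Atr_entry.
  have e : \sum_l L i l * L^T l j = ((s <= i < n + n)%N && (i == j))%:R.
    have [ir|ir] := boolP (s <= i < n + n)%N; last first.
      apply: big1 => l _; rewrite !mxE [(i : nat) == _](_ : _ = false) ?mul0r//.
      by apply/negbTE; move: ir; rewrite /s; have := ltn_ord l; lia.
    have lt : (i - s < t)%N by move: ir; rewrite /s; lia.
    rewrite (bigD1 (Ordinal lt))//= big1 => [|l hl].
      rewrite !mxE /= subnKC; last by case/andP: ir.
      by rewrite eqxx mul1r addr0 eq_sym val_eqE.
    rewrite !mxE [(i : nat) == _](_ : _ = false) ?mul0r//; apply/negbTE.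
    by apply: contra hl => /eqP e; rewrite -val_eqE /= e addKn.
  rewrite e; case: eqP => [_|_]; last by rewrite mulr0n mulr0 andbF subr0; left.
  rewrite mulr1n andbT; case: ifP => _; first by rewrite mulfV// subrr; left.
  by rewrite mulr1 subr0; right; rewrite vp.
have hD : mxge vE 1 (adj Y *m (L *m L^T) *m Y - 1%:M).
  have -> : adj Y *m (L *m L^T) *m Y - 1%:M =
     p *: (hact conj (Atr E pi n t r) Y - p^-1 *: 1%:M) -
     adj Y *m (p *: Atr E pi n t r - L *m L^T) *m Y.
    rewrite hactE scalerBr scalerA mulfV// scale1r mulmxBr mulmxBl -scalemxAr -scalemxAl.
    have cancel (x y z : 'M[E]_n) : x - y - (x - z) = z - y.
      by rewrite opprB addrCA [x - y - x]addrAC subrr add0r.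
    by rewrite cancel.
  apply: (mxgeB HvE); last exact: (mxgeMr HvE (mxgeMl HvE aY0 hL) Y0).
  by rewrite -[1]addr0; apply: (mxgeZ HvE) => //; right; rewrite vp.
have L0 : mxge vE 0 (L *m L^T).
  apply: (mxgeMl HvE) => i j; rewrite !mxE; case: eqP => _; try exact: vge01; by left.
have d0 : mxge vE 0 (adj Y *m (L *m L^T) *m Y) := mxgeMr HvE (mxgeMl HvE aY0 L0) Y0.
have := mxge_det_cong HvE d0 (mxge1 HvE (k := n)) hD; rewrite det1 => hdet.
have [det0 _] := unit_perturb HvE hdet (oner_neq0 _) (val1 HvE).
have ur : adj Y *m (L *m L^T) *m Y \in unitmx by rewrite unitmxE unitfE.
have := mxrank_unit ur; have : (\rank (adj Y *m (L *m L^T) *m Y) <= t)%N.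
  by rewrite [adj Y *m _]mulmxA -[_ *m Y]mulmxA; exact: mulmx_max_rank.
by move=> h1 h2; move: h1; rewrite h2; lia.
Qed.

End Solutions.

(** * Whittaker functions and local densities *)

Section Densities.
Variable R : realType.
Variables (F : fieldType) (E : fieldExtType F).
Variables (vF : F -> int) (vE : E -> int) (conj : 'AEnd(E)) (pi : F) (eps : E).
Hypothesis HvF : normalized_valuation vF.
Hypothesis HuE : unramified vF vE.
Hypothesis cK : involutive conj.
Hypothesis cV : forall d x, vge vE d x -> vge vE d (conj x).
Hypothesis cfix : forall x, conj x = x -> exists a, x = a%:A.
Hypothesis piU : uniformizer vF pi.
Hypothesis two0 : (2 : E) != 0.
Hypothesis v2 : vE 2 = 0.
Hypothesis eps0 : eps != 0.
Hypothesis veps : vE eps = 0.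
Hypothesis ceps : conj eps = - eps.
Hypothesis Ffin : finmod (vge vF 1) (vge vF 0).

Local Notation q := (residue_card vF).
Local Notation adj := (adj conj).
Local Notation p := (pi%:A : E).
Local Notation herm k := (herm conj k).

Let HvE : normalized_valuation vE. Proof. by case: HuE. Qed.

Let p0 : p != 0.
Proof. by case: piU => pi0 _; rewrite scaler_eq0 oner_eq0 orbF. Qed.

Let vp : vE p = 1.
Proof. by case: piU => pi0 vpi; case: HuE => _ /(_ _ pi0) ->. Qed.

Lemma residue_card_gt1 : (1 < q)%N.
Proof.
case: Ffin => T [s hs].
rewrite /residue_card (transversal_card (subgroup_vge 1 HvF) hs).
(* the classes of 0 and 1 differ *)
have [_ _ ss] := hs; have [t0 h0] := ss _ (vge0 vF 0); have [t1 h1] := ss _ (vge01 HvF).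
apply/card_gt1P; exists t0, t1; split=> //; apply/negP => /eqP e; apply: (not_vge11 HvF).
by have := vgeB HvF h1 h0; rewrite e sub0r opprK subrK.
Qed.

Let q_gt0 : (0 < q)%N. Proof. exact: ltnW residue_card_gt1. Qed.

Let leM m k (d e : int) : e <= d -> @mxge _ _ vE m k d `<=` mxge vE e.
Proof. by move=> ed X; exact: mxgeW. Qed.

Let leV k (d e : int) : e <= d -> (hermge vE d : set (herm k)) `<=` hermge vE e.
Proof. by move=> ed X; exact: mxgeW. Qed.

Let subM m k d := @subgroup_mxge _ _ vE m k d HvE.
Let subV k d := subgroup_hermge conj HvE k d.
Let stepM m k := index_mxge HvF HuE cK cV cfix piU two0 v2 eps0 veps ceps Ffin m k.
Let stepV k := index_hermge HvF HuE cK cV cfix piU two0 v2 eps0 veps ceps Ffin k.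
Let idxM m k := filtration_index (subM m k) (@leM m k) (stepM m k).
Let idxV k := filtration_index (subV k) (@leV k) (stepV k).
Let Mfin m k (d e : int) (h : e <= d) := filtration_finmod (subM m k) (@leM m k) (stepM m k) h.
Let Vfin k (d e : int) (h : e <= d) := filtration_finmod (subV k) (@leV k) (stepV k) h.

Variable psi : F -> R[i].
Hypothesis psi_additive : forall x y, psi (x + y) = psi x * psi y.
Hypothesis psi_trivial : forall x, vge vF 0 x -> psi x = 1.
Hypothesis psi_nontrivial : exists2 x, vge vF 0 x & psi (pi^-1 * x) != 1.
Variables (muM : forall m k, {measure set (borel (@mxge _ _ vE m k)) -> \bar R})
  (muV : forall k, {measure set (borel (@hermge _ _ vE conj k)) -> \bar R}).
Hypothesis muM_haar : forall m k, normalized_haar (muM m k).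
Hypothesis muV_haar : forall k, normalized_haar (muV k).

Lemma lattice_volM (m k : nat) d : lattice_vol (@mxge _ _ vE m k) R d =
  (q ^ (2 * (m * k)))%N%:R ^ (- d).
Proof.
apply: (filtration_lattice_vol (subM m k) (@leM m k) (stepM m k)).
by rewrite expn_gt0 q_gt0.
Qed.

Lemma lattice_volV (k : nat) d : lattice_vol (@hermge _ _ vE conj k) R d =
  (q ^ (k ^ 2))%N%:R ^ (- d).
Proof.
apply: (filtration_lattice_vol (subV k) (@leV k) (stepV k)).
by rewrite expn_gt0 q_gt0.
Qed.

Lemma Whittaker_limit n h t r (B : 'M[E]_(n + n)) : adj B = B ->
  W pi psi muM muV h t B r = clim (fun k : nat =>
    (ncosets (mxge vE (k%:Z + 1)) (@solutions _ _ vE conj pi n h t r B k))%:R *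
    (lattice_vol (@mxge _ _ vE (n + n + 2 * r) (n + n)) R (k%:Z + 1))%:C *
    (lattice_vol (@hermge _ _ vE conj (n + n)) R (- k%:Z))%:C).
Proof.
move=> hB; rewrite /W; congr (clim _); apply/funext => k.
exact: (Whittaker_term HvF HuE cK cV cfix piU two0 v2 psi_additive psi_trivial
  psi_nontrivial muM_haar muV_haar (fun m k d e => @Mfin m k d e) (fun k d e => @Vfin k d e) h t r hB k).
Qed.

Lemma Whittaker_invariant n t r (B : 'M[E]_(n + n)) (g1 g2 : 'M[E]_n) :
  adj B = B -> GLO vE g1 -> GLO vE g2 ->
  W pi psi muM muV n t (hact conj B (block_mx g1 0 0 g2)) r = W pi psi muM muV n t B r.
Proof.
move=> hB G1 G2; have hB' := adj_hact cK (block_mx g1 0 0 g2) hB.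
rewrite (Whittaker_limit n t r hB) (Whittaker_limit n t r hB').
congr (clim _); apply/funext => k; have k0 : 0 <= k%:Z + 1 by lia.
by rewrite (ncosets_solutions_mulr pi HvE cV (fun m k d e => @Mfin m k d e) t r k B k0 G1 G2).
Qed.

Section Dual.
Variables (n : nat) (C : 'M[E]_n).
Hypothesis hC : adj C = C.
Local Notation B := (block_mx C 0 0 (p^-1 *: 1%:M) : 'M[E]_(n + n)).

Lemma adj_dual : adj B = B.
Proof.
rewrite adj_block hC !adj0 adjZ adj1; congr (block_mx _ _ _ (_ *: _)).
by rewrite fmorphV /= conj_in_alg.
Qed.

Lemma Whittaker_vanish h t r : (t < n)%N -> W pi psi muM muV h t B r = 0.
Proof.
move=> tn; rewrite Whittaker_limit; last exact: adj_dual.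
rewrite (_ : (fun k : nat => _) = (fun=> 0)); first exact: clim0.
apply/funext => k; rewrite (solutions_empty HvE cV p0 vp)//.
have h0 : transversal (mxge vE (k%:Z + 1)) (set0 : set 'M[E]_(n + n + 2 * r, n + n))
    (fun i : 'I_0 => 0).
  by split=> [[]|[]|].
by rewrite (transversal_card (subM _ _ _) h0) card_ord !mul0r.
Qed.

(** u_1 q^(-4 n^2), where u_1 is the order of the unitary group over the
   residue field of E. *)
Definition unitary_factor : R[i] :=
  (ncosets (mxge vE 1) (@unitary_mod _ _ vE conj n 1))%:R * q%:R ^- (4 * n ^ 2).

Lemma unitary_factor_neq0 : unitary_factor != 0.
Proof.
rewrite mulf_neq0 ?invr_eq0 ?expf_eq0 ?pnatr_eq0 ?negb_and -?lt0n ?q_gt0 ?orbT//.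
apply: (ncosets_neq0 (x := 1%:M) (subM _ _ _)).
  exact: (finmod_unitary_mod conj HvE (fun m k d N => idxM m k d N) n 1 1).
by split; [exact: mxge1|rewrite adj1 mulmx1 subrr; exact: mxge0].
Qed.

(** By [ncosets_solutions] the k-th terms of both limits count the same
   matrices z' with z'^* z' = C modulo pi^k, up to the approximately unitary
   b', whose number is u_1 q^(k n^2), and free variables. The powers of q
   combine to q^(-4 n^2): they depend neither on k nor on r, so the factor
   passes through the limit and later through the derivative. *)
Lemma Whittaker_dual r : W pi psi muM muV n n B r =
  unitary_factor * alpha R vF vE conj (block_mx 1%:M 0 0 1%:M : 'M[E]_(n + 2 * r)) C.
Proof.
rewrite (Whittaker_limit _ _ _ adj_dual) /alpha -clim_scale; last exact: unitary_factor_neq0.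
congr (clim _); apply/funext => k.
rewrite (ncosets_solutions HvE cK cV two0 v2 p0 vp (fun m k d N => idxM m k d N)).
rewrite (ncosets_gram_refine HvE cV (fun m k d N => idxM m k d N)).
rewrite (ncosets_unitary HvE cK cV two0 v2 q_gt0 (fun m k d N => idxM m k d N) (fun k d N => idxV k d N)).
rewrite lattice_volM lattice_volV -scalar_mx_block.
have -> : [set X : 'M[E]_(n + 2 * r, n) | mxge vE 0 X /\
    mxge vE k%:Z (hact conj 1%:M X - C)] = gram_solutions vE conj k C.
  by apply/seteqP; split=> X; rewrite /gram_solutions /= hactE mulmx1.
rewrite /unitary_factor.
set Z := (ncosets _ (gram_solutions _ _ _ _)); set u := ncosets _ (unitary_mod _ _ _).
have qc0 : (q%:R : R[i]) != 0 by rewrite pnatr_eq0 -lt0n q_gt0.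
rewrite !(fmorphXz (real_complex R)) !(rmorph_nat (real_complex R)).
rewrite !natrM !natrX !exprnP !exprz_exp.
rewrite [LHS](_ : _ = Z%:R * u%:R * (q%:R ^ (2 * ((n + 2 * r) * n))%N%:Z *
   q%:R ^ ((2 * ((n + 2 * r) * n))%N%:Z * k.+1%:Z) * q%:R ^ ((n ^ 2)%N%:Z * k%:Z) *
   q%:R ^ ((2 * ((n + n + 2 * r) * (n + n)))%N%:Z * - (k%:Z + 1)) *
   q%:R ^ (((n + n) ^ 2)%N%:Z * - - k%:Z))); last by ring.
rewrite -!expfzDr//.
rewrite [RHS](_ : _ = Z%:R * u%:R * (q%:R ^ (- (4 * n ^ 2)%N%:Z) *
   q%:R ^ (- ((k * n)%:Z * ((2 * (n + 2 * r))%:Z - n%:Z))))); last first.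
  by rewrite exprnN; ring.
rewrite -expfzDr//; congr (_ * _ ^ _).
rewrite -!mulnn -addn1 !(PoszD, PoszM); ring.
Qed.

End Dual.
End Densities.

Unset Implicit Arguments.

Theorem theorem3p24 (R : realType) (p : nat)
    (Qp : fieldType) (vp : Qp -> int)
    (F : fieldExtType Qp) (vF : F -> int)
    (E : fieldExtType F) (vE : E -> int)
    (conj : 'AEnd(E)) (pi : F) (psi : F -> R[i])
    (muM : forall m k, {measure set (borel (@mxge _ _ vE m k)) -> \bar R})
    (muV : forall k, {measure set (borel (@hermge _ _ vE conj k)) -> \bar R})
    (n : nat) (beta : {ffun 'I_n -> R[i]}) (delta : R[i])
    (p_prime : prime p) (p_odd : odd p)
    (Qp_padic : is_Qp p vp)
    (F_unramified : unramified vp vF)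
    (E_unramified : unramified vF vE)
    (E_quadratic : \dim {:E} = 2%N)
    (conj_nontrivial : conj != \1%AF)
    (pi_uniformizer : uniformizer vF pi)
    (psi_neq0 : forall x, psi x != 0)
    (psi_additive : forall x y, psi (x + y) = psi x * psi y)
    (psi_trivial : forall x, vge vF 0 x -> psi x = 1)
    (psi_nontrivial : exists2 x, vge vF 0 x & psi (pi^-1 * x) != 1)
    (muM_haar : forall m k, normalized_haar (muM m k))
    (muV_haar : forall k, normalized_haar (muV k))
    (n_ge1 : (1 <= n)%N)
    (beta_delta_unique :
       unique (constants_eq vF pi psi muM muV (leq_addr n n))
         (beta, beta, delta)) :
  let J := calJ vF pi psi muM muV beta in
  [/\ forall (B : 'M[E]_(n + n)) (g1 g2 : 'M[E]_n),
        nondeg_herm conj B -> GLO vE g1 -> GLO vE g2 ->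
        J (hact conj B (block_mx g1 0 0 g2)) = J B,
      forall B : 'M[E]_(n + n), nondeg_herm conj B ->
        J B = J (vee pi (leq_addr n n) B) &
      forall B2 : 'M[E]_n, nondeg_herm conj B2 ->
        J (block_mx 1%:M 0 0 B2) =
        alpha' R vF vE conj (1%:M : 'M[E]_n) (pi%:A *: B2)
          / alpha R vF vE conj (1%:M : 'M[E]_n) (1%:M : 'M[E]_n)].
Proof.
move=> J.
have [HvF hFp] := F_unramified; have [_ hEF] := E_unramified.
have [Hvp hnat _ Hcp] := Qp_padic.
have HcF := unramified_complete Hvp F_unramified Hcp.
have p_neq2 : p != 2 by apply: contraTneq p_odd => ->.
have two0p : (2 : Qp) != 0 by exact: (padic_nat_neq0 p_prime Qp_padic (m := 2)).
have v2p : vp 2 = 0.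
  by rewrite (hnat 2%N)// (logn_prime p (isT : prime 2)) (negbTE p_neq2).
have two0F : (2 : F) != 0.
  have -> : (2 : F) = 2%:A by rewrite scaler_nat.
  by rewrite scaler_eq0 oner_eq0 orbF.
have v2F : vF 2 = 0.
  have -> : (2 : F) = 2%:A by rewrite scaler_nat.
  by rewrite hFp.
have two0 : (2 : E) != 0.
  have -> : (2 : E) = 2%:A by rewrite scaler_nat.
  by rewrite scaler_eq0 oner_eq0 orbF.
have v2 : vE 2 = 0.
  have -> : (2 : E) = 2%:A by rewrite scaler_nat.
  by rewrite hEF.
have cK := conjK E_quadratic conj_nontrivial.
have cV := vge_conj HvF HcF E_unramified E_quadratic conj_nontrivial.
have cfix := conj_fixed E_quadratic conj_nontrivial.
have [eps [eps0 veps ceps]] := exists_antifixed HvF E_unramified E_quadratic conj_nontrivial two0F.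
have Ffin : finmod (vge vF 1) (vge vF 0).
  have [T [s hs]] := residue_finite Hvp F_unramified
    (fun a a0 => padic_residue_finite p_prime Qp_padic a0).
  exact: (finmod_cover (subgroup_vge 1 HvF) hs).
have q_gt1 := residue_card_gt1 HvF Ffin.
have [pi0 vpi] := pi_uniformizer.
have piE0 : (pi%:A : E) != 0 by rewrite scaler_eq0 oner_eq0 orbF.
have inv t r (B : 'M[E]_(n + n)) (g1 g2 : 'M[E]_n) : adj conj B = B ->
    GLO vE g1 -> GLO vE g2 ->
    W pi psi muM muV n t (hact conj B (block_mx g1 0 0 g2)) r = W pi psi muM muV n t B r.
  exact: (Whittaker_invariant HvF E_unramified cK cV cfix pi_uniformizer two0 v2 eps0 veps ceps
    Ffin psi_additive psi_trivial psi_nontrivial muM_haar muV_haar).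
have dual (C : 'M[E]_n) r : adj conj C = C ->
    W pi psi muM muV n n (block_mx C 0 0 (pi%:A^-1 *: 1%:M)) r =
    unitary_factor R vF vE conj n *
    alpha R vF vE conj (block_mx 1%:M 0 0 1%:M : 'M[E]_(n + 2 * r)) C.
  move=> hC; exact: (Whittaker_dual HvF E_unramified cK cV cfix pi_uniformizer two0 v2 eps0 veps ceps
    Ffin psi_additive psi_trivial psi_nontrivial muM_haar muV_haar hC).
have vanish (C : 'M[E]_n) t r : adj conj C = C -> (t < n)%N ->
    W pi psi muM muV n t (block_mx C 0 0 (pi%:A^-1 *: 1%:M)) r = 0.
  move=> hC; exact: (Whittaker_vanish HvF E_unramified cK cV cfix pi_uniformizer two0 v2 eps0 veps ceps
    Ffin psi_additive psi_trivial psi_nontrivial muM_haar muV_haar hC).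
have K0 : unitary_factor R vF vE conj n != 0.
  exact: (unitary_factor_neq0 R HvF E_unramified cK cV cfix pi_uniformizer two0 v2 eps0 veps ceps Ffin n).
have AtE : At E pi n n = block_mx 1%:M 0 0 (pi%:A^-1 *: 1%:M).
  by rewrite At_block scalemx1.
have At_nondeg : nondeg_herm conj (At E pi n n).
  split; first by apply/hermmxE; rewrite AtE; apply: adj_dual; exact: adj1.
  rewrite AtE unitmxE det_ublock det1 mul1r detZ det1 mulr1 unitfE.
  by rewrite expf_neq0// invr_eq0.
have vee_At : vee pi (leq_addr n n) (At E pi n n) = At E pi n n.
  by rewrite AtE vee_block scalerA mulfV// scale1r.
have ceq (B : 'M[E]_(n + n)) : nondeg_herm conj B ->
    W' vF pi psi muM muV n n B - W' vF pi psi muM muV n n (vee pi (leq_addr n n) B) =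
    \sum_(i < n) beta i * W pi psi muM muV n i B 0
    - \sum_(j < n) beta j * W pi psi muM muV n j (vee pi (leq_addr n n) B) 0
    + delta * W pi psi muM muV n n B 0.
  by move=> hB; have := beta_delta_unique.1 B hB; rewrite addnK.
(* As A_n^vee = A_n, the relation at A_n reads 0 = delta W(A_n, 0). Either
   delta = 0, or W(A_n, 0) = 0 and then its inverse is 0, and so is J. *)
have Jvee B : nondeg_herm conj B -> J B = J (vee pi (leq_addr n n) B).
  move=> hB; apply/eqP; rewrite -subr_eq0 /J /calJ -mulrBr; apply/eqP.
  have h1 := ceq B hB; have h2 := ceq _ At_nondeg.
  rewrite vee_At !subrr add0r in h2.
  move/esym/eqP: h2; rewrite mulf_eq0 => /orP[/eqP d0|/eqP W0]; last first.
    by rewrite W0 invr0 mul0r.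
  rewrite d0 mul0r addr0 in h1.
  have sub4 (a b c e : R[i]) : a - b - (c - e) = (a - c) - (b - e) by ring.
  by rewrite sub4 h1 subrr mulr0.
split.
- move=> B g1 g2 [hB uB] G1 G2.
  have hB' : adj conj B = B by apply/hermmxE.
  have eW i : W pi psi muM muV n i (hact conj B (block_mx g1 0 0 g2)) =
      W pi psi muM muV n i B by apply/funext => r; exact: inv.
  have eW' : W' vF pi psi muM muV n n (hact conj B (block_mx g1 0 0 g2)) =
      W' vF pi psi muM muV n n B := congr1 (xderiv (residue_card vF)) (eW n).
  have eS : \sum_(i < n) beta i * W pi psi muM muV n i (hact conj B (block_mx g1 0 0 g2)) 0 =
      \sum_(i < n) beta i * W pi psi muM muV n i B 0.
    by apply: eq_bigr => i _; rewrite (congr1 (fun f => f 0%N) (eW i)).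
  exact: (congr2 (fun a b => (W pi psi muM muV n n (At E pi n n) 0)^-1 * (a - b)) eW' eS).
- exact: Jvee.
- move=> B2 [hB2 uB2].
  have hB2' : adj conj B2 = B2 by apply/hermmxE.
  have hC : adj conj (pi%:A *: B2) = pi%:A *: B2 by rewrite adjZ hB2' conj_in_alg.
  have hB : nondeg_herm conj (block_mx 1%:M 0 0 B2 : 'M[E]_(n + n)).
    split; last by rewrite unitmxE det_ublock det1 mul1r -unitmxE.
    by apply/hermmxE; rewrite adj_block adj1 !adj0 hB2'.
  have dim m : m = n -> alpha R vF vE conj (1%:M : 'M[E]_m) (1%:M : 'M[E]_n) =
      alpha R vF vE conj (1%:M : 'M[E]_n) (1%:M : 'M[E]_n) by move=> ->.
  have WAt : W pi psi muM muV n n (At E pi n n) 0 =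
      unitary_factor R vF vE conj n * alpha R vF vE conj (1%:M : 'M[E]_n) (1%:M : 'M[E]_n).
    rewrite AtE (dual _ 0%N (adj1 conj n)) -scalar_mx_block; congr (_ * _).
    by apply: dim; rewrite muln0 addn0.
  have Wdual : W' vF pi psi muM muV n n (block_mx (pi%:A *: B2) 0 0 (pi%:A^-1 *: 1%:M)) =
      unitary_factor R vF vE conj n * alpha' R vF vE conj (1%:M : 'M[E]_n) (pi%:A *: B2).
    rewrite /W' /alpha' -(xderiv_scale q_gt1 _ K0); congr (xderiv _ _).
    by apply/funext => r; exact: dual.
  (* B^vee = diag(pi B2, pi^-1 1_n) *)
  rewrite (Jvee _ hB) vee_block /J /calJ WAt Wdual big1 => [|i _]; last first.
    by rewrite (vanish _ _ _ hC (ltn_ord i)) mulr0.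
  by rewrite subr0 invfM mulrACA (mulVf K0) mul1r mulrC.
Qed.
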